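(* Let $\mathcal M$ be an o-minimalistic structure. If $f\colon Y\to Y$ is a definable injective map, for some definable $Y\subseteq M^n$, whose image is co-discrete, meaning that $Y\setminus f(Y)$ is discrete, then $f$ is a bijection. In particular, any definable map $D\to D$ from a definable discrete subset $D\subseteq M^n$ to itself is injective if and only if it is surjective.
   Context: Let $L$ be a first-order language containing a binary relation symbol $<$; all $L$-structures are assumed to be dense linear orders without endpoints, with the order topology (and product topology on $M^n$). Definable means definable with parameters. An $L$-structure is o-minimal if every definable subset of its universe is a finite union of points and open intervals. An $L$-structure is o-minimalistic if it satisfies every $L$-sentence that holds in every o-minimal $L$-structure. Discrete means discrete in the subspace topology (the empty set is discrete). *)

(* Defs.v *)
From mathcomp Require Import all_boot all_order interval.
From mathcomp Require Import all_classical.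
From mathcomp Require Import topology.
Set Implicit Arguments.
Unset Strict Implicit.
Unset Printing Implicit Defensive.

Local Open Scope classical_set_scope.

(* Symbols are sorted by arity; constants are the function symbols of arity 0. *)
Record language := Language {
  fun_symbol : nat -> Type;
  rel_symbol : nat -> Type;
  lt_symbol : rel_symbol 2
}.

(* Terms and formulas with free variables among x_0, ..., x_(n-1), represented
   by 'I_n.  Equality is a logical symbol.  Under a quantifier, index 0 is the
   bound variable and the outer variables are shifted by one. *)
Inductive term (L : language) (n : nat) : Type :=
| Var of 'I_n
| App k of fun_symbol L k & ('I_k -> term L n).

Inductive formula (L : language) : nat -> Type :=
| Bot n : formula L n
| Eq n : term L n -> term L n -> formula L n
| Rel n k : rel_symbol L k -> ('I_k -> term L n) -> formula L n
| Imp n : formula L n -> formula L n -> formula L n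
| All n : formula L n.+1 -> formula L n.

Definition sentence (L : language) := formula L 0.

(* Every structure is a nonempty dense linear order without endpoints. *)
Record structure (L : language) := Structure {
  carrier_disp : Order.disp_t;
  carrier :> orderType carrier_disp;
  fun_interp : forall k, fun_symbol L k -> ('I_k -> carrier) -> carrier;
  rel_interp : forall k, rel_symbol L k -> set ('I_k -> carrier);
  lt_interp : forall a : 'I_2 -> carrier,
    rel_interp (lt_symbol L) a <-> (a ord0 < a ord_max)%O;
  carrier_inhabited : inhabited carrier;
  lt_dense : forall x y : carrier, (x < y)%O -> exists z, (x < z)%O /\ (z < y)%O;
  no_least : forall x : carrier, exists y, (y < x)%O;
  no_greatest : forall x : carrier, exists y, (x < y)%O
}.

Section Semantics.
Context {L : language} {M : structure L}.

Fixpoint eval n (e : 'I_n -> M) (t : term L n) : M :=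
  match t with
  | Var i => e i
  | App k F a => fun_interp F (fun i => eval e (a i))
  end.

Definition scons n (x : M) (e : 'I_n -> M) : 'I_n.+1 -> M :=
  fun i => if unlift ord0 i is Some j then e j else x.

Fixpoint sat n (phi : formula L n) : ('I_n -> M) -> Prop :=
  match phi in formula _ n return ('I_n -> M) -> Prop with
  | Bot _ => fun=> False
  | Eq _ s t => fun e => eval e s = eval e t
  | Rel _ k R a => fun e => rel_interp R (fun i => eval e (a i))
  | Imp _ phi psi => fun e => sat phi e -> sat psi e
  | All _ phi => fun e => forall x, sat phi (scons x e)
  end.

Definition tuple_cat n m (x : 'I_n -> M) (y : 'I_m -> M) : 'I_(n + m) -> M :=
  fun i => match fintype.split i with inl j => x j | inr j => y j end.

Definition definable n (A : set ('I_n -> M)) : Prop :=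
  exists m (phi : formula L (n + m)) (b : 'I_m -> M),
    A = [set x | sat phi (tuple_cat x b)].

(* A map A -> B is the restriction to A of a total function; only its values on
   A matter. *)
Definition graph_on n m (A : set ('I_n -> M))
    (f : ('I_n -> M) -> ('I_m -> M)) : set ('I_(n + m) -> M) :=
  [set z | exists2 x, A x & z = tuple_cat x (f x)].

Definition definable_map n m (A : set ('I_n -> M)) (B : set ('I_m -> M))
    (f : ('I_n -> M) -> ('I_m -> M)) : Prop :=
  set_fun A B f /\ definable (graph_on A f).

(* Discreteness in the topology on A induced by the product of the order
   topologies; [set_type A] carries the subspace topology. *)
Definition discrete n (A : set ('I_n -> M)) : Prop :=
  forall U : set (set_type (A : set {ptws 'I_n -> order_topology M})), open U.

End Semantics.

(* There is exactly one assignment of the empty set of variables. *)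
Definition models (L : language) (M : structure L) (s : sentence L) : Prop :=
  forall e : 'I_0 -> M, sat s e.

Definition point_or_open_interval (L : language) (M : structure L)
    (A : set M) : Prop :=
  (exists x, A = [set x]) \/
  (exists2 i : interval M, itv_open_ends i & A = [set` i]).

Definition o_minimal (L : language) (M : structure L) : Prop :=
  forall A : set M, definable [set x : 'I_1 -> M | A (x ord0)] ->
    exists k (F : 'I_k -> set M),
      (forall i, point_or_open_interval (F i)) /\ A = \bigcup_i F i.

Definition o_minimalistic (L : language) (M : structure L) : Prop :=
  forall s : sentence L,
    (forall N : structure L, o_minimal N -> models N s) -> models M s.

(* Main.v *)
Require Import Defs.
From mathcomp Require Import all_boot all_order all_algebra.
From mathcomp Require Import all_classical.
From mathcomp Require Import topology ring.

(** The statement is first-order.  For formulas phi and psi there is a single sentence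
    saying that, for all parameters, if psi defines the graph of an injective self-map of
    the set defined by phi and the points missed by the map are isolated, then no point is
    missed; discreteness is expressed by boxes with endpoints in the structure.  An
    o-minimalistic structure satisfies every such sentence that holds in all o-minimal
    structures ([transfer]), so the work takes place in an o-minimal structure N.

    In N a discrete definable set is finite ([discrete_finite]): an infinite one has a
    coordinate projection containing an interval, and picking the least fibre points over
    a subinterval on which they vary continuously produces a point of the set that is not
    isolated.  It remains to see that an injective definable f : Y -> Y missing only
    finitely many points misses none ([injection_onto]).  This is the invariance of the
    Euler characteristic chi, the additive invariant with chi(point) = 1 and
    chi(open interval) = -1: integrating the indicator of the graph of f over the second
    block of variables gives the indicator of Y, integrating it over the first block gives
    the indicator of f(Y), so Fubini yields chi(Y) = chi(f(Y)), and the number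
    chi(Y \ f(Y)) of missed points is zero.

    For the integral to make sense, the Euler characteristic of the fibres of a definable
    family has to take finitely many values, each on a definable set.  This is uniform
    finiteness ([uniform_finiteness]), which is proved here without cell decomposition.
    The Monotonicity Theorem ([mono_sub], [mono_global]) says that definable functions of
    one variable are piecewise constant or strictly monotone and continuous.  It gives
    [common]: a definable family of nonempty open convex subsets of the line, indexed by
    an interval, has a common point over some subinterval.  By [common], the number of
    points in the fibres of a family of finite sets is locally constant along every
    definable curve outside a definable finite set ([local_count]); functions with this
    property are called tame.  A tame function of finitely many variables is bounded
    ([all_tame_bounded]): in one direction it is constant between finitely many points
    whose number is bounded by induction, and its value between two consecutive points is,
    again by [common], a tame function of the other variables.

    Every constructible function is then assembled from indicators of sets of the form
    D x N, and of the graph of and the region below a definable function over D, by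
    removing the least discontinuity of the fibres, whose number is bounded
    ([con_decompose]).  Integrals and Fubini need only be checked on these, where
    monotonicity makes all fibres convex ([fubini_lower], [fubini_graph]). *)

Import Order.TTheory GRing.Theory.

Set Implicit Arguments.
Unset Strict Implicit.
Unset Printing Implicit Defensive.

Local Open Scope order_scope.

(** * Order reasoning and definable predicates *)

Ltac osat_step :=
  match goal with
  | H : is_true (_ && _) |- _ => move/andP: H => H
  | H : _ /\ _ |- _ => case: H => ? ?
  | H : ~ is_true (_ < _) |- _ => move/negP: H; rewrite -leNgt => H
  | H : ~ is_true (_ <= _) |- _ => move/negP: H; rewrite -ltNge => H
  | H : is_true (~~ (_ < _)) |- _ => rewrite -leNgt in H
  | H : is_true (~~ (_ <= _)) |- _ => rewrite -ltNge in H
  | H : is_true (_ != _) |- _ => move/eqP: H => H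
  | H : is_true (_ == _) |- _ => move/eqP: H => H
  | H : ?x = ?y |- _ => is_var x; subst x
  | H : ?x = ?y |- _ => is_var y; subst y
  | H : is_true (?x < ?x) |- _ => exfalso; by rewrite ltxx in H
  | H : ?x <> ?x |- _ => exfalso; by apply: H
  | H : is_true (?x < ?y), K : is_true (?y < ?x) |- _ =>
      exfalso; by move: (lt_trans H K); rewrite ltxx
  | H : is_true (?x < ?y), K : is_true (?y <= ?x) |- _ =>
      exfalso; by move: (lt_le_trans H K); rewrite ltxx
  | H : is_true (?x <= ?x) |- _ => clear H
  | H : is_true (?x <= ?y), K : ?x <> ?y |- _ =>
      lazymatch goal with E : is_true (x < y) |- _ => fail
      | _ => have : x < y by rewrite lt_neqAle H andbT; apply/eqP end; move=> ?
  | H : is_true (?x <= ?y), K : ?y <> ?x |- _ =>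
      lazymatch goal with E : is_true (x < y) |- _ => fail
      | _ => have : x < y by rewrite lt_neqAle H andbT eq_sym; apply/eqP end; move=> ?
  | H : is_true (?x < ?y), K : is_true (?y < ?z) |- _ =>
      lazymatch goal with E : is_true (x < z) |- _ => fail
      | _ => assert (is_true (x < z)) by exact (lt_trans H K) end
  | H : is_true (?x < ?y), K : is_true (?y <= ?z) |- _ =>
      lazymatch goal with E : is_true (x < z) |- _ => fail
      | _ => assert (is_true (x < z)) by exact (lt_le_trans H K) end
  | H : is_true (?x <= ?y), K : is_true (?y < ?z) |- _ =>
      lazymatch goal with E : is_true (x < z) |- _ => fail
      | _ => assert (is_true (x < z)) by exact (le_lt_trans H K) end
  | H : is_true (?x <= ?y), K : is_true (?y <= ?x) |- _ =>
      lazymatch goal with E : x = y |- _ => fail | E : y = x |- _ => fail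
      | _ => have : x = y by apply/le_anti/andP; split end; move=> ?
  | H : is_true (?x <= ?y), K : is_true (?y <= ?z) |- _ =>
      tryif constr_eq x z then fail else
      lazymatch goal with E : is_true (x <= z) |- _ => fail
      | E : is_true (x < z) |- _ => fail
      | _ => assert (is_true (x <= z)) by exact (le_trans H K) end
  end.
Ltac osat := repeat osat_step.
Ltac ord0 :=
  match goal with
  | |- False => osat
  | |- _ /\ _ => split; ord0
  | |- is_true (_ && _) => apply/andP; ord0
  | |- is_true true => done
  | |- is_true (~~ _) => apply/negP; intro; ord0
  | |- is_true (?x < ?y) => case: (ltP x y) => [//|?]; exfalso; osat
  | |- is_true (?x <= ?y) => case: (leP x y) => [//|?]; exfalso; osat
  | |- is_true (?x != ?y) => apply/eqP; intro; ord0
  | |- is_true (?x == ?y) => apply/eqP; ord0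
  | |- ?x = ?y => case: (ltgtP x y) => [?|?|//]; exfalso; osat
  | |- ~ _ => intro; ord0
  | |- _ => exfalso; osat
  end.
(** Decides goals about a linear order: negate the goal, then close the hypotheses
    under transitivity until a cycle appears. *)
Ltac ord := intros; solve [assumption | ord0].

Definition scons_env (T : Type) (x : T) (r : nat -> T) : nat -> T :=
  fun n => if n is k.+1 then r k else x.
Notation "x .: r" := (scons_env x r) (at level 60, right associativity).
Definition shift (T : Type) (r : nat -> T) : nat -> T := fun n => r n.+1.

Definition step d (M : orderType d) (U : Type) (f : M -> U) (s : seq M) : Prop :=
  forall x y, x < y -> (forall z, z \in s -> ~ (x <= z <= y)) -> f x = f y.

(** What the geometric part uses of the definable predicates of an o-minimal
    structure. The arguments of a predicate form an infinite sequence, of which it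
    reads finitely many entries; a bound variable is pushed in front, as in de Bruijn
    notation. The axioms are symmetric in the order, so that each one-sided argument
    is made once and then read in the dual order. *)
Class omin_family d (M : orderType d) (Def : ((nat -> M) -> Prop) -> Prop) : Prop :=
  OminFamily {
  om_dense : forall x y : M, x < y -> exists z, x < z < y;
  om_left : forall x : M, exists y, y < x;
  om_right : forall x : M, exists y, x < y;
  om_inh : inhabited M;
  om_bot : Def (fun=> False);
  om_imp : forall P Q, Def P -> Def Q -> Def (fun r => P r -> Q r);
  om_all : forall P, Def P -> Def (fun r => forall x, P (x .: r));
  om_lt : Def (fun r => r 0%N < r 1%N);
  om_subst : forall P (g : (nat -> M) -> nat -> M), Def P ->
    (forall n, (exists k, forall r, g r n = r k) \/
               (exists c, forall r, g r n = c)) ->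
    Def (fun r => P (g r));
  om_support : forall P, Def P -> exists n, forall r r' : nat -> M,
    (forall k, (k < n)%N -> r k = r' k) -> P r -> P r';
  om_step : forall P, Def P -> forall r, exists s : seq M, step (fun x => P (x .: r)) s
}.

Lemma om_dual d (M : orderType d) Def : omin_family (M := M) Def -> @omin_family _ (M^d) Def.
Proof.
case=> dn lf rt ih bt im al ltd sb sp st.
split=> //.
- move=> x y xy; have [z /andP[yz zx]] := dn y x xy.
  by exists z; apply/andP; split.
- pose g (r : nat -> M) (n : nat) := match n with 0 => r 1%N | 1 => r 0%N | _ => r n end.
  have := sb _ g ltd; apply=> n; left; exists (match n with 0 => 1%N | 1 => 0%N | _ => n end).
  by case: n => [|[|n]].
- move=> P DP r; have [s hs] := st P DP r; exists s => x y xy hz.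
  apply/esym/(hs y x xy) => z zs /andP[h1 h2]; apply: (hz z zs).
  by apply/andP; split.
Qed.

Section Framework.
Context {d : Order.disp_t} {M : orderType d} (Def : ((nat -> M) -> Prop) -> Prop).
Context {om : omin_family Def}.
Notation env := (nat -> M).
Implicit Types (P Q : env -> Prop) (r : env).

Lemma def_ext P Q : (forall r, P r <-> Q r) -> Def P -> Def Q.
Proof. by move=> h; have -> : P = Q by apply/funext => r; apply/propext. Qed.

Lemma def_False : Def (fun=> False). Proof. exact: om_bot. Qed.

Lemma def_imp P Q : Def P -> Def Q -> Def (fun r => P r -> Q r).
Proof. exact: om_imp. Qed.

Lemma def_not P : Def P -> Def (fun r => ~ P r).
Proof. by move=> h; apply: def_imp => //; exact: om_bot. Qed.

Lemma def_True : Def (fun=> True).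
Proof. by apply: def_ext (def_not def_False) => r; tauto. Qed.

Lemma def_and P Q : Def P -> Def Q -> Def (fun r => P r /\ Q r).
Proof.
move=> hP hQ; apply: def_ext (def_not (def_imp hP (def_not hQ))) => r.
split=> [h|]; last by tauto.
by split; apply: contrapT => h'; tauto.
Qed.

Lemma def_or P Q : Def P -> Def Q -> Def (fun r => P r \/ Q r).
Proof.
move=> hP hQ; apply: def_ext (def_imp (def_not hP) hQ) => r.
by split; have := pselect (P r); tauto.
Qed.

Lemma def_iff P Q : Def P -> Def Q -> Def (fun r => P r <-> Q r).
Proof. by move=> hP hQ; apply: def_and; apply: def_imp. Qed.

Lemma def_cst (p : Prop) : Def (fun=> p).
Proof.
have [hp|hp] := pselect p.
  by apply: def_ext def_True.
by apply: def_ext def_False.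
Qed.

Lemma def_all (Q : env -> M -> Prop) :
  Def (fun r => Q (shift r) (r 0%N)) -> Def (fun r => forall x, Q r x).
Proof. exact: om_all. Qed.

Lemma def_ex (Q : env -> M -> Prop) :
  Def (fun r => Q (shift r) (r 0%N)) -> Def (fun r => exists x, Q r x).
Proof.
move=> h; apply: def_ext (def_not (def_all (Q := fun r x => ~ Q r x) (def_not h))).
move=> r; split=> [h1|[x hx] h1]; last exact: (h1 x).
by apply: contrapT => h2; apply: h1 => x hx; apply: h2; exists x.
Qed.

Lemma def_ex2 (Q Q' : env -> M -> Prop) :
  Def (fun r => Q (shift r) (r 0%N)) -> Def (fun r => Q' (shift r) (r 0%N)) ->
  Def (fun r => exists2 x, Q r x & Q' r x).
Proof.
move=> h h'; have := def_ex (Q := fun r x => Q r x /\ Q' r x) (def_and h h').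
by apply: def_ext => r; split=> [[x []]|[x]]; exists x.
Qed.

Definition dfun (f : env -> M) := Def (fun r => r 0%N = f (shift r)).
Definition denv (g : env -> env) := forall n, dfun (fun r => g r n).

Lemma def_ltv i j : Def (fun r => r i < r j).
Proof.
pose g (r : env) (n : nat) := match n with 0 => r i | 1 => r j | _ => r 0%N end.
have := om_subst (g := g) om_lt; apply=> n; left.
by case: n => [|[|n]]; [exists i|exists j|exists 0%N].
Qed.

Lemma def_eqv i j : Def (fun r => r i = r j).
Proof.
apply: def_ext (def_and (def_not (def_ltv i j)) (def_not (def_ltv j i))) => r.
by split=> [|->]; [ord|rewrite ltxx].
Qed.

Lemma dfun_var i : dfun (fun r => r i).
Proof. exact: def_eqv. Qed.

Lemma dfun_cst c : dfun (fun=> c).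
Proof.
pose g (r : env) (n : nat) := match n with 0 => r 0%N | _ => c end.
have := om_subst (g := g) (def_eqv 0 1); apply=> n.
by case: n => [|n]; [left; exists 0%N|right; exists c].
Qed.

(** The finitely many variables that P reads are replaced by g one at a time, each by
    an existential quantifier. *)
Lemma def_comp P (g : env -> env) : Def P -> denv g -> Def (fun r => P (g r)).
Proof.
move=> DP hg; have [n hn] := om_support DP.
pose drp k (r : env) : env := fun i => r (k + i)%N.
pose Q k (r : env) := P (fun i => if (i < k)%N then r i else g (drp k r) i).
suff h k : (k <= n)%N -> Def (Q (n - k)%N).
  have := h n (leqnn _); rewrite subnn; apply: def_ext => r.
  suff -> : Q 0%N r = P (g r) by [].
  by rewrite /Q; congr P; apply/funext => i.
elim: k => [_|k IH kn].
  rewrite subn0.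
  pose h (r : env) i := if (i < n)%N then r i else r 0%N.
  have : Def (fun r => P (h r)).
    apply: om_subst => // i; left; exists (if (i < n)%N then i else 0%N) => r.
    by rewrite /h; case: ifP.
  by apply: def_ext => r; split; apply: hn => i; rewrite /h => ->.
have {IH} := IH (ltnW kn).
set m := (n - k.+1)%N; have -> : (n - k = m.+1)%N by rewrite /m -subSn ?subSS.
move=> IH.
pose h (r : env) i := if (i < m)%N then r i.+1 else if i == m then r 0%N else r i.
have D1 : Def (fun r => Q m.+1 (h r)).
  apply: om_subst => // i; left.
  exists (if (i < m)%N then i.+1 else if i == m then 0%N else i) => r.
  by rewrite /h; case: ifP => // _; case: ifP.
pose h' (r : env) i := if i is j.+1 then drp m (shift r) j else r 0%N.
have D2 : Def (fun r => h' r 0%N = g (shift (h' r)) m).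
  apply: (om_subst (P := fun r => r 0%N = g (shift r) m) (g := h') (hg m)).
  move=> [|i]; left; first by exists 0%N.
  by exists (m + i).+1.
have := @def_ex (fun r y => h' (y .: r) 0%N = g (shift (h' (y .: r))) m /\ Q m.+1 (h (y .: r))).
have e0 r : shift (h' r) = drp m (shift r) by [].
have e1 r : (r 0%N .: shift r) = r by apply/funext => -[].
have -> : (fun r : env => h' (r 0%N .: shift r) 0%N = g (shift (h' (r 0%N .: shift r))) m /\
     Q m.+1 (h (r 0%N .: shift r))) = (fun r => h' r 0%N = g (shift (h' r)) m /\ Q m.+1 (h r)).
  by apply/funext => r; rewrite e1.
move=> /(_ (def_and D2 D1)); apply: def_ext => r.
have key y : y = g (drp m r) m ->
   (fun i => if (i < m.+1)%N then h (y .: r) i else g (drp m.+1 (h (y .: r))) i)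
   = (fun i => if (i < m)%N then r i else g (drp m r) i).
  move=> yE; apply/funext => i; rewrite ltnS leq_eqVlt.
  have -> : drp m.+1 (h (y .: r)) = drp m r.
    apply/funext => j; rewrite /drp /h.
    by rewrite ltnNge ltnW ?leq_addr //= gtn_eqF //= addSn ltnS leq_addr.
  rewrite /h; case: ltngtP => //= ->.
  by rewrite yE.
rewrite /Q; split=> [[y [/= yE]]|h1].
  by rewrite key.
by exists (g (drp m r) m); split=> //; rewrite key.
Qed.

Lemma dfun_comp f (g : env -> env) : dfun f -> denv g -> dfun (fun r => f (g r)).
Proof.
move=> hf hg.
apply: (@def_comp (fun r => r 0%N = f (shift r)) (fun r => r 0%N .: g (shift r)) hf).
move=> -[|n]; first exact: dfun_var.
pose h (r : env) i := if i is j.+1 then r j.+2 else r 0%N.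
apply: (om_subst (P := fun r => r 0%N = g (shift r) n) (g := h) (hg n)).
move=> [|i]; left; first by exists 0%N.
by exists i.+2.
Qed.

Lemma denv_id : denv (fun r => r). Proof. exact: dfun_var. Qed.
Lemma denv_shift : denv (fun r => shift r). Proof. by move=> n; exact: dfun_var. Qed.
Lemma denv_cst r0 : denv (fun=> r0). Proof. by move=> n; exact: dfun_cst. Qed.
Lemma denv_cons f g : dfun f -> denv g -> denv (fun r => f r .: g r).
Proof. by move=> hf hg -[|n]; [exact: hf|exact: hg]. Qed.
Lemma denv_comp g h : denv g -> denv h -> denv (fun r => g (h r)).
Proof. by move=> hg hh n; exact: (dfun_comp (hg n) hh). Qed.

Lemma def_lt f g : dfun f -> dfun g -> Def (fun r => f r < g r).
Proof.
move=> hf hg; apply: (@def_comp (fun r => r 0%N < r 1%N) (fun r => f r .: (g r .: r))).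
  exact: def_ltv.
by apply: denv_cons => //; apply: denv_cons => //; exact: denv_id.
Qed.

Lemma def_eq f g : dfun f -> dfun g -> Def (fun r => f r = g r).
Proof.
move=> hf hg; apply: (@def_comp (fun r => r 0%N = r 1%N) (fun r => f r .: (g r .: r))).
  exact: def_eqv.
by apply: denv_cons => //; apply: denv_cons => //; exact: denv_id.
Qed.

Lemma def_le f g : dfun f -> dfun g -> Def (fun r => f r <= g r).
Proof.
move=> hf hg; apply: def_ext (def_not (def_lt hg hf)) => r.
by split=> [|? ?]; ord.
Qed.

Definition drel (A : env -> M -> Prop) := Def (fun r => A (shift r) (r 0%N)).

Lemma def_rel A g f : drel A -> denv g -> dfun f -> Def (fun r => A (g r) (f r)).
Proof.
move=> hA hg hf; have := @def_comp (fun r => A (shift r) (r 0%N)) (fun r => f r .: g r) hA.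
by apply; apply: denv_cons.
Qed.

Definition drel2 (A : env -> M -> M -> Prop) :=
  Def (fun r => A (shift (shift r)) (r 1%N) (r 0%N)).

Lemma def_rel2 A g f f' : drel2 A -> denv g -> dfun f -> dfun f' ->
  Def (fun r => A (g r) (f r) (f' r)).
Proof.
move=> hA hg hf hf'.
have := @def_comp (fun r => A (shift (shift r)) (r 1%N) (r 0%N)) (fun r => f' r .: (f r .: g r)) hA.
by apply; apply: denv_cons => //; apply: denv_cons.
Qed.

Lemma dfun_if (P : env -> Prop) f g : Def P -> dfun f -> dfun g ->
  dfun (fun r => if `[< P r >] then f r else g r).
Proof.
move=> hP hf hg.
have hP' : Def (fun r => P (shift r)) by exact: (def_comp hP denv_shift).
have := def_or (def_and hP' hf) (def_and (def_not hP') hg).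
apply: def_ext => r; case: asboolP => h; tauto.
Qed.

Lemma def_andb (p q : env -> bool) : Def (fun r => p r) -> Def (fun r => q r) ->
  Def (fun r => p r && q r).
Proof.
move=> hp hq; apply: def_ext (def_and hp hq) => r.
by split=> [[-> ->]|/andP[]].
Qed.

Definition dset (A : M -> Prop) := Def (fun r => A (r 0%N)).
Definition dmap (f : M -> M) := dfun (fun r => f (r 0%N)).
Definition dbin (R : M -> M -> Prop) := Def (fun r => R (r 1%N) (r 0%N)).

Lemma def_set A f : dset A -> dfun f -> Def (fun r => A (f r)).
Proof.
move=> hA hf; apply: (@def_comp (fun r => A (r 0%N)) (fun r => f r .: r) hA).
by apply: denv_cons => //; exact: denv_id.
Qed.
Lemma dfun_map f g : dmap f -> dfun g -> dfun (fun r => f (g r)).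
Proof.
move=> hf hg; apply: (@dfun_comp (fun r => f (r 0%N)) (fun r => g r .: r) hf).
by apply: denv_cons => //; exact: denv_id.
Qed.
Lemma def_bin R f g : dbin R -> dfun f -> dfun g -> Def (fun r => R (f r) (g r)).
Proof.
move=> hR hf hg; apply: (@def_comp (fun r => R (r 1%N) (r 0%N)) (fun r => g r .: (f r .: r)) hR).
by apply: denv_cons => //; apply: denv_cons => //; exact: denv_id.
Qed.

End Framework.

Ltac def_step :=
  match goal with
  | |- dset _ _ => unfold dset
  | |- dmap _ _ => unfold dmap
  | |- dbin _ _ => unfold dbin
  | |- drel _ _ => unfold drel
  | |- drel2 _ _ => unfold drel2
  | H : ?G |- ?G => exact H
  | |- denv _ (fun r => (@?f r) .: (@?g r)) => refine (denv_cons (f := f) (g := g) _ _)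
  | |- denv ?D (fun _ => ?c) => exact (denv_cst (Def := D) c)
  | H : denv ?D ?h |- denv ?D (fun r => ?h (@?g r)) =>
      refine (denv_comp (g := h) (h := g) H _)
  | |- denv ?D _ => let n := fresh "n" in intro n; exact (dfun_var (Def := D) _)
  | |- dfun ?D (fun _ => ?c) => exact (dfun_cst (Def := D) c)
  | |- dfun ?D _ => exact (dfun_var (Def := D) _)
  | H : dmap ?D ?h |- dfun ?D (fun r => ?h (@?g r)) =>
      refine (dfun_map (f := h) (g := g) H _)
  | H : dfun ?D ?h |- dfun ?D (fun r => ?h (@?g r)) =>
      refine (dfun_comp (f := h) (g := g) H _)
  | H : denv ?D ?h |- dfun ?D (fun r => ?h (@?g r) ?n) =>
      refine (dfun_comp (f := fun r => h r n) (g := g) (H n) _)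
  | |- dfun ?D _ => refine (dfun_if (Def := D) _ _ _)
  | |- ?D (fun _ => ?p) => exact (def_cst (Def := D) p)
  | |- ?D (fun r => (@?P r) /\ (@?Q r)) => refine (def_and (Def := D) (P := P) (Q := Q) _ _)
  | |- ?D (fun r => (@?P r) \/ (@?Q r)) => refine (def_or (Def := D) (P := P) (Q := Q) _ _)
  | |- ?D (fun r => (@?P r) <-> (@?Q r)) => refine (def_iff (Def := D) (P := P) (Q := Q) _ _)
  | |- ?D (fun r => ~ (@?P r)) => refine (def_not (Def := D) (P := P) _)
  | |- ?D (fun r => is_true ((@?P r) && (@?Q r))) =>
      refine (def_andb (Def := D) (p := P) (q := Q) _ _)
  | |- ?D (fun r => is_true (Order.lt (@?f r) (@?g r))) =>
      refine (def_lt (Def := D) (f := f) (g := g) _ _)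
  | |- ?D (fun r => is_true (Order.le (@?f r) (@?g r))) =>
      refine (def_le (Def := D) (f := f) (g := g) _ _)
  | |- ?D (fun r => (@?f r) = (@?g r)) => refine (def_eq (Def := D) (f := f) (g := g) _ _)
  | |- ?D (fun r => ex (@?Q r)) => refine (def_ex (Def := D) (Q := Q) _)
  | |- ?D (fun r => ex2 (@?Q r) (@?Q' r)) =>
      refine (def_ex2 (Def := D) (Q := Q) (Q' := Q') _ _)
  | H : drel ?D ?A |- ?D (fun r => ?A (@?g r) (@?f r)) =>
      refine (def_rel (A := A) (g := g) (f := f) H _ _)
  | H : drel2 ?D ?A |- ?D (fun r => ?A (@?g r) (@?f r) (@?f' r)) =>
      refine (def_rel2 (A := A) (g := g) (f := f) (f' := f') H _ _ _)
  | H : dset ?D ?A |- ?D (fun r => ?A (@?f r)) => refine (def_set (A := A) (f := f) H _)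
  | H : dbin ?D ?R |- ?D (fun r => ?R (@?f r) (@?g r)) =>
      refine (def_bin (R := R) (f := f) (g := g) H _ _)
  | H : ?D ?P |- ?D (fun r => ?P (@?g r)) => refine (def_comp (P := P) (g := g) H _)
  | |- ?D (fun r => _) => refine (def_imp (Def := D) _ _)
  | |- ?D (fun r => _) => refine (def_all (Def := D) _)
  end.
(** Proves definability by following the syntax of the predicate. *)
Ltac def_tac := cbv beta; repeat (def_step; cbv beta).

(** * Germs of definable subsets of the line *)

Section Germs.
Context {d : Order.disp_t} {M : orderType d}.
Implicit Types (A B : M -> Prop) (x y z a b u v : M).

(** The letters r and l stand for right and left: A holds just after x, just before x.
    *)
Definition nbr x A := exists2 b, x < b & forall u, x < u < b -> A u.
Definition nbl x A := exists2 a, a < x & forall u, a < u < x -> A u.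
Definition nb x A := exists a b, a < x < b /\ forall u, a < u < b -> A u.
(** Finiteness by enumeration in a list; its content does not depend on the order, so
    that it passes to the dual. *)
Definition fin A := exists s : seq M, forall x, A x -> x \in s.

Lemma nbrI x A B : nbr x A -> nbr x B -> nbr x (fun u => A u /\ B u).
Proof.
move=> [b xb hb] [c xc hc]; exists (Order.min b c); first by rewrite lt_min xb xc.
move=> u /andP[xu]; rewrite lt_min => /andP[ub uc].
by split; [apply: hb|apply: hc]; rewrite xu.
Qed.
Lemma nblI x A B : nbl x A -> nbl x B -> nbl x (fun u => A u /\ B u).
Proof.
move=> [b xb hb] [c xc hc]; exists (Order.max b c); first by rewrite gt_max xb xc.
move=> u /andP[+ xu]; rewrite gt_max => /andP[ub uc].
by split; [apply: hb|apply: hc]; rewrite xu andbT.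
Qed.
Lemma nbI x A B : nb x A -> nb x B -> nb x (fun u => A u /\ B u).
Proof.
move=> [a [b [xb hb]]] [a' [b' [xb' hb']]].
exists (Order.max a a'), (Order.min b b'); split.
  by rewrite gt_max lt_min; ord.
move=> u; rewrite gt_max lt_min => h.
by split; [apply: hb|apply: hb']; ord.
Qed.
Lemma nbr_sub x A B : (forall u, A u -> B u) -> nbr x A -> nbr x B.
Proof. by move=> h [b xb hb]; exists b => // u /hb/h. Qed.
Lemma nb_sub x A B : (forall u, A u -> B u) -> nb x A -> nb x B.
Proof. by move=> h [a [b [xb hb]]]; exists a, b; split=> // u /hb/h. Qed.
Lemma nb_at x A : nb x A -> A x.
Proof. by move=> [a [b [xb]]]; apply. Qed.
Lemma nb_itv a b x : a < x < b -> nb x (fun u => a < u < b).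
Proof. by move=> h; exists a, b. Qed.
Lemma nb_r x A : nb x A -> nbr x A.
Proof. by move=> [a [b [xb h]]]; exists b => [|u hu]; [|apply: h]; ord. Qed.
Lemma nb_lr x A : nbl x A -> nbr x A -> A x -> nb x A.
Proof.
move=> [a ax ha] [b xb hb] Ax; exists a, b; split; first by ord.
move=> u /andP[au ub]; case: (ltgtP u x) => [ux|xu|->//].
  by apply: ha; ord.
by apply: hb; ord.
Qed.

Lemma fin_sub A B : (forall x, A x -> B x) -> fin B -> fin A.
Proof. by move=> h [s hs]; exists s => x /h/hs. Qed.
Lemma finU A B : fin A -> fin B -> fin (fun x => A x \/ B x).
Proof.
by move=> [s hs] [t ht]; exists (s ++ t) => x; rewrite mem_cat => -[/hs|/ht] ->; rewrite ?orbT.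
Qed.
Lemma fin1 a : fin (fun x => x = a).
Proof. by exists [:: a] => x ->; rewrite inE. Qed.
Lemma fin_bigU A (B : M -> M -> Prop) : fin A -> (forall a, A a -> fin (B a)) ->
  fin (fun x => exists2 a, A a & B a x).
Proof.
move=> [s hs] hB.
suff [t ht] : fin (fun x => exists a, [/\ a \in s, A a & B a x]).
  by exists t => x [a Aa Bx]; apply: ht; exists a; split=> //; apply: hs.
elim: {hs} s => [|e s IH]; first by exists [::] => x [a []].
have [Ae|nAe] := pselect (A e).
  have := finU IH (hB e Ae); apply: fin_sub => x [a [+ Aa Bx]].
  by rewrite inE => /orP[/eqP <-|ha]; [right|left; exists a].
apply: fin_sub IH => x [a [+ Aa Bx]].
by rewrite inE => /orP[/eqP ae|ha]; [case: nAe; rewrite -ae|exists a].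
Qed.
Lemma fin_image A (f : M -> M) : fin A -> fin (fun y => exists2 x, A x & y = f x).
Proof. by move=> h; apply: fin_bigU => // a _; exact: fin1. Qed.
Lemma fin_min A : fin A -> (exists x, A x) -> exists2 x, A x & forall y, A y -> x <= y.
Proof.
move=> [s]; elim: s A => [|e s IH] A hs [x Ax]; first by have := hs x Ax.
have [h|h] := pselect (exists2 y, A y & y < e).
  have [||y [Ay ye] hy] := IH (fun y => A y /\ y < e).
  - by move=> y [/hs]; rewrite inE => /orP[/eqP ->|//]; rewrite ltxx.
  - by case: h => y; exists y.
  exists y => // z Az; case: (leP z e) => ze; last by ord.
  by case: (ltgtP z e) ze => // ze _; [apply: hy|subst z; ord].
have [Ae|nAe] := pselect (A e).
  by exists e => // y Ay; case: (leP e y) => // ye; case: h; exists y.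
apply: IH; last by exists x.
by move=> y Ay; have := hs y Ay; rewrite inE => /orP[/eqP ye|//]; case: nAe; rewrite -ye.
Qed.
End Germs.

Lemma fin_max d (M : orderType d) (A : M -> Prop) : fin A -> (exists x, A x) ->
  exists2 x, A x & forall y, A y -> y <= x.
Proof. exact: (@fin_min _ (M^d)). Qed.

Section OneDim.
Context {d : Order.disp_t} {M : orderType d} {Def : ((nat -> M) -> Prop) -> Prop}.
Context {om : omin_family Def}.
Notation dset := (dset Def).
Implicit Types (A B : M -> Prop) (x y z a b u v : M).

Lemma between x y : x < y -> exists z, x < z < y. Proof. exact: om_dense. Qed.
Lemma between_max a b x : a < x -> b < x -> exists z, (a < z) && (b < z) && (z < x).
Proof.
move=> ax bx; have [z] : exists z, Order.max a b < z < x by apply: between; rewrite gt_max ax.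
by rewrite gt_max => h; exists z.
Qed.
Lemma between_min a b x : x < a -> x < b -> exists z, [&& x < z, z < a & z < b].
Proof.
move=> ax bx; have [z] : exists z, x < z < Order.min a b by apply: between; rewrite lt_min ax.
by rewrite lt_min => h; exists z.
Qed.
Lemma above x : exists y, x < y. Proof. exact: om_right. Qed.
Lemma below x : exists y, y < x. Proof. exact: om_left. Qed.

Lemma gap_r x (s : seq M) : exists2 b, x < b & forall z, z \in s -> ~ (x < z < b).
Proof.
elim: s => [|e s [b xb hb]]; first by have [b xb] := above x; exists b.
have [xe|ex] := ltP x e.
  exists (Order.min b e); first by rewrite lt_min xb.
  move=> z; rewrite inE => /orP[/eqP ->|zs]; rewrite lt_min ?ltxx ?andbF //.
  by move=> h; apply: (hb z zs); ord.
exists b => // z; rewrite inE => /orP[/eqP -> h|/hb//]; ord.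
Qed.

Lemma nbr_neq0 x A : nbr x A -> exists u, x < u /\ A u.
Proof.
by move=> [b xb hb]; have [u hu] := between xb; exists u; split; [ord|apply: hb].
Qed.
Lemma nbl_neq0 x A : nbl x A -> exists u, u < x /\ A u.
Proof.
by move=> [b xb hb]; have [u hu] := between xb; exists u; split; [ord|apply: hb].
Qed.

Lemma step_r U (f : M -> U) s x : step f s ->
  exists2 b, x < b & forall u v, x < u < b -> x < v < b -> f u = f v.
Proof.
move=> hs; have [b xb hb] := gap_r x s; exists b => // u v hu hv.
wlog uv : u v hu hv / u <= v.
  by move=> W; case: (leP u v) => h; [apply: W|apply/esym/W => //; ord].
case: (ltgtP u v) uv => // [uv _|-> //].
by apply: hs => // z zs h; apply: (hb z zs); ord.
Qed.

Lemma dset_step A : dset A -> exists s, step A s.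
Proof. by move=> hA; have [x] := om_inh; exact: (om_step hA (fun=> x)). Qed.

Lemma germ_r x A : dset A -> nbr x A \/ nbr x (fun u => ~ A u).
Proof.
move=> /dset_step[s hs]; have [b xb hb] := step_r x hs.
have [c xcb] := between xb.
have [Ac|nAc] := pselect (A c); [left|right]; exists b => // u hu.
  by rewrite (hb u c).
by rewrite (hb u c).
Qed.

(** A point of A outside the finite set s of possible changes lies in an interval
    contained in A. *)
Lemma fin_or_itv A : dset A -> fin A \/ exists a b, a < b /\ forall u, a < u < b -> A u.
Proof.
move=> hA; have [[x Ax]|h] := pselect (exists x, A x /\ nbr x A).
  by right; case: Ax => _ [b xb hb]; exists x, b.
left; have [s hs] := dset_step hA; exists s => x Ax; apply: contrapT => /negP xs.
apply: h; exists x; split=> //; have [b xb hb] := gap_r x s; exists b => // u hu.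
rewrite -(hs x u) //; first by ord.
move=> z zs /andP[]; rewrite le_eqVlt => /orP[/eqP zx|xz zu]; first by rewrite zx zs in xs.
by apply: (hb z zs); ord.
Qed.

Lemma subint a b A : a < b -> dset A -> exists a' b', [/\ a <= a', a' < b', b' <= b &
  (forall u, a' < u < b' -> A u) \/ (forall u, a' < u < b' -> ~ A u)].
Proof.
move=> ab /(germ_r a)[] [c ac hc]; exists a, (Order.min b c); split => //.
- by rewrite lt_min ab.
- by rewrite ge_min lexx.
- by left=> u; rewrite lt_min => hu; apply: hc; ord.
- by rewrite lt_min ab.
- by rewrite ge_min lexx.
- by right=> u; rewrite lt_min => hu; apply: hc; ord.
Qed.

Lemma itv_notfin a b : a < b -> ~ fin (fun u => a < u < b).
Proof.
move=> ab [s hs]; have [c ac hc] := gap_r a s.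
have am : a < Order.min b c by rewrite lt_min ab.
have [u] := between am; rewrite lt_min => /andP[au /andP[ub uc]].
by apply: (hc u (hs u _)); ord.
Qed.

(** Definable completeness. Between an element outside A and one inside it, the points
    of s split the interval; bisect until none is left, and the cut is then one of the
    two ends. *)
Lemma cut_inf A : dset A -> (forall x y, x < y -> A x -> A y) -> (exists x, A x) ->
  (exists x, ~ A x) -> exists e, (forall x, x < e -> ~ A x) /\ (forall x, e < x -> A x).
Proof.
move=> hA up [u Au] [v nAv]; have [s hs] := dset_step hA.
have vu : v < u by case: (ltgtP v u) => // [/up/(_ Au)//|h]; rewrite h in nAv.
have {hs} : forall x y, x < y -> v < x -> y < u ->
    (forall z, z \in s -> ~ (x <= z <= y)) -> A x = A y.
  by move=> x y ? ? ? ?; apply: hs.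
elim: s u v Au nAv vu => [|e s IH] u v Au nAv vu hs.
  have [w /andP[vw wu]] := between vu.
  have [Aw|nAw] := pselect (A w); [exists v|exists u]; split=> x.
  - by move=> xv /(up _ _ xv).
  - move=> vx; case: (ltgtP x w) => [xw|wx|->//]; last exact: up wx Aw.
    by rewrite (hs x w) //; ord.
  - move=> xu Ax; case: (ltgtP x w) => [xw|wx|xw]; last by rewrite xw in Ax.
      exact: nAw (up _ _ xw Ax).
    by apply: nAw; rewrite (hs w x) //; ord.
  - by move=> ux; exact: up ux Au.
have [ve|ev] := ltP v e; last first.
  apply: (IH u v) => // x y xy vx yu hz; apply: hs => // z; rewrite inE => /orP[/eqP -> h|]; last exact: hz.
  by ord.
have [eu|ue] := ltP e u; last first.
  apply: (IH u v) => // x y xy vx yu hz; apply: hs => // z; rewrite inE => /orP[/eqP -> h|]; last exact: hz.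
  by ord.
have [Ae|nAe] := pselect (A e).
  apply: (IH e v) => // x y xy vx yu hz; apply: hs => //; first by ord.
  by move=> z; rewrite inE => /orP[/eqP -> h|]; [ord|exact: hz].
apply: (IH u e) => // x y xy vx yu hz; apply: hs => //; first by ord.
by move=> z; rewrite inE => /orP[/eqP -> h|]; [ord|exact: hz].
Qed.
End OneDim.

Section OneDimDual.
Context {d : Order.disp_t} {M : orderType d} {Def : ((nat -> M) -> Prop) -> Prop}.
Context {om : omin_family Def}.
Lemma germ_l x (A : M -> Prop) : dset Def A -> nbl x A \/ nbl x (fun u => ~ A u).
Proof.
move=> hA; have [[b xb hb]|[b xb hb]] := @germ_r _ (M^d) _ (om_dual om) x A hA; [left|right];
by exists b => // u /andP[bu ux]; apply: hb; apply/andP; split.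
Qed.
Lemma gap_l x (s : seq M) : exists2 a, a < x & forall z, z \in s -> ~ (a < z < x).
Proof.
have [b xb hb] := @gap_r _ (M^d) _ (om_dual om) x s; exists b => // z zs /andP[h h'].
by apply: (hb z zs); apply/andP; split.
Qed.
End OneDimDual.

(** * Definable linear orders on an interval *)

Definition linear_order (T : Type) (r : T -> T -> Prop) :=
  [/\ forall x, ~ r x x, forall x y z, r x y -> r y z -> r x z &
      forall x y, x <> y -> r x y \/ r y x].

Section LocalOrder.
Context {d : Order.disp_t} {M : orderType d} {Def : ((nat -> M) -> Prop) -> Prop}.
Context {om : omin_family Def}.
Notation dset := (dset Def). Notation dbin := (dbin Def).
Implicit Types (A B : M -> Prop) (x y z a b u v : M).

(** Induction along a closed interval; the infimum of the points reached by a failure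
    would itself have to satisfy A. *)
Lemma real_ind A x y : dset A -> A x ->
  (forall z, x <= z < y -> A z -> nbr z A) ->
  (forall z, x < z <= y -> (forall w, x <= w < z -> A w) -> A z) ->
  forall z, x <= z <= y -> A z.
Proof.
move=> hA Ax hr hl z0 z0xy; apply: contrapT => nAz0.
pose U z := exists w, (x <= w <= y /\ w <= z) /\ ~ A w.
have hU : dset U by rewrite /U; def_tac.
have nUx z : z <= x -> ~ U z.
  by move=> zx [w [h nAw]]; apply: nAw; have -> : w = x by ord.
have [|||e [lo up]] := cut_inf hU.
- by move=> z z' zz' [w [h nAw]]; exists w; split => //; ord.
- by exists z0, z0; split=> //; ord.
- by exists x; exact: nUx.
have xe : x <= e.
  by case: (leP x e) => // /up h; case: (nUx x).
have ey : e <= z0.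
  case: (leP e z0) => // /lo []; exists z0; split => //; ord.
have hlo w : x <= w < e -> A w.
  move=> h; apply: contrapT => nAw; apply: (lo w); first by ord.
  by exists w; split=> //; ord.
have Ae : A e.
  case: (ltgtP x e) xe => // [xe|<-//] _; apply: hl => //; ord.
have [ez|ez] := ltP e z0; last first.
  by apply: nAz0; have -> : z0 = e by ord.
have [|//|c ec hc] := hr e; first by ord.
have [c' hc'] := between ec.
have [|w [h nAw]] := up c'; first by ord.
apply: nAw; case: (ltgtP w e) => [we|we|->//]; first by apply: hlo; ord.
by apply: hc; ord.
Qed.

Variables (r : M -> M -> Prop).
Hypotheses (hr : dbin r) (rL : linear_order r).

Lemma loc_inc a b : (forall x, a < x < b -> nbl x (fun u => r u x)) ->
  (forall x, a < x < b -> nbr x (fun u => r x u)) ->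
  forall x y, a < x -> x < y -> y < b -> r x y.
Proof.
case: rL => rI rT rC hl hR x y ax xy yb.
have hA : dset (fun z => z = x \/ r x z) by def_tac.
suff : y = x \/ r x y by case=> // yx; ord.
apply: (real_ind hA (x := x) (y := y)); last by ord.
- by left.
- move=> z hz [->|xz].
    by have [|c xc hc] := hR x; [ord|exists c => // u hu; right; apply: hc].
  have [|c xc hc] := hR z; first by ord.
  by exists c => // u hu; right; apply: rT xz _; apply: hc.
- move=> z hz hw; right.
  have [|c xc hc] := hl z; first by ord.
  have [u hu] : exists u, Order.max c x < u < z by apply: between; rewrite gt_max; ord.
  have {}hu : c < u < z /\ x < u by move: hu; rewrite gt_max; ord.
  have [|ux|xu] := hw u; [ord|ord|].
  by apply: rT xu _; apply: hc; ord.
Qed.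

(** Strict local minima at all points force a drop. Points having only r-larger points
    to their right are finitely many, since an interval of them would contradict
    minimality on the left; so near b each x has r y x for all y close to b. The
    infimum z of the places from which this holds up to b has points r-above x just
    before it and r-below x just after it. *)
Lemma locmin_jump a b : a < b ->
  (forall x, a < x < b -> nbl x (r x)) -> (forall x, a < x < b -> nbr x (r x)) ->
  exists z v, a < z < b /\ nbl z (fun u => r v u) /\ nbr z (fun u => r u v).
Proof.
case: rL => rI rT rC ab hl hR.
pose B x := a < x < b /\ forall y, x < y < b -> r x y.
have hB : dset B by rewrite /B; def_tac.
have [[s hs]|[a' [b' [ab' hB']]]] := fin_or_itv hB; last first.
  have [x hx] := between ab'; have [xab _] := hB' _ hx.
  have [c cx hc] := hl x xab.
  have [u hu] : exists u, (c < u) && (a' < u) && (u < x) by apply: between_max; ord.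
  have [_ hu'] := hB' u ltac:(ord).
  by case: (rI x); apply: (rT _ u); [apply: hc; ord|apply: hu'; ord].
(* B is finite, so to the right of some a1 each x is followed by a smaller value. *)
have [a1 a1b ha1] := gap_l b s.
wlog aa1 : a1 a1b ha1 / a <= a1.
  move=> W; case: (leP a a1) => [/W|h]; first exact.
  by apply: (W a) => // z zs hz; apply: (ha1 z zs); ord.
have drop x : a1 < x < b -> exists2 y, x < y < b & r y x.
  move=> hx; apply: contrapT => h; apply: (ha1 x) => //; apply: hs; split; first by ord.
  move=> y hy; have [|//|yx] := rC x y; first by move=> e; ord.
  by case: h; exists y.
have claim1 x : a1 < x < b -> nbl b (fun y => r y x).
  move=> hx; have [//|[c cb hc]] : nbl b (fun y => r y x) \/ nbl b (fun y => ~ r y x).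
    by apply: germ_l; def_tac.
  pose A z := forall y, z < y < b -> ~ r y x.
  have hA : dset A by rewrite /A; def_tac.
  have nAx z : z <= x -> ~ A z.
    by move=> zx hz; have [y hy yx] := drop x hx; apply: (hz y) => //; ord.
  have [|||e [lo up]] := cut_inf hA.
  - by move=> z z' zz' hz y hy; apply: hz; ord.
  - by exists c.
  - by exists x; exact: nAx.
  have xe : x <= e by case: (leP x e) => // /up; case/nAx.
  have ec : e <= c by case: (leP e c) => // /lo; case.
  have Ae : A e.
    move=> y hy; have [z hz] := @between _ _ _ _ e y ltac:(ord).
    by apply: (up z); ord.
  have {}xe : x < e by case: (ltgtP x e) xe => // xe _; case: (nAx e) => //; rewrite xe.
  have [ex|nex] := pselect (r e x).
    have [|y hy ye] := drop e; first by ord.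
    by case: (Ae y) => //; exact: rT ye ex.
  have xre : r x e by have [h|//|//] := rC x e; ord.
  have [|w we hw] := hl e; first by ord.
  case: (lo w we) => y hy yx.
  case: (ltgtP y e) => [ye|ey|ye]; last by rewrite ye in yx.
    by apply: (rI x); apply: rT xre (rT _ _ _ (hw y _) yx); ord.
  by apply: (Ae y) => //; ord.
have [x hx] := between a1b.
pose A z := forall y, z < y < b -> r y x.
have hA : dset A by rewrite /A; def_tac.
have nAx z : z <= x -> ~ A z.
  move=> zx hz; have [|c xc hc] := hR x; first by ord.
  have [y hy] : exists y, [&& x < y, y < b & y < c] by apply: between_min; ord.
  case: (rI x); apply: (rT _ y); [apply: hc|apply: hz]; ord.
have [|||e [lo up]] := cut_inf hA.
- by move=> z z' zz' hz y hy; apply: hz; ord.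
- by have [c cb hc] := claim1 x hx; exists c.
- by exists x; exact: nAx.
have [c cb hc] := claim1 x hx.
have xe : x <= e by case: (leP x e) => // /up; case/nAx.
have ec : e <= c by case: (leP e c) => // /lo; case.
have Ae : A e.
  move=> y hy; have [z hz] := @between _ _ _ _ e y ltac:(ord).
  by apply: (up z); ord.
have {}xe : x < e by case: (ltgtP x e) xe => // xe _; case: (nAx e) => //; rewrite xe.
have rex : r e x.
  have [|c' ec' hc'] := hR e; first by ord.
  have [y hy] : exists y, [&& e < y, y < b & y < c'] by apply: between_min; ord.
  apply: (rT _ y); [apply: hc'|apply: Ae]; ord.
exists e, x; split; first by ord.
split; last by exists b => [|u hu]; [ord|apply: Ae].
have [//|[w we hw]] : nbl e (r x) \/ nbl e (fun u => ~ r x u).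
  by apply: germ_l; def_tac.
have [w' hw'] : exists w', (w < w') && (x < w') && (w' < e) by apply: between_max; ord.
case: (lo w'); first by ord.
move=> y hy; case: (ltgtP y e) => [ye|ey|->//]; last by apply: Ae; ord.
have [|xy|//] := rC x y; first by move=> h; ord.
by case: (hw y); ord.
Qed.
End LocalOrder.

Section LocalOrder2.
Context {d : Order.disp_t} {M : orderType d} {Def : ((nat -> M) -> Prop) -> Prop}.
Context {om : omin_family Def}.
Notation dset := (dset Def). Notation dbin := (dbin Def).
Implicit Types (A B : M -> Prop) (x y z a b u v : M).

Lemma linear_flip (r : M -> M -> Prop) : linear_order r -> linear_order (fun x y => r y x).
Proof.
case=> rI rT rC; split=> // [x y z h h'|x y /rC]; [exact: rT h' h|tauto].
Qed.

(** By locmin_jump drops occur in every subinterval, hence at all points of some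
    subinterval; in the dual order the same lemma gives a point with an upward jump
    there. No point carries both. *)
Lemma no_locmin (r : M -> M -> Prop) a b : dbin r -> linear_order r -> a < b ->
  (forall x, a < x < b -> nbl x (r x)) -> (forall x, a < x < b -> nbr x (r x)) -> False.
Proof.
move=> hr rL ab hl hR.
pose R z := exists v, nbl z (fun u => r v u) /\ nbr z (fun u => r u v).
have hRd : dset R by rewrite /R /nbl /nbr; def_tac.
have [a' [b' [aa' ab' bb' [hR'|hR']]]] := subint ab hRd; last first.
  have [||z [v [hz h]]] := @locmin_jump _ _ _ _ r hr rL a' b' ab'.
  - by move=> x hx; apply: hl; ord.
  - by move=> x hx; apply: hR; ord.
  by case: (hR' z hz); exists v.
have [||z0 [v' [/andP[hz hz'] [h1 h2]]]] := @locmin_jump _ (M^d) Def (om_dual om) r hr rL b' a' ab'.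
- move=> x0 /andP[xb ax]; pose x : M := x0.
  have {}xb : x < b' := xb.
  have {}ax : a' < x := ax.
  have [|c xc hc] := hR x; first by ord.
  by exists c => // u /andP[? ?]; apply: hc; apply/andP; split.
- move=> x0 /andP[xb ax]; pose x : M := x0.
  have {}xb : x < b' := xb.
  have {}ax : a' < x := ax.
  have [|c xc hc] := hl x; first by ord.
  by exists c => // u /andP[? ?]; apply: hc; apply/andP; split.
pose z : M := z0.
have {h1} h1 : nbr z (fun u => r v' u).
  by case: h1 => c xc hc; exists c => // u /andP[? ?]; apply: hc; apply/andP; split.
have {h2} h2 : nbl z (fun u => r u v').
  by case: h2 => c xc hc; exists c => // u /andP[? ?]; apply: hc; apply/andP; split.
have [|v [h3 h4]] := hR' z; first by apply/andP; split.
have [u [_ [u1 u2]]] := nbl_neq0 (nblI h2 h3).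
have [w [_ [w1 w2]]] := nbr_neq0 (nbrI h1 h4).
case: rL => rI rT rC; apply: (rI v); apply: rT (rT _ _ _ u2 u1) (rT _ _ _ w1 w2).
Qed.

(** Each point is locally minimal, locally maximal, or is crossed by r upwards or
    downwards, with one behaviour throughout a subinterval; the first two are excluded
    and the other two spread from local to global. *)
Lemma mono_order (r : M -> M -> Prop) a b : dbin r -> linear_order r -> a < b ->
  exists a' b', [/\ a <= a', a' < b', b' <= b &
   (forall x y, a' < x -> x < y -> y < b' -> r x y) \/
   (forall x y, a' < x -> x < y -> y < b' -> r y x)].
Proof.
move=> hr rL ab; have [rI rT rC] := rL.
have hr' : dbin (fun x y => r y x) by def_tac.
have rL' := linear_flip rL.
have hA1 : dset (fun x => nbr x (r x)) by rewrite /nbr; def_tac.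
have hA2 : dset (fun x => nbl x (r x)) by rewrite /nbl; def_tac.
have [a1 [b1 [aa1 ab1 bb1 h1]]] := subint ab hA1.
have [a2 [b2 [aa2 ab2 bb2 h2]]] := subint ab1 hA2.
have {}h1 : (forall x, a2 < x < b2 -> nbr x (r x)) \/ (forall x, a2 < x < b2 -> nbr x (fun u => r u x)).
  case: h1 => h; [left|right] => x hx; first by apply: h; ord.
  have [/h|[c xc hc]] : nbr x (r x) \/ nbr x (fun u => ~ r x u).
  - by apply: germ_r; def_tac.
  - by case; ord.
  exists c => // u hu; have [|xu|//] := rC x u; first by move=> e; ord.
  by case: (hc u).
have {}h2 : (forall x, a2 < x < b2 -> nbl x (r x)) \/ (forall x, a2 < x < b2 -> nbl x (fun u => r u x)).
  case: h2 => h; [left|right] => x hx; first by apply: h; ord.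
  have [/h|[c xc hc]] : nbl x (r x) \/ nbl x (fun u => ~ r x u).
  - by apply: germ_l; def_tac.
  - by case; ord.
  exists c => // u hu; have [|xu|//] := rC x u; first by move=> e; ord.
  by case: (hc u).
exists a2, b2; split; [ord|ord|ord|].
case: h1 h2 => h1 [] h2.
- by case: (no_locmin hr rL ab2 h2 h1).
- by left; exact: (loc_inc hr rL h2 h1).
- by right=> x y ? ? ?; exact: (loc_inc hr' rL' h2 h1).
- by case: (no_locmin hr' rL' ab2 h2 h1).
Qed.
End LocalOrder2.

(** * Monotonicity of definable functions *)

Section Monotonicity.
Context {d : Order.disp_t} {M : orderType d} {Def : ((nat -> M) -> Prop) -> Prop}.
Context {om : omin_family Def}.
Notation dset := (dset Def). Notation dmap := (dmap Def). Notation dbin := (dbin Def).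
Implicit Types (A B : M -> Prop) (x y z a b u v : M) (f : M -> M).

Definition convex A := forall x y z, A x -> A z -> x < y < z -> A y.

Lemma convex_seg A x y z : convex A -> A x -> A y -> x <= z <= y -> A z.
Proof.
move=> cA Ax Ay hz; case: (ltgtP x z) => [xz|zx|<-//]; last by ord.
by case: (ltgtP z y) => [zy|yz|->//]; [apply: (cA x z y)|]; ord.
Qed.

Definition isopen A := forall x, A x -> nb x A.
Definition cont f x := forall p q, p < f x < q -> nb x (fun u => p < f u < q).
Definition cst_on A f := forall x y, A x -> A y -> f x = f y.
Definition inc_on A f := (forall x y, A x -> A y -> x < y -> f x < f y) /\
  forall x, A x -> cont f x.
Definition dec_on A f := (forall x y, A x -> A y -> x < y -> f y < f x) /\
  forall x, A x -> cont f x.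

Lemma itv_sub a b a' b' : a' < b' -> (forall u, a' < u < b' -> a < u < b) ->
  a <= a' /\ b' <= b.
Proof.
move=> ab h; split; case: leP => // lt; exfalso.
  have [u hu] : exists u, [&& a' < u, u < a & u < b'] by apply: between_min; ord.
  have := h u; move=> /(_ _)/andP[]; ord.
have [u hu] : exists u, (b < u) && (a' < u) && (u < b') by apply: between_max; ord.
have := h u; move=> /(_ _)/andP[]; ord.
Qed.

(** If no value is taken infinitely often, the least points of the fibres form an
    infinite set, which contains an interval on which f is injective. *)
Lemma cst_or_inj f a b : dmap f -> a < b -> exists a' b', [/\ a <= a', a' < b', b' <= b &
  (forall x y, a' < x < b' -> a' < y < b' -> f x = f y) \/
  (forall x y, a' < x < b' -> a' < y < b' -> f x = f y -> x = y)].
Proof.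
move=> hf ab.
have [[c [a' [b' [ab' h]]]]|nc] := pselect (exists c a' b', a' < b' /\ forall u, a' < u < b' ->
    a < u < b /\ f u = c).
  have [h1 h2] := itv_sub ab' (fun u hu => (h u hu).1).
  exists a', b'; split=> //; left=> x y hx hy.
  by rewrite (h x hx).2 (h y hy).2.
have hfib c : fin (fun x => a < x < b /\ f x = c).
  have [//|[a' [b' [ab' h]]]] : fin (fun x => a < x < b /\ f x = c) \/
    exists a' b', a' < b' /\ forall u, a' < u < b' -> a < u < b /\ f u = c.
    by apply: fin_or_itv; def_tac.
  by case: nc; exists c, a', b'.
pose X x := a < x < b /\ forall x', a < x' < x -> f x' <> f x.
have hX : dset X by rewrite /X; def_tac.
have [fX|[a' [b' [ab' h]]]] := fin_or_itv hX.
  case: (itv_notfin ab).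
  have := fin_bigU (B := fun x0 x => a < x < b /\ f x = f x0) fX (fun x0 _ => hfib (f x0)).
  apply: fin_sub => x hx.
  have [|x0 [hx0 e0] h0] := fin_min (hfib (f x)); first by exists x.
  exists x0 => //; split=> // x' hx' e'.
  have h1 : x0 <= x' by apply: h0; rewrite e'; split => //; ord.
  by ord.
have [h1 h2] := itv_sub ab' (fun u hu => (h u hu).1).
exists a', b'; split=> //; right=> x y hx hy e.
case: (ltgtP x y) => // xy; exfalso.
  by apply: ((h y hy).2 x) => //; ord.
by apply: ((h x hx).2 y) => //; ord.
Qed.

Lemma image_itv f a b : dmap f -> a < b ->
  (forall x y, a < x < b -> a < y < b -> f x = f y -> x = y) ->
  exists p q, p < q /\ forall v, p < v < q -> exists2 x, a < x < b & v = f x.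
Proof.
move=> hf ab inj.
have [fI|//] : fin (fun v => exists2 x, a < x < b & v = f x) \/
    exists a' b', a' < b' /\ forall u, a' < u < b' -> exists2 x, a < x < b & u = f x.
  by apply: fin_or_itv; def_tac.
case: (itv_notfin ab).
have hB v : (exists2 x, a < x < b & v = f x) -> fin (fun x => a < x < b /\ f x = v).
  move=> [x hx vx]; exists [:: x] => y [hy e]; rewrite inE; apply/eqP; apply: inj => //.
  by rewrite e.
by apply: fin_sub (fin_bigU fI hB) => x hx; exists (f x) => //; exists x.
Qed.

(** Strict monotonicity, in a form symmetric under reversing the values. *)
Definition btw_on a b f := forall x y z, a < x -> x < y -> y < z -> z < b ->
  f x < f y < f z \/ f z < f y < f x.

(** The image is infinite, hence contains an interval (p, q); a monotone function
    hitting every value of (p, q) is continuous where its values lie in (p, q). *)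
Lemma btw_cont f a b : dmap f -> a < b -> btw_on a b f ->
  exists a' b', [/\ a <= a', a' < b', b' <= b & forall x, a' < x < b' -> cont f x].
Proof.
move=> hf ab h.
have inj x y : a < x < b -> a < y < b -> f x = f y -> x = y.
  move=> hx hy e; case: (ltgtP x y) => // xy; exfalso.
    have [z hz] := between xy.
    by have := h x z y; rewrite e => /(_ _ _ _ _)[]; ord.
  have [z hz] := between xy.
  by have := h y z x; rewrite e => /(_ _ _ _ _)[]; ord.
have [p [q [pq him]]] := image_itv hf ab inj.
have key x : a < x < b -> p < f x < q -> cont f x.
  move=> hx hpq p' q' hpq'.
  have [v1 hv1] : exists v1, (p' < v1) && (p < v1) && (v1 < f x) by apply: between_max; ord.
  have [v2 hv2] : exists v2, [&& f x < v2, v2 < q' & v2 < q] by apply: between_min; ord.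
  have [|u1 hu1 e1] := him v1; first by ord.
  have [|u2 hu2 e2] := him v2; first by ord.
  rewrite e1 in hv1; rewrite e2 in hv2.
  have u12 : u1 <> u2 by move=> e; rewrite e in hv1; ord.
  have xu1 : x <> u1 by move=> e; rewrite e in hv1; ord.
  have xu2 : x <> u2 by move=> e; rewrite e in hv2; ord.
  case: (ltgtP u1 u2) => // lt12.
    exists u1, u2; split.
      case: (ltgtP u1 x) => // h1; last 2 first.
      - by have := h x u1 u2; move=> /(_ _ _ _ _)[]; ord.
      - by case: xu1.
      case: (ltgtP x u2) => // h2.
      by have := h u1 u2 x; move=> /(_ _ _ _ _)[]; ord.
    by move=> u hu; have := h u1 u u2; move=> /(_ _ _ _ _)[]; ord.
  exists u2, u1; split.
    case: (ltgtP u2 x) => // h1; last 2 first.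
    - by have := h x u2 u1; move=> /(_ _ _ _ _)[]; ord.
    - by case: xu2.
    case: (ltgtP x u1) => // h2.
    by have := h u2 u1 x; move=> /(_ _ _ _ _)[]; ord.
  by move=> u hu; have := h u2 u u1; move=> /(_ _ _ _ _)[]; ord.
have [r1 hr1] := between pq; have [s1 hs1] : exists s1, r1 < s1 < q by apply: between; ord.
have [|x1 hx1 e1] := him r1; first by ord.
have [|x2 hx2 e2] := him s1; first by ord.
rewrite e1 in hr1; rewrite e1 e2 in hs1.
case: (ltgtP x1 x2) => lt12; last by rewrite lt12 in hs1; ord.
  exists x1, x2; split; [ord|ord|ord|] => x hx; apply: key; first by ord.
  by have := h x1 x x2; move=> /(_ _ _ _ _)[]; ord.
exists x2, x1; split; [ord|ord|ord|] => x hx; apply: key; first by ord.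
by have := h x2 x x1; move=> /(_ _ _ _ _)[]; ord.
Qed.

(** The order of the values of f, refined by the order of the arguments where f takes
    equal values, is a linear order to which mono_order applies; refining makes it
    linear on the whole line and not only where f is injective. *)
Lemma mono_sub f a b : dmap f -> a < b -> exists a' b', [/\ a <= a', a' < b', b' <= b &
  [\/ cst_on (fun u => a' < u < b') f, inc_on (fun u => a' < u < b') f |
      dec_on (fun u => a' < u < b') f]].
Proof.
move=> hf ab; have [a1 [b1 [aa1 ab1 bb1 [h|inj]]]] := cst_or_inj hf ab.
  by exists a1, b1; split=> //; apply: Or31.
(* Equal values occur outside (a1, b1) only. *)
pose r x y := f x < f y \/ (f x = f y /\ x < y).
have hr : dbin r by rewrite /r; def_tac.
have rL : linear_order r.
  rewrite /r; split.
  - by move=> x; case=> [|[_]]; rewrite ltxx.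
  - move=> x y z [h1|[h1 h1']] [h2|[h2 h2']].
    + by left; ord.
    + by left; rewrite -h2.
    + by left; rewrite h1.
    + by right; split; [rewrite h1|ord].
  - move=> x y xy; case: (ltgtP (f x) (f y)) => h; [by left; left|by right; left|].
    by case: (ltgtP x y) xy => // h' _; [left|right]; right.
have [a2 [b2 [aa2 ab2 bb2 h]]] := mono_order hr rL ab1.
have {}h : (forall x y, a2 < x -> x < y -> y < b2 -> f x < f y) \/
           (forall x y, a2 < x -> x < y -> y < b2 -> f y < f x).
  case: h => h; [left|right] => x y ax xy yb; case: (h x y ax xy yb) => // -[].
    move=> e; have := inj x y; move=> /(_ _ _ e) e'; have : x = y by apply: e'; ord.
    by ord.
  by move=> _; ord.
have inj2 x y : a2 < x < b2 -> a2 < y < b2 -> f x = f y -> x = y.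
  by move=> hx hy; apply: inj; ord.
have btw : btw_on a2 b2 f.
  move=> x y z ax xy yz zb; case: h => h; [left|right]; apply/andP.
    by split; apply: h; ord.
  by split; apply: h; ord.
have [a3 [b3 [aa3 ab3 bb3 hc]]] := btw_cont hf ab2 btw.
exists a3, b3; split; [ord|ord|ord|].
case: h => h; [apply: Or32|apply: Or33]; split=> // x y hx hy xy; apply: h; ord.
Qed.

Lemma cst_cont f a b : cst_on (fun u => a < u < b) f -> forall x, a < x < b -> cont f x.
Proof.
by move=> h x hx p q hpq; exists a, b; split=> // u hu; rewrite (h u x).
Qed.

Lemma cont_sub f a b : dmap f -> a < b -> exists a' b', [/\ a <= a', a' < b', b' <= b &
  forall x, a' < x < b' -> cont f x].
Proof.
move=> hf ab; have [a' [b' [h1 h2 h3 h]]] := mono_sub hf ab; exists a', b'; split=> //.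
by case: h => [/cst_cont//|[]//|[]//].
Qed.

(** A transitive definable relation that holds locally holds globally. *)
Lemma loc_rel (r : M -> M -> Prop) x y : dbin r ->
  (forall u v w, r u v -> r v w -> r u w) -> x < y ->
  (forall z, x <= z <= y -> exists a b, a < z < b /\
     forall u v, a < u -> u < v -> v < b -> r u v) -> r x y.
Proof.
move=> hr rT xy hloc.
suff : y = x \/ r x y by case=> // yx; ord.
have hA : dset (fun z => z = x \/ r x z) by def_tac.
apply: (real_ind hA (x := x) (y := y)); last by ord.
- by left.
- move=> z hz Az; have [|a [b [zab h]]] := hloc z; first by ord.
  exists b => [|u hu]; first by ord.
  right; have zu : r z u by apply: h; ord.
  by case: Az => [<-//|xz]; exact: rT xz zu.
- move=> z hz hw; right; have [|a [b [zab h]]] := hloc z; first by ord.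
  have [w hwz] : exists w, (a < w) && (x < w) && (w < z) by apply: between_max; ord.
  have [|wx|xw] := hw w; [ord|ord|].
  by apply: rT xw (h _ _ _ _ _); ord.
Qed.

(** The points with no neighbourhood of one of the three types contain no interval by
    mono_sub, so they are finitely many. The finite set also contains the places where
    the type changes. *)
Lemma mono_global f : dmap f -> exists s : seq M, forall A, convex A ->
  (forall z, z \in s -> ~ A z) -> [\/ cst_on A f, inc_on A f | dec_on A f].
Proof.
move=> hf.
pose Tc x := exists a b, a < x < b /\ cst_on (fun u => a < u < b) f.
pose Ti x := exists a b, a < x < b /\ inc_on (fun u => a < u < b) f.
pose Td x := exists a b, a < x < b /\ dec_on (fun u => a < u < b) f.
have hTc : dset Tc by rewrite /Tc /cst_on; def_tac.
have hTi : dset Ti by rewrite /Ti /inc_on /cont /nb; def_tac.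
have hTd : dset Td by rewrite /Td /dec_on /cont /nb; def_tac.
have [s0 hs0] : fin (fun x => ~ (Tc x \/ Ti x \/ Td x)).
  have [//|[a [b [ab h]]]] : fin (fun x => ~ (Tc x \/ Ti x \/ Td x)) \/ exists a b, a < b /\
      forall u, a < u < b -> ~ (Tc u \/ Ti u \/ Td u) by apply: fin_or_itv; def_tac.
  have [a' [b' [h1 h2 h3 h4]]] := mono_sub hf ab; have [u hu] := between h2.
  case: (h u); first by ord.
  by case: h4 => h4; [left|right; left|right; right]; exists a', b'.
have [s1 hs1] := dset_step hTc; have [s2 hs2] := dset_step hTi.
have [s3 hs3] := dset_step hTd.
exists (s0 ++ s1 ++ s2 ++ s3) => A cA hA.
have [[x0 Ax0]|nA] := pselect (exists x, A x); last first.
  by apply: Or31 => x y Ax; case: nA; exists x.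
have seg x y z := @convex_seg A x y z cA.
have same (T : M -> Prop) s : step T s -> {subset s <= s0 ++ s1 ++ s2 ++ s3} ->
    T x0 -> forall x, A x -> T x.
  move=> hT sub Tx x Ax; case: (ltgtP x x0) => [xx|xx|->//].
    by rewrite (hT x x0) // => z zs hz; apply: (hA z); [exact: sub|exact: seg hz].
  by rewrite -(hT x0 x) // => z zs hz; apply: (hA z); [exact: sub|exact: seg hz].
have T0 : Tc x0 \/ Ti x0 \/ Td x0.
  by apply: contrapT => /hs0 h; apply: (hA x0) => //; rewrite mem_cat h.
have glob (r : M -> M -> Prop) : dbin r -> (forall u v w, r u v -> r v w -> r u w) ->
    (forall z, A z -> exists a b, a < z < b /\ forall u v, a < u -> u < v -> v < b -> r u v) ->
    forall x y, A x -> A y -> x < y -> r x y.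
  move=> hr rT hloc x y Ax Ay xy; apply: loc_rel => // z hz; apply: hloc; exact: seg hz.
case: T0 => [h|[h|h]].
- have {}h : forall x, A x -> Tc x.
    by apply: (same _ _ hs1) h => z' h'; rewrite !mem_cat h' ?orbT.
  have key : forall x y, A x -> A y -> x < y -> f x = f y.
    apply: (glob (fun x y => f x = f y)) => [|u v w -> //|z /h[a [b [h1 h2]]]]; first by def_tac.
    by exists a, b; split=> // u v ? ? ?; apply: h2; ord.
  apply: Or31 => x y Ax Ay; case: (ltgtP x y) => [xy|xy|->//]; [|apply/esym]; exact: key.
- have {}h : forall x, A x -> Ti x.
    by apply: (same _ _ hs2) h => z' h'; rewrite !mem_cat h' ?orbT.
  apply: Or32; split; last by move=> x /h[a [b [h1 [h2 h3]]]]; exact: h3.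
  apply: (glob (fun x y => f x < f y)) => [|u v w|z /h[a [b [h1 [h2 _]]]]].
  + by def_tac.
  + exact: lt_trans.
  + by exists a, b; split=> // u v ? ? ?; apply: h2; ord.
- have {}h : forall x, A x -> Td x.
    by apply: (same _ _ hs3) h => z' h'; rewrite !mem_cat h' ?orbT.
  apply: Or33; split; last by move=> x /h[a [b [h1 [h2 h3]]]]; exact: h3.
  apply: (glob (fun x y => f y < f x)) => [|u v w h1 h2|z /h[a [b [h1 [h2 _]]]]].
  + by def_tac.
  + exact: lt_trans h2 h1.
  + by exists a, b; split=> // u v ? ? ?; apply: h2; ord.
Qed.

Lemma dfun_choice (R : (nat -> M) -> M -> Prop) : drel Def R ->
  (forall r, exists y, R r y) -> (forall r y y', R r y -> R r y' -> y = y') ->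
  exists g : (nat -> M) -> M, dfun Def g /\ forall r, R r (g r).
Proof.
move=> hR ex un; have [f hf] := choice ex; exists f; split=> //.
by apply: def_ext hR => r; split=> [h|->]; [exact: un h _|].
Qed.

Lemma dmap_choice (R : M -> M -> Prop) : dbin R ->
  (forall r, exists y, R r y) -> (forall r y y', R r y -> R r y' -> y = y') ->
  exists f, dmap f /\ forall r, R r (f r).
Proof.
move=> hR ex un; have [f hf] := choice ex; exists f; split=> //.
by apply: def_ext hR => r; split=> [h|->]; [exact: un h _|exact: hf].
Qed.

(** The infimum of a definable family of upward closed sets is a definable function of
    the parameter. *)
Lemma inf_map (U : M -> M -> Prop) a b : dbin U ->
  (forall t, a < t < b -> forall x y, x < y -> U t x -> U t y) ->
  (forall t, a < t < b -> exists x, U t x) ->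
  (forall t, a < t < b -> exists x, ~ U t x) ->
  exists f, dmap f /\ forall t, a < t < b ->
    (forall x, x < f t -> ~ U t x) /\ (forall x, f t < x -> U t x).
Proof.
move=> hU up ne na; have [c] : inhabited M := om_inh.
pose R t e := (a < t < b -> (forall x, x < e -> ~ U t x) /\ (forall x, e < x -> U t x)) /\
   (~ (a < t < b) -> e = c).
have [|t|t e e' [h1 h2] [h1' h2']|f [hf fE]] := @dmap_choice R.
- by rewrite /R; def_tac.
- have [ht|ht] := pselect (a < t < b); last by exists c.
  have hUt : dset (U t) by def_tac.
  by have [e he] := cut_inf hUt (up t ht) (ne t ht) (na t ht); exists e.
- have [ht|ht] := pselect (a < t < b); last by rewrite h2 // h2'.
  have [l1 u1] := h1 ht; have [l2 u2] := h1' ht.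
  case: (ltgtP e e') => // /between[w hw]; exfalso.
    by apply: (l2 w); [ord|apply: u1; ord].
  by apply: (l1 w); [ord|apply: u2; ord].
by exists f; split=> // t ht; exact: (fE t).1.
Qed.

(** On a subinterval U t is everything, or empty, or the half-line above a continuous
    function of t. *)
Lemma lsc_up (U : M -> M -> Prop) a b : dbin U -> a < b ->
  (forall t x y, a < t < b -> U t x -> x < y -> U t y) ->
  (forall t, a < t < b -> isopen (U t)) ->
  exists a' b', [/\ a <= a', a' < b', b' <= b & forall t y, a' < t < b' -> U t y ->
     nb t (fun t' => U t' y)].
Proof.
move=> hU ab up op.
have hA : dset (fun t => forall y, U t y) by def_tac.
have [a1 [b1 [aa1 ab1 bb1 [hall|hnall]]]] := subint ab hA.
  by exists a1, b1; split=> // t y ht _; exists a1, b1; split=> // u /hall.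
have hE : dset (fun t => exists y, U t y) by def_tac.
have [a2 [b2 [aa2 ab2 bb2 [hex|hnex]]]] := subint ab1 hE; last first.
  exists a2, b2; split=> //; [ord|ord|].
  by move=> t y ht Uty; case: (hnex t ht); exists y.
have [f [hf fE]] : exists f, dmap f /\ forall t, a2 < t < b2 ->
    (forall x, x < f t -> ~ U t x) /\ (forall x, f t < x -> U t x).
  apply: inf_map => // t ht.
  - by move=> x y xy Ux; apply: up Ux xy; ord.
  - apply: contrapT => h; apply: (hnall t); first by ord.
    by move=> y; apply: contrapT => h'; apply: h; exists y.
have [a3 [b3 [aa3 ab3 bb3 hc]]] := cont_sub hf ab2.
have fU t y : a2 < t < b2 -> U t y <-> f t < y.
  move=> ht; have [l u] := fE t ht; split=> [Uty|/u//].
  have nU x : U t x -> f t <= x by move=> Ux; case: leP => // /l.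
  have [|p [q [hy hpq]]] := op t _ y Uty; first by ord.
  have [w hw] := @between _ _ _ _ p y ltac:(ord).
  by have := nU w (hpq w ltac:(ord)); ord.
exists a3, b3; split; [ord|ord|ord|].
move=> t y ht /fU h; have {}h : f t < y by apply: h; ord.
have [p hp] := below (f t).
have := hc t ht p y; move=> /(_ _) h1.
have {h1} : nb t (fun u => p < f u < y) by apply: h1; ord.
move=> /(nbI (nb_itv ht)); apply: nb_sub => u [hu h1].
by apply/fU; ord.
Qed.
End Monotonicity.

Section Common.
Context {d : Order.disp_t} {M : orderType d} {Def : ((nat -> M) -> Prop) -> Prop}.
Context {om : omin_family Def}.
Notation dbin := (dbin Def).
Implicit Types (A B : M -> Prop) (x y z a b u v : M).

Lemma nb_dual x A : @nb _ (M^d) x A -> nb x A.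
Proof.
move=> [a [b [/andP[h1 h2] h]]]; exists b, a; split; first by apply/andP; split.
by move=> u /andP[h3 h4]; apply: h; apply/andP; split.
Qed.
Lemma dual_nb x A : nb x A -> @nb _ (M^d) x A.
Proof.
move=> [a [b [/andP[h1 h2] h]]]; exists b, a; split; first by apply/andP; split.
by move=> u /andP[h3 h4]; apply: h; apply/andP; split.
Qed.

Lemma lsc_down (U : M -> M -> Prop) a b : dbin U -> a < b ->
  (forall t x y, a < t < b -> U t x -> y < x -> U t y) ->
  (forall t, a < t < b -> isopen (U t)) ->
  exists a' b', [/\ a <= a', a' < b', b' <= b & forall t y, a' < t < b' -> U t y ->
     nb t (fun t' => U t' y)].
Proof.
move=> hU ab dn op.
have [||b' [a' [h1 h2 h3 h4]]] := @lsc_up _ (M^d) Def (om_dual om) U b a hU ab.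
- by move=> t x y /andP[h1 h2]; apply: dn; apply/andP; split.
- move=> t /andP[h1 h2] x Ux; apply: dual_nb; apply: op Ux; apply/andP; split => //.
exists a', b'; split=> // t y /andP[h5 h6] Uty; apply: nb_dual.
by apply: h4 => //; apply/andP; split.
Qed.

(** Membership of y in G t amounts to y lying above some point and below some point of
    G t. Both are lower semicontinuous conditions on t over a subinterval. *)
Lemma common (G : M -> M -> Prop) a b : dbin G -> a < b ->
  (forall t, a < t < b -> exists y, G t y) ->
  (forall t, a < t < b -> convex (G t)) ->
  (forall t, a < t < b -> isopen (G t)) ->
  exists a' b' y, [/\ a <= a', a' < b', b' <= b & forall t, a' < t < b' -> G t y].
Proof.
move=> hG ab ne cv op.
pose U t y := exists2 u, G t u & u < y.
pose L t y := exists2 u, G t u & y < u.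
have hU : dbin U by rewrite /U; def_tac.
have hL : dbin L by rewrite /L; def_tac.
have [||a1 [b1 [aa1 ab1 bb1 hU']]] := lsc_up hU ab.
- by move=> t x y _ [u Gu ux] xy; exists u => //; ord.
- move=> t ht y [u Gu uy]; have [v yv] := above y; exists u, v; split; first by ord.
  by move=> w hw; exists u => //; ord.
have [||a2 [b2 [aa2 ab2 bb2 hL']]] := lsc_down hL ab1.
- by move=> t x y _ [u Gu ux] xy; exists u => //; ord.
- move=> t ht y [u Gu uy]; have [v yv] := below y; exists v, u; split; first by ord.
  by move=> w hw; exists u => //; ord.
have [t0 ht0] := between ab2.
have [|y Gy] := ne t0; first by ord.
have [|p [q [hy hpq]]] := op t0 _ y Gy; first by ord.
have [u1 hu1] := @between _ _ _ _ p y ltac:(ord).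
have [u2 hu2] := @between _ _ _ _ y q ltac:(ord).
have n1 : nb t0 (fun t => U t y).
  by apply: hU'; [ord|exists u1; [apply: hpq|]; ord].
have n2 : nb t0 (fun t => L t y).
  by apply: hL'; [ord|exists u2; [apply: hpq|]; ord].
have [a3 [b3 [ht3 h3]]] := nbI (nb_itv ht0) (nbI n1 n2).
have [i1 i2] : a2 <= a3 /\ b3 <= b2.
  by apply: itv_sub => [|u /h3[]//]; ord.
exists a3, b3, y; split; [ord|ord|ord|] => t /h3[ht [[u Gu uy] [v Gv yv]]].
by apply: (cv t _ u y v) => //; ord.
Qed.
End Common.

(** * Local constancy of the number of points in a fibre *)

Section Counting.
Context {d : Order.disp_t} {M : orderType d}.
Implicit Types (A B : M -> Prop) (x y z a b u v : M).

(** At most n elements. The recursion on n makes the condition visibly first-order in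
    A. *)
Fixpoint atmost n A : Prop :=
  if n is m.+1 then exists y, atmost m (fun x => A x /\ x <> y) else forall x, ~ A x.

Lemma atmost_seq n A : atmost n A -> exists2 s : seq M, (size s <= n)%N & forall x, A x -> x \in s.
Proof.
elim: n A => [|n IH] A /=; first by move=> h; exists [::] => // x /h.
move=> [y /IH[s sn hs]]; exists (y :: s) => // x Ax; rewrite inE.
by case: eqP => //= xy; apply: hs.
Qed.

Lemma seq_atmost (c : M) n A (s : seq M) : (size s <= n)%N -> (forall x, A x -> x \in s) -> atmost n A.
Proof.
elim: n A s => [|n IH] A [|y s] //= sn hs; first by move=> x /hs.
  exists c; apply: (IH _ [::]) => // x [/hs//].
exists y; apply: (IH _ s) => // x [/hs + xy]; rewrite inE => /orP[/eqP//|//].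
Qed.

Lemma atmost_fin n A : atmost n A -> fin A.
Proof. by move=> /atmost_seq[s _ hs]; exists s. Qed.

Lemma atmost_drop (c : M) n A B e : atmost n.+1 A -> A e ->
  (forall x, B x -> A x /\ x <> e) -> atmost n B.
Proof.
move=> /atmost_seq[s sn hs] Ae hB.
apply: (seq_atmost c (s := [seq y <- s | predC1 e y])).
  rewrite size_filter; have := count_predC (pred1 e) s.
  have : has (pred1 e) s by apply/hasP; exists e; [exact: hs|exact: eqxx].
  rewrite has_count => h1 h2; rewrite -ltnS; apply: leq_trans sn.
  by rewrite -h2 -[X in (X <= _)%N]add1n leq_add2r.
move=> y /hB[Ay ye]; rewrite mem_filter /= hs // andbT; exact/eqP.
Qed.

Definition least (P : pred nat) : nat :=
  if pselect (exists n, P n) is left h then ex_minn h else 0%N.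
Definition cnt A : nat := least (fun n => `[< atmost n A >]).

Lemma cnt_ext A B : (forall n, atmost n A <-> atmost n B) -> cnt A = cnt B.
Proof.
move=> h; rewrite /cnt; congr least; apply/funext => n; exact: asbool_equiv_eq.
Qed.

Lemma cntP (c : M) A n : fin A -> (cnt A <= n)%N <-> atmost n A.
Proof.
move=> fA; rewrite /cnt /least; case: pselect => [h|[]]; last first.
  by case: fA => s hs; exists (size s); apply/asboolP/(seq_atmost c _ hs).
case: ex_minnP => m /asboolP hm hmin; split=> [mn|/asboolP/hmin//].
have [s sn hs] := atmost_seq hm; exact: (seq_atmost c (leq_trans sn mn) hs).
Qed.

(** A set covered by the image of A under a partial function is no larger than A. *)
Lemma atmost_rel (c : M) A B (R : M -> M -> Prop) n :
  (forall x', B x' -> exists2 x, A x & R x x') ->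
  (forall x x' x'', R x x' -> R x x'' -> B x' -> B x'' -> x' = x'') ->
  atmost n A -> atmost n B.
Proof.
move=> ex un /atmost_seq[s sn hs].
have [h hh] : exists h : M -> M, forall x x', R x x' -> B x' -> h x = x'.
  have : forall x, exists y, forall x', R x x' -> B x' -> y = x'.
    move=> x; have [[y [Rxy By]]|nh] := pselect (exists y, R x y /\ B y).
      by exists y => x' Rx Bx; apply: un Rxy Rx By Bx.
    by exists c => x' Rx Bx; case: nh; exists x'.
  by move=> /choice[h hh]; exists h => x; exact: hh.
apply: (seq_atmost c (s := map h s)); first by rewrite size_map.
by move=> x' Bx'; have [x Ax Rx] := ex _ Bx'; rewrite -(hh _ _ Rx Bx'); apply/map_f/hs.
Qed.

Lemma nb_fin A (R : M -> M -> Prop) t (a b : M) : a < t < b -> fin A ->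
  (forall y, A y -> nb t (R y)) -> nb t (fun t' => forall y, A y -> R y t').
Proof.
move=> tab [s hs] h.
suff : nb t (fun t' => forall y, y \in s -> A y -> R y t').
  by apply: nb_sub => t' H y Ay; apply: H => //; apply: hs.
elim: {hs} s => [|y s IH]; first by exists a, b.
have [Ay|nAy] := pselect (A y).
  apply: nb_sub (nbI (h y Ay) IH) => t' [h1 h2] z; rewrite inE => /orP[/eqP -> //|]; exact: h2.
by apply: nb_sub IH => t' h2 z; rewrite inE => /orP[/eqP -> //|]; exact: h2.
Qed.
End Counting.

Section LocalCount.
Context {d : Order.disp_t} {M : orderType d} {Def : ((nat -> M) -> Prop) -> Prop}.
Context {om : omin_family Def}.
Notation dset := (dset Def). Notation dmap := (dmap Def). Notation dbin := (dbin Def).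
Notation env := (nat -> M).
Implicit Types (A : M -> Prop) (x y z a b u v t : M) (B : M -> M -> Prop).

Lemma fin_ge A y : fin A -> (forall a, A a -> y < a) -> exists2 h, y < h & forall a, A a -> h <= a.
Proof.
move=> fA hA; have [ne|e] := pselect (exists a, A a).
  by have [x Ax hx] := fin_min fA ne; exists x => //; exact: hA.
by have [h yh] := above y; exists h => // a Aa; case: e; exists a.
Qed.
Lemma fin_le A y : fin A -> (forall a, A a -> a < y) -> exists2 h, h < y & forall a, A a -> a <= h.
Proof.
move=> fA hA; have [ne|e] := pselect (exists a, A a).
  by have [x Ax hx] := fin_max fA ne; exists x => //; exact: hA.
by have [h yh] := below y; exists h => // a Aa; case: e; exists a.
Qed.

(** Disjoint neighbourhoods of the points of a finite set, bounded by chosen midpoints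
    between them. *)
Lemma separate A : fin A -> exists lo hi : M -> M,
  (forall y, lo y < y < hi y) /\ forall y y', A y -> A y' -> y < y' -> hi y <= lo y'.
Proof.
move=> fA.
have [mid hmid] : exists mid : M -> M -> M, forall x y, x < y -> x < mid x y < y.
  have : forall p : M * M, exists m, p.1 < p.2 -> p.1 < m < p.2.
    by move=> [x y]; case: (ltP x y) => [/between[z hz]|_]; [exists z|exists x].
  by move=> /choice[m hm]; exists (fun x y => m (x, y)) => x y; exact: (hm (x, y)).
have : forall y, exists h, y < h /\ forall y', A y' -> y < y' -> h <= mid y y'.
  move=> y; have fI : fin (fun m => exists2 y', A y' /\ y < y' & m = mid y y').
    by apply: fin_image; apply: fin_sub fA => z [].
  have [|h yh hh] := fin_ge (y := y) fI.
    by move=> m [y' [_ yy'] ->]; have := hmid _ _ yy'; ord.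
  by exists h; split=> // y' Ay' yy'; apply: hh; exists y'.
move=> /choice[hi hhi].
have : forall y, exists h, h < y /\ forall y', A y' -> y' < y -> mid y' y <= h.
  move=> y; have fI : fin (fun m => exists2 y', A y' /\ y' < y & m = mid y' y).
    by apply: fin_image; apply: fin_sub fA => z [].
  have [|h yh hh] := fin_le (y := y) fI.
    by move=> m [y' [_ yy'] ->]; have := hmid _ _ yy'; ord.
  by exists h; split=> // y' Ay' yy'; apply: hh; exists y'.
move=> /choice[lo hlo]; exists lo, hi; split.
  by move=> y; have [h1 _] := hlo y; have [h2 _] := hhi y; ord.
move=> y y' Ay Ay' yy'; have := (hhi y).2 y' Ay' yy'.
by have := (hlo y').2 y Ay yy'; ord.
Qed.

Lemma dfun_min (A : env -> M -> Prop) : drel Def A -> (forall r, fin (A r)) ->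
  exists e : env -> M, dfun Def e /\
    forall r, (exists y, A r y) -> A r (e r) /\ forall y, A r y -> e r <= y.
Proof.
move=> hA fA; have [c] : inhabited M := om_inh.
pose D r := exists y, A r y.
pose R r e := (D r -> A r e /\ forall y, A r y -> e <= y) /\ (~ D r -> e = c).
have [e [he eE]] : exists e : env -> M, dfun Def e /\ forall r, R r (e r).
  apply: dfun_choice; first by rewrite /R /D; def_tac.
    move=> r; have [Dr|nD] := pselect (D r); last by exists c.
    by have [e h1 h2] := fin_min (fA r) Dr; exists e.
  move=> r e e' [h1 h2] [h1' h2']; have [Dr|nD] := pselect (D r); last by rewrite h2 // h2'.
  have [g1 l1] := h1 Dr; have [g2 l2] := h1' Dr.
  by have := l1 _ g2; have := l2 _ g1; ord.
by exists e; split=> // r Dr; exact: (eE r).1.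
Qed.

(** Near (t, y) the family B is either empty or a single branch passing through y
    continuously. *)
Definition regular B t y :=
  (B t y -> forall p q, p < y < q -> exists p' q', (p <= p' /\ p' < y < q' /\ q' <= q) /\
     nb t (fun t' => exists2 z, p' < z < q' /\ B t' z & forall z', p' < z' < q' -> B t' z' -> z' = z)) /\
  (~ B t y -> exists p q, p < y < q /\ nb t (fun t' => forall z, p < z < q -> ~ B t' z)).
(** All points of the vertical line over t are regular, including those at infinity.
    This is first-order in t, whereas local constancy of the number of points is not
    visibly so. *)
Definition good B t :=
  (exists q, nb t (fun t' => forall z, q < z -> ~ B t' z)) /\
  (exists q, nb t (fun t' => forall z, z < q -> ~ B t' z)) /\
  forall y, regular B t y.

Lemma def_allseq (F : M -> env -> Prop) (s : seq M) : (forall y, Def (F y)) ->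
  Def (fun r => forall y, y \in s -> F y r).
Proof.
move=> hF; elim: s => [|y s IH].
  by apply: def_ext (def_True (Def := Def)) => r; split.
apply: def_ext (def_and (hF y) IH) => r; split.
  by move=> [h1 h2] z; rewrite inE => /orP[/eqP->//|]; exact: h2.
by move=> h; split=> [|z zs]; apply: h; rewrite inE ?eqxx // zs orbT.
Qed.

(** Compactness of the closed vertical line, by real induction along it, for a set C
    that every point of the line, and both ends at infinity, avoid locally. *)
Lemma cover_nb C t : dbin C -> (exists a b, a < t < b) ->
  (exists q, nb t (fun t' => forall z, q < z -> ~ C t' z)) ->
  (exists q, nb t (fun t' => forall z, z < q -> ~ C t' z)) ->
  (forall y, exists p q, p < y < q /\ nb t (fun t' => forall z, p < z < q -> ~ C t' z)) ->
  nb t (fun t' => forall z, ~ C t' z).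
Proof.
move=> hC tab [q1 h1] [q0 h0] hbox.
have [x xq0] := below q0.
have [y] : exists y, Order.max q1 x < y by exact: above.
rewrite gt_max => /andP[q1y xy].
pose A z := nb t (fun t' => forall w, w <= z -> ~ C t' w).
have hA : dset A by rewrite /A /nb; def_tac.
suff : A y.
  move=> /(nbI h1); apply: nb_sub => t' [H1 H2] z.
  by case: (leP z y) => [/H2//|yz]; apply: H1; ord.
apply: (real_ind hA (x := x) (y := y)); last by ord.
- by apply: nb_sub h0 => t' H w wx; apply: H; ord.
- move=> z hz Az; have [p [q [pq hb]]] := hbox z.
  exists q => [|u hu]; first by ord.
  apply: nb_sub (nbI Az hb) => t' [H1 H2] w wu.
  by case: (leP w z) => [/H1//|zw]; apply: H2; ord.
- move=> z hz hw; have [p [q [pq hb]]] := hbox z.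
  have [w hwz] : exists w, (p < w) && (x < w) && (w < z) by apply: between_max; ord.
  have [|] := hw w; first by ord.
  move=> a' [b' Aw]; apply: nb_sub (nbI (_ : A w) hb); last by exists a', b'.
  move=> t' [H1 H2] v vz.
  by case: (leP v w) => [/H1//|zw]; apply: H2; ord.
Qed.

(** The branches through the points over t lie in disjoint boxes, one point of the
    fibre in each; by cover_nb no other point of the fibres near t exists, so that
    points over t and over t' correspond bijectively. *)
Lemma good_count B t : dbin B -> (forall t, fin (B t)) -> good B t ->
  nb t (fun t' => cnt (B t') = cnt (B t)).
Proof.
move=> hB fB [gt [gb gr]].
have [a at_] := below t; have [b tb] := above t.
have [lo [hi [hlh sep]]] := separate (fB t).
have : forall y, exists pq : M * M, B t y -> (lo y <= pq.1 /\ pq.1 < y < pq.2 /\ pq.2 <= hi y) /\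
     nb t (fun t' => exists2 z, pq.1 < z < pq.2 /\ B t' z &
       forall z', pq.1 < z' < pq.2 -> B t' z' -> z' = z).
  move=> y; have [By|nBy] := pselect (B t y); last by exists (a, b).
  by have [p [q h]] := (gr y).1 By _ _ (hlh y); exists (p, q).
move=> /choice[pq hpq]; pose P y := (pq y).1; pose Q y := (pq y).2.
have [s hs] := fB t.
pose C t' z := B t' z /\ forall y, y \in s -> B t y -> ~ (P y < z < Q y).
have hC : dbin C.
  apply: def_and; first by def_tac.
  by apply: def_allseq => y; def_tac.
have nC : nb t (fun t' => forall z, ~ C t' z).
  apply: cover_nb => //.
  - by exists a, b; ord.
  - by case: gt => q h; exists q; apply: nb_sub h => t' H z /H nB [].
  - by case: gb => q h; exists q; apply: nb_sub h => t' H z /H nB [].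
  - move=> y; have [By|nBy] := pselect (B t y).
      have [[h1 [h2 h3]] _] := hpq y By.
      exists (P y), (Q y); split=> //; exists a, b; split; first by ord.
      by move=> t' _ z hz [_ /(_ y (hs y By) By)]; apply.
    have [p [q [h1 h2]]] := (gr y).2 nBy; exists p, q; split=> //.
    by apply: nb_sub h2 => t' H z /H nB [].
have tab : a < t < b by ord.
have nU := nb_fin tab (fB t) (fun y By => (hpq y By).2).
apply: nb_sub (nbI nC nU) => t' [hC' hU'].
apply: cnt_ext => n; split.
- apply: (atmost_rel t (R := fun z y => B t y /\ P y < z < Q y)).
    move=> y By; have [z [hz Bz] _] := hU' y By; exists z => //.
  move=> z y y' [By hy] [By' hy'] _ _.
  have [[h1 [h2 h3]] _] := hpq y By; have [[h1' [h2' h3']] _] := hpq y' By'.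
  rewrite -/(P y) -/(Q y) in h1 h2 h3; rewrite -/(P y') -/(Q y') in h1' h2' h3'.
  case: (ltgtP y y') => // yy.
    by have := sep _ _ By By' yy; ord.
  by have := sep _ _ By' By yy; ord.
- apply: (atmost_rel t (R := fun y z => B t y /\ P y < z < Q y)).
    move=> z Bz; apply: contrapT => h; apply: (hC' z); split=> // y _ By hz.
    by apply: h; exists y.
  move=> y z z' [By hz] [_ hz'] Bz Bz'.
  by have [w _ h] := hU' y By; rewrite (h z) // (h z').
Qed.

Lemma low_box B a b : dbin B -> (forall t, fin (B t)) -> a < b ->
  exists a' b' q, [/\ a <= a', a' < b', b' <= b & forall t, a' < t < b' -> forall z, z < q -> ~ B t z].
Proof.
move=> hB fB ab; pose G t y := forall z, z <= y -> ~ B t z.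
have hG : dbin G by rewrite /G; def_tac.
have gap t : exists h, forall z, B t z -> h < z.
  have [ne|e] := pselect (exists z, B t z).
    by have [x Ax hx] := fin_min (fB t) ne; have [h hx'] := below x; exists h => // z /hx; ord.
  by exists a => // z Bz; case: e; exists z.
have [|||a' [b' [q [h1 h2 h3 h4]]]] := common hG ab.
- by move=> t ht; have [h hh] := gap t; exists h => z zh /hh; ord.
- by move=> t ht x y z Gx Gz xyz w wy; apply: Gz; ord.
- move=> t ht y Gy; have [s hs] := fB t; have [c yc hc] := gap_r y s.
  have [p py] := below y; exists p, c; split; first by ord.
  move=> u hu z zu Bz; case: (leP z y) => [/Gy//|yz]; apply: (hc z (hs z Bz)); ord.
by exists a', b', q; split=> // t ht z zq; apply: (h4 t ht); ord.
Qed.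

Lemma gap_above_map B f a b : dbin B -> (forall t, fin (B t)) -> a < b -> dmap f ->
  exists a' b' q, [/\ a <= a', a' < b', b' <= b & forall t, a' < t < b' ->
    f t < q /\ forall z, f t < z <= q -> ~ B t z].
Proof.
move=> hB fB ab hf; pose G t y := f t < y /\ forall z, f t < z <= y -> ~ B t z.
have hG : dbin G by rewrite /G; def_tac.
have [|||a' [b' [q [h1 h2 h3 h4]]]] := common hG ab.
- move=> t ht; have [s hs] := fB t; have [c yc hc] := gap_r (f t) s.
  have [y hy] := between yc; exists y; split; first by ord.
  by move=> z hz Bz; apply: (hc z (hs z Bz)); ord.
- by move=> t ht x y z [x1 Gx] [z1 Gz] xyz; split=> [|w hw]; [|apply: Gz]; ord.
- move=> t ht y [y1 Gy]; have [s hs] := fB t; have [c yc hc] := gap_r y s.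
  exists (f t), c; split; first by ord.
  move=> u hu; split=> [|z hz Bz]; first by ord.
  case: (leP z y) => zy; first by apply: (Gy z) => //; ord.
  by apply: (hc z (hs z Bz)); ord.
by exists a', b', q; split=> // t ht; exact: h4.
Qed.

End LocalCount.

Section LocalCountDual.
Context {d : Order.disp_t} {M : orderType d} {Def : ((nat -> M) -> Prop) -> Prop}.
Context {om : omin_family Def}.
Notation dset := (dset Def). Notation dmap := (dmap Def). Notation dbin := (dbin Def).
Notation env := (nat -> M).
Implicit Types (A : M -> Prop) (x y z a b u v t : M) (B : M -> M -> Prop).

Lemma high_box B a b : dbin B -> (forall t, fin (B t)) -> a < b ->
  exists a' b' q, [/\ a <= a', a' < b', b' <= b & forall t, a' < t < b' -> forall z, q < z -> ~ B t z].
Proof.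
move=> hB fB ab.
have [a' [b' [q [h1 h2 h3 h4]]]] := @low_box _ (M^d) Def (om_dual om) B b a hB fB ab.
by exists b', a', q; split=> // t /andP[h5 h6] z qz; apply: h4 => //; apply/andP.
Qed.

Lemma gap_below_map B f a b : dbin B -> (forall t, fin (B t)) -> a < b -> dmap f ->
  exists a' b' q, [/\ a <= a', a' < b', b' <= b & forall t, a' < t < b' ->
    q < f t /\ forall z, q <= z < f t -> ~ B t z].
Proof.
move=> hB fB ab hf.
have [a' [b' [q [h1 h2 h3 h4]]]] := @gap_above_map _ (M^d) Def (om_dual om) B f b a hB fB ab hf.
exists b', a', q; split=> // t /andP[h5 h6]; have [|h7 h8] := h4 t; first exact/andP.
by split=> // z /andP[h9 h10]; apply: h8; apply/andP.
Qed.

(** Otherwise bad points exist over all t of an interval; let f t be the infimum of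
    the bad y. By common there is a box around the graph of f over a subinterval that
    meets the family in the graph of f or not at all. In it all points of the graph
    are regular by continuity of f, and all points above the graph because one more
    use of common finds a smaller box disjoint from the graph. *)
Lemma good_ex B a b : dbin B -> (forall t, fin (B t)) -> a < b ->
  (forall t, a < t < b -> ~ good B t) -> False.
Proof.
move=> hB fB ab ng.
have [a1 [b1 [q0 [aa1 ab1 bb1 low]]]] := low_box hB fB ab.
have [a2 [b2 [q1 [aa2 ab2 bb2 high]]]] := high_box hB fB ab1.
pose Y t y := ~ regular B t y.
have hY : dbin Y by rewrite /Y /regular /nb; def_tac.
have Yne t : a2 < t < b2 -> exists y, Y t y.
  move=> ht; apply: contrapT => h; apply: (ng t); first by ord.
  split; [|split].
  - by exists q1, a2, b2; split=> // t' ht' z; apply: high.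
  - by exists q0, a2, b2; split=> // t' ht' z; apply: low; ord.
  - by move=> y; apply: contrapT => nr; apply: h; exists y.
have Yge t y : a2 < t < b2 -> Y t y -> q0 <= y.
  move=> ht Yy; case: leP => // yq; case: Yy; split.
    by move=> By; case: (low t _ y yq) => //; ord.
  move=> _; have [p py] := below y; exists p, q0; split; first by ord.
  by exists a2, b2; split=> // t' ht' z hz; apply: low; ord.
pose U t y := exists z, Y t z /\ z <= y.
have hU : dbin U by rewrite /U; def_tac.
have [q0' hq0'] := below q0.
have [|||f [hf fE]] := inf_map (U := U) (a := a2) (b := b2) hU.
- by move=> t ht x y xy [z [Yz zx]]; exists z; split=> //; ord.
- by move=> t ht; have [y Yy] := Yne t ht; exists y, y.
- by move=> t ht; exists q0' => -[z [Yz zq]]; have := Yge t z ht Yz; ord.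
have {}fE t : a2 < t < b2 -> (forall y, Y t y -> f t <= y) /\
    forall q, f t < q -> exists2 y, Y t y & f t <= y <= q.
  move=> ht; have [h1 h2] := fE t ht.
  have h3 y : Y t y -> f t <= y.
    by move=> Yy; case: leP => // /h1 []; exists y.
  by split=> // q /h2[y [Yy yq]]; exists y => //; have := h3 y Yy; ord.
have [a3 [b3 [aa3 ab3 bb3 hc]]] := cont_sub hf ab2.
have [a4 [b4 [Q [aa4 ab4 bb4 hQ]]]] := gap_above_map hB fB ab3 hf.
have [a5 [b5 [P [aa5 ab5 bb5 hP]]]] := gap_below_map hB fB ab4 hf.
have dB : dset (fun t => B t (f t)) by def_tac.
have dY : dset (fun t => Y t (f t)) by def_tac.
have [a6 [b6 [aa6 ab6 bb6 cB]]] := subint ab5 dB.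
have [a7 [b7 [aa7 ab7 bb7 cY]]] := subint ab6 dY.
have box t z : a7 < t < b7 -> P <= z <= Q -> B t z -> z = f t.
  move=> ht hz Bz; have [|h1 h2] := hQ t; first by ord.
  have [|h3 h4] := hP t; first by ord.
  case: (ltgtP z (f t)) => // lt; exfalso.
    by apply: (h4 z) => //; ord.
  by apply: (h2 z) => //; ord.
have fPQ t : a7 < t < b7 -> P < f t < Q.
  move=> ht; have [|h1 h2] := hQ t; first by ord.
  by have [|h3 h4] := hP t; ord.
case: cY => cY.
  have [t ht] := between ab7; apply: (cY t ht); split.
    move=> Bt p q hpq.
    have {}cB t' : a6 < t' < b6 -> B t' (f t').
      by case: cB => [h|h] ht'; [exact: h|case: (h t) => //; ord].
    have fpq := fPQ t ht.
    exists (Order.max p P), (Order.min q Q); split.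
      split; first by rewrite le_max lexx.
      by split; [rewrite gt_max lt_min; ord|rewrite ge_min lexx].
    have n1 : nb t (fun t' => Order.max p P < f t' < Order.min q Q).
      by apply: hc; [ord|rewrite gt_max lt_min; ord].
    apply: nb_sub (nbI n1 (nb_itv ht)) => t' [h1 h2]; exists (f t').
      by split=> //; apply: cB; ord.
    move=> z'; rewrite gt_max lt_min => hz' Bz'; apply: box => //; ord.
  move=> nBt.
  have {}cB t' : a6 < t' < b6 -> ~ B t' (f t').
    by case: cB => [h|h] ht'; [case: nBt; apply: h; ord|exact: h].
  exists P, Q; split; first exact: fPQ.
  exists a7, b7; split=> // t' ht' z hz Bz.
  by apply: (cB t'); [ord|rewrite -(box t' z) //; ord].
pose G t y := f t < y < Q /\ exists2 z, Y t z & y < z < Q.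
have hG : dbin G by rewrite /G; def_tac.
have [|||a8 [b8 [c [aa8 ab8 bb8 h8]]]] := common hG ab7.
- move=> t ht; have fp := fPQ t ht; have [Q' hQ'] : exists Q', f t < Q' < Q by apply: between; ord.
  have [|_ /(_ Q')[|z Yz hz]] := fE t; [ord|ord|].
  have zf : f t <> z by move=> e; apply: (cY t ht); rewrite e.
  have [y hy] : exists y, f t < y < z by apply: between; ord.
  by exists y; split; [ord|exists z => //; ord].
- move=> t ht x y z [x1 Gx] [z1 [w Yw hw]] xyz; split; first by ord.
  by exists w => //; ord.
- move=> t ht y [y1 [w Yw hw]]; exists (f t), w; split; first by ord.
  by move=> u hu; split; [ord|exists w => //; ord].
have [t ht] := between ab8; have [h1 [z Yz hz]] := h8 t ht.
apply: Yz; split.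
  move=> Bz; have h2 : P < f t < Q by apply: fPQ; ord.
  have e : z = f t by apply: box => //; ord.
  by ord.
move=> _; exists c, Q; split=> //.
exists a8, b8; split=> // t' ht' w hw Bw.
have [h1' _] := h8 t' ht'; have h2 : P < f t' < Q by apply: fPQ; ord.
have e : w = f t' by apply: box => //; ord.
by ord.
Qed.

Lemma local_count (A : env -> M -> Prop) : drel Def A -> (forall r, fin (A r)) ->
  exists E, [/\ drel Def E, forall r, fin (E r) &
    forall r t, ~ E r t -> nb t (fun t' => cnt (A (t' .: r)) = cnt (A (t .: r)))].
Proof.
move=> hA fA; pose B r t y := A (t .: r) y.
exists (fun r t => ~ good (B r) t).
have hB : drel2 Def B by rewrite /B; def_tac.
have hB1 r : dbin (B r) by rewrite /B; def_tac.
split.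
- by rewrite /good /regular /nb; def_tac.
- move=> r; have [//|[a [b [ab h]]]] : fin (fun t => ~ good (B r) t) \/ exists a b, a < b /\
      forall t, a < t < b -> ~ good (B r) t.
    by have := hB1 r => hBr; apply: fin_or_itv; rewrite /good /regular /nb; def_tac.
  by case: (good_ex (hB1 r) (fun t => fA (t .: r)) ab h).
- move=> r t /contrapT gt; apply: (good_count (hB1 r)) gt => t'; exact: fA.
Qed.
End LocalCountDual.

(** * Uniform finiteness *)

Section Tame.
Context {d : Order.disp_t} {M : orderType d} {Def : ((nat -> M) -> Prop) -> Prop}.
Context {om : omin_family Def}.
Notation dset := (dset Def). Notation dbin := (dbin Def).
Notation denv := (denv Def). Notation dfun := (dfun Def). Notation drel := (drel Def).
Notation env := (nat -> M).
Implicit Types (x y z a b u v t : M) (r : env) (k : env -> nat) (A E G : env -> M -> Prop).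

(** Functions that are locally constant along each definable curve away from finitely
    many points, uniformly in parameters. Composition with definable maps preserves
    this, and it contains no bound on the number of values. *)
Definition tame k := (forall j, Def (fun r => (k r <= j)%N)) /\
  forall g : env -> env, denv g -> exists E, [/\ drel E, forall r, fin (E r) &
    forall r t, ~ E r t -> nb t (fun t' => k (g (t' .: r)) = k (g (t .: r)))].

Lemma tame_comp k (g : env -> env) : tame k -> denv g -> tame (fun r => k (g r)).
Proof.
move=> [hl hE] hg; split.
  by move=> j; have h := hl j; exact: (def_comp h hg).
by move=> g' hg'; apply: (hE (fun r => g (g' r))); exact: denv_comp.
Qed.

Lemma def_atmost A n : drel A -> Def (fun r => atmost n (A r)).
Proof.
elim: n A => [|n IH] A hA /=; first by def_tac.
apply: def_ex => /=.
have hA' : drel (fun r x => A (shift r) x /\ x <> r 0%N) by def_tac.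
exact: (IH _ hA').
Qed.

Lemma count_tame A : drel A -> (forall r, fin (A r)) -> tame (fun r => cnt (A r)).
Proof.
move=> hA fA; split.
  move=> j; apply: def_ext (def_atmost j hA) => r.
  by apply: iff_sym; apply: (cntP (r 0%N)).
move=> g hg; apply: (local_count (A := fun r => A (g r))) => //.
by def_tac.
Qed.

Lemma tame_eq k j : tame k -> Def (fun r => k r = j).
Proof.
move=> [hl _]; case: j => [|j].
  by apply: def_ext (hl 0%N) => r; rewrite leqn0; split=> /eqP.
apply: def_ext (def_and (hl j.+1) (def_not (hl j))) => r.
split=> [[h1 /negP]|->]; last by rewrite ltnn; split.
by rewrite -ltnNge => h2; apply/eqP; rewrite eqn_leq h1 h2.
Qed.

Definition depends m k := forall r r', (forall i, (i < m)%N -> r i = r' i) -> k r = k r'.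
Definition trunc (c : M) m r : env := fun i => if (i < m)%N then r i else c.

Lemma denv_trunc c m : denv (trunc c m).
Proof.
move=> n; rewrite /trunc; case: (n < m)%N; [exact: dfun_var|exact: dfun_cst].
Qed.
Lemma depends_trunc c m k : depends m (fun r => k (trunc c m r)).
Proof.
move=> r r' h; congr k; apply/funext => i; rewrite /trunc; case: ifP => // hi.
by rewrite h.
Qed.

Definition bounded (I : Type) (k : I -> nat) := exists N, forall i, (k i <= N)%N.
Definition tame_bounded m := forall k, tame k -> depends m k -> bounded k.

Lemma trunc_bounded c m k : tame_bounded m -> tame k -> bounded (fun r => k (trunc c m r)).
Proof.
by move=> tb kt; apply: tb; [exact: tame_comp kt (denv_trunc c m)|exact: depends_trunc].
Qed.

Section Step.
Variables (m : nat) (c : M) (k : env -> nat).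
Hypotheses (tb : tame_bounded m) (kt : tame k).

Lemma graph_bounded (e : env -> M) : dfun e -> exists N, forall r,
  (k (e (trunc c m r) .: trunc c m r) <= N)%N.
Proof.
move=> he; have hg : denv (fun r => e r .: r) by apply: denv_cons => //; exact: denv_id.
exact: (trunc_bounded c tb (tame_comp kt hg)).
Qed.

(** The value of k on the convex fibre G r is a tame function of r. By common, for all
    but finitely many t the fibre over t shares a point y with its neighbours, and
    there tameness of k with y fixed applies. *)
Lemma gap_bounded G : drel G -> (forall r, convex (G r)) -> (forall r, isopen (G r)) ->
  (forall r y, G r y -> nb y (fun y' => k (y' .: r) = k (y .: r))) ->
  exists N, forall r y, G (trunc c m r) y -> (k (y .: trunc c m r) <= N)%N.
Proof.
move=> hG cG oG lG.
have kcst r x y : G r x -> G r y -> x < y -> k (x .: r) = k (y .: r).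
  move=> Gx Gy xy.
  have hk := tame_eq (k (x .: r)) kt.
  have hr : dbin (fun u v => k (u .: r) = k (x .: r) <-> k (v .: r) = k (x .: r)).
    have he n : denv (fun r' => r' n .: r) by def_tac.
    by apply: def_iff; [exact: (def_comp hk (he 1%N))|exact: (def_comp hk (he 0%N))].
  apply/esym; apply: (iffLR (loc_rel hr _ xy _)) => // [u v w -> //|z hz].
  have [|a [b [zab h]]] := lG r z; first exact: convex_seg hz.
  by exists a, b; split=> // u v ? ? ?; rewrite (h u) ?(h v) //; ord.
pose kG r := if pselect (exists y, G r y) is left h then k (projT1 (cid h) .: r) else 0%N.
have kGE r y : G r y -> kG r = k (y .: r).
  move=> Gy; rewrite /kG; case: pselect => [h|[]]; last by exists y.
  case: (cid h) => y' Gy' /=; case: (ltgtP y y') => [lt|lt|->//]; last by rewrite (kcst _ _ _ Gy' Gy).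
  by rewrite -(kcst _ _ _ Gy Gy').
have kG0 r : ~ (exists y, G r y) -> kG r = 0%N by rewrite /kG; case: pselect.
have kGt : tame kG.
  split.
    move=> j; have hj : Def (fun r => (k r <= j)%N) by exact: kt.1.
    have h1 : Def (fun r => (exists y, G r y /\ (k (y .: r) <= j)%N) \/ ~ exists y, G r y).
      apply: def_or; last by def_tac.
      apply: def_ex; apply: def_and; first by def_tac.
      have he : denv (fun r => r 0%N .: shift r) by def_tac.
      exact: (def_comp hj he).
    apply: def_ext h1 => r; split.
      by move=> [[y [Gy kj]]|/kG0 ->//]; rewrite (kGE r y).
    move=> kj; have [[y Gy]|n] := pselect (exists y, G r y); last by right.
    by left; exists y; rewrite -(kGE r y).
  move=> g hg.
  pose h (q : env) := q 1%N .: g (q 0%N .: shift (shift q)).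
  have hh : denv h by rewrite /h; def_tac.
  have [E [hE fE lE]] := kt.2 h hh.
  pose ok r t := (exists y, nb t (fun t' => G (g (t' .: r)) y) /\ ~ E (y .: r) t) \/
     nb t (fun t' => forall y, ~ G (g (t' .: r)) y).
  exists (fun r t => ~ ok r t); split.
  - by rewrite /ok /nb; def_tac.
  - move=> r; have hok : dset (ok r) by rewrite /ok /nb; def_tac.
    have [//|[a [b [ab nok]]]] : fin (fun t => ~ ok r t) \/ exists a b, a < b /\
       forall t, a < t < b -> ~ ok r t by apply: fin_or_itv; def_tac.
    exfalso.
    have hG' : dbin (fun t y => G (g (t .: r)) y) by def_tac.
    have hne : dset (fun t => exists y, G (g (t .: r)) y) by def_tac.
    have [a1 [b1 [aa1 ab1 bb1 [ne|em]]]] := subint ab hne; last first.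
      have [t ht] := between ab1; apply: (nok t); first by ord.
      right; exists a1, b1; split=> // t' ht' y Gy; apply: (em t' ht'); by exists y.
    have [|||a2 [b2 [y [aa2 ab2 bb2 hy]]]] := common hG' ab1.
    + exact: ne.
    + by move=> t _; exact: cG.
    + by move=> t _; exact: oG.
    apply: (itv_notfin ab2); apply: fin_sub (fE (y .: r)) => t ht.
    apply: contrapT => nE; apply: (nok t); first by ord.
    by left; exists y; split=> //; exists a2, b2.
  - move=> r t /contrapT [[y [nG /lE nE]]|nG].
      have := nb_at nG => Gt.
      apply: nb_sub (nbI nG nE) => t' [Gt' kE].
      by rewrite (kGE _ _ Gt) (kGE _ _ Gt').
    have em := nb_at nG; apply: nb_sub nG => t' em'.
    by rewrite !kG0 // => -[y]; [exact: em|exact: em'].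
have [N hN] := trunc_bounded c tb kGt.
by exists N => r y Gy; rewrite -(kGE _ _ Gy).
Qed.

(** Peel off the least exceptional point e r: below it k is constant along the fibre,
    on its graph k is a tame function of fewer variables, and above it one exceptional
    point fewer is left. *)
Lemma pieces_bounded N G E : drel G -> drel E -> (forall r, convex (G r)) ->
  (forall r, isopen (G r)) -> (forall r, atmost N (fun y => G r y /\ E r y)) ->
  (forall r y, G r y -> ~ E r y -> nb y (fun y' => k (y' .: r) = k (y .: r))) ->
  exists N', forall r y, G (trunc c m r) y -> (k (y .: trunc c m r) <= N')%N.
Proof.
elim: N G => [|N IH] G hG hE cG oG aG lG.
  apply: gap_bounded => // r y Gy; apply: lG => // Ey.
  by apply: (aG r y).
pose D r := exists y, G r y /\ E r y.
have hD : Def D by rewrite /D; def_tac.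
have hGE : drel (fun r y => G r y /\ E r y) by def_tac.
have [e [he eE]] := dfun_min hGE (fun r => atmost_fin (aG r)).
pose G1 r y := G r y /\ (D r -> y < e r).
pose G2 r y := G r y /\ (D r /\ e r < y).
have hG1 : drel G1 by rewrite /G1; def_tac.
have hG2 : drel G2 by rewrite /G2; def_tac.
have [N1 hN1] : exists N', forall r y, G1 (trunc c m r) y -> (k (y .: trunc c m r) <= N')%N.
  apply: gap_bounded => //.
  - move=> r x y z [Gx hx] [Gz hz] xyz; split; first exact: cG Gx Gz xyz.
    by move=> Dr; have := hz Dr; ord.
  - move=> r y [Gy hy]; have [a [b [yab h]]] := oG r y Gy.
    have [Dr|nD] := pselect (D r); last by exists a, b; split=> // u hu; split=> //; exact: h.
    apply: nb_sub (nbI (oG r y Gy) (nb_itv (_ : a < y < e r))); last by have := hy Dr; ord.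
    by move=> u [h1 h2]; split=> // _; ord.
  - move=> r y [Gy hy]; apply: lG => // Ey.
    have Dr : D r by exists y.
    have [_ /(_ y (conj Gy Ey))] := eE r Dr; have := hy Dr; ord.
have [N2 hN2] : exists N', forall r y, G2 (trunc c m r) y -> (k (y .: trunc c m r) <= N')%N.
  apply: IH => //.
  - move=> r x y z [Gx [Dr hx]] [Gz hz] xyz; split; first exact: cG Gx Gz xyz.
    by split=> //; ord.
  - move=> r y [Gy [Dr hy]]; have [a [b [yab h]]] := oG r y Gy.
    apply: nb_sub (nbI (oG r y Gy) (nb_itv (_ : e r < y < b))); last by ord.
    by move=> u [h1 h2]; split=> //; split=> //; ord.
  - move=> r; have [Dr|nD] := pselect (D r); last first.
      by apply: (seq_atmost c (s := [::])) => // y [[_ []]].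
    have [ge _] := eE r Dr; apply: (atmost_drop c (aG r) ge).
    by move=> y [[Gy [_ ey]] Ey]; split=> // ye; rewrite ye in ey; ord.
  - by move=> r y [Gy _]; exact: lG.
have [N3 hN3] := graph_bounded he.
exists (maxn N1 (maxn N2 N3)) => r y Gy; set r' := trunc c m r in Gy *.
rewrite !leq_max.
have [Dr|nD] := pselect (D r'); last by rewrite hN1 //; split.
case: (ltgtP y (e r')) => h.
- by rewrite hN1.
- by rewrite hN2 ?orbT.
- by rewrite h hN3 !orbT.
Qed.
End Step.

(** The exceptional points in the direction of the first variable form a family of
    finite sets depending on the others, and the size of its members is a tame
    function of one variable fewer. *)
Lemma all_tame_bounded m : tame_bounded m.
Proof.
have [c] : inhabited M := om_inh.
elim: m => [|m IH] k kt dk.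
  by exists (k (fun=> c)) => r; rewrite (dk r (fun=> c)).
have hid : denv (fun r => r) by exact: denv_id.
have [E [hE fE lE]] := kt.2 _ hid.
have [N hN] := trunc_bounded c IH (count_tame hE fE).
have kE r y : k (y .: r) = k (y .: trunc c m r).
  by apply: dk => -[|i] //= hi; rewrite /trunc -ltnS hi.
have ht := denv_trunc c m.
have [||||||N' hN'] := @pieces_bounded m c k IH kt N (fun _ _ => True) (fun r y => E (trunc c m r) y).
- by def_tac.
- by def_tac.
- by [].
- move=> r y _; have [a ay] := below y; have [b yb] := above y; exists a, b; split => //; ord.
- move=> r; have := hN r; rewrite (cntP c N (fE _)) => /atmost_seq[s sn hs].
  by apply: (seq_atmost c sn) => y [_ /hs].
- move=> r y _ /lE; apply: nb_sub => y' e; rewrite kE e -kE //.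
exists N' => r.
have -> : k r = k (r 0%N .: trunc c m (shift r)).
  by apply: dk => -[|i] //= hi; rewrite /trunc -ltnS hi.
exact: hN'.
Qed.

Theorem uniform_finiteness A : drel A -> (forall r, fin (A r)) ->
  exists N, forall r, atmost N (A r).
Proof.
move=> hA fA; have [c] : inhabited M := om_inh.
have [n hn] := om_support hA.
have key r r' : (forall i, (i < n)%N -> r i = r' i) -> forall y, A r y -> A r' y.
  move=> h y Ay; apply: (hn (y .: r) (y .: r')) Ay => -[|i] //= hi.
  by apply: h; exact: ltnW.
have dA : depends n (fun r => cnt (A r)).
  move=> r r' h; congr cnt; apply/funext => y; apply/propext.
  by split; apply: key => // i hi; rewrite h.
have [N hN] := all_tame_bounded (count_tame hA fA) dA.
by exists N => r; apply/(cntP c N (fA r)).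
Qed.
End Tame.

(** * Integration against the Euler characteristic on the line *)

Definition indic (P : Prop) : int := if `[< P >] then 1%R else 0%R.
Lemma indT (P : Prop) : P -> indic P = 1%R.
Proof. by rewrite /indic => h; case: asboolP. Qed.
Lemma indF (P : Prop) : ~ P -> indic P = 0%R.
Proof. by rewrite /indic => h; case: asboolP. Qed.
Lemma ind_iff (P Q : Prop) : (P <-> Q) -> indic P = indic Q.
Proof. by move=> h; congr indic; apply/propext. Qed.

Lemma sum_support (T : eqType) (F : T -> int) (s t : seq T) : uniq s -> uniq t ->
  (forall x, x \notin s -> F x = 0%R) -> (forall x, x \notin t -> F x = 0%R) ->
  (\sum_(x <- s) F x = \sum_(x <- t) F x)%R.
Proof.
move=> us ut hs ht.
have key u : (\sum_(x <- u) F x = \sum_(x <- [seq x <- u | F x != 0%R]) F x)%R.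
  rewrite big_filter [RHS]big_mkcond; apply: eq_bigr => x _; by case: eqP.
rewrite key [RHS]key; apply: perm_big; apply: uniq_perm; rewrite ?filter_uniq // => x.
rewrite !mem_filter; case: eqP => //= /eqP Fx.
have -> : x \in s by apply: contraNT Fx => /hs ->.
by apply/esym; apply: contraNT Fx => /ht ->.
Qed.

Section Integral.
Context {d : Order.disp_t} {M : orderType d} {Def : ((nat -> M) -> Prop) -> Prop}.
Context {om : omin_family Def}.
Notation dset := (dset Def).
Implicit Types (A B : M -> Prop) (x y z a b u : M) (v : int) (phi psi : M -> int).

Definition stepf phi := exists s, step phi s.
Definition rlim phi e : int := xget 0%R [set v | nbr e (fun u => phi u = v)].
Definition minf phi : int := xget 0%R [set v | exists b, forall u, u < b -> phi u = v].
Definition jump phi e : int := (phi e - rlim phi e)%R.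

(** The sum over e of phi(e) - phi(e+), minus the value at minus infinity. This equals
    the sum of the values at the points of a finite set minus the sum of the values on
    the complementary open intervals, but does not refer to a choice of such a set. *)
Definition euler phi : int :=
  if pselect (exists s, uniq s /\ forall e, e \notin s -> jump phi e = 0%R) is left h
  then (\sum_(e <- projT1 (cid h)) jump phi e - minf phi)%R else 0%R.

Lemma eulerE phi s : uniq s -> (forall e, e \notin s -> jump phi e = 0%R) ->
  euler phi = (\sum_(e <- s) jump phi e - minf phi)%R.
Proof.
move=> us hs; rewrite /euler; case: pselect => [h|[]]; last by exists s.
by case: (cid h) => t [ut ht] /=; congr (_ - _)%R; apply: sum_support.
Qed.

Lemma rlimE phi e v : nbr e (fun u => phi u = v) -> rlim phi e = v.
Proof.
move=> h; rewrite /rlim; case: xgetP => [w -> /= hw|/(_ v)//].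
by have [u [_ [<- <-]]] := nbr_neq0 (nbrI h hw).
Qed.

Lemma minfE phi v : (exists b, forall u, u < b -> phi u = v) -> minf phi = v.
Proof.
move=> [b hb]; rewrite /minf; case: xgetP => [w -> /= [c hc]|/(_ v)[]]; last by exists b.
have [u] := below (Order.min b c); rewrite lt_min => hu.
by rewrite -(hb u) ?(hc u) //; ord.
Qed.

Lemma stepf_r phi e : stepf phi -> exists v, nbr e (fun u => phi u = v).
Proof.
move=> [s hs]; have [b eb hb] := step_r e hs; have [c hc] := between eb.
by exists (phi c), b => // u hu; apply: hb.
Qed.

Lemma stepf_rlim phi e : stepf phi -> nbr e (fun u => phi u = rlim phi e).
Proof. by move=> /(stepf_r e)[v hv]; rewrite (rlimE hv). Qed.

Lemma seq_below (s : seq M) : exists b, forall z, z \in s -> b < z.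
Proof.
elim: s => [|z s [b hb]]; first by have [c] : inhabited M := om_inh; exists c.
have [c] := below (Order.min b z); rewrite lt_min => hc; exists c => w.
by rewrite inE => /orP[/eqP ->|/hb]; ord.
Qed.

Lemma stepf_minf phi : stepf phi -> exists b, forall u, u < b -> phi u = minf phi.
Proof.
move=> [s hs]; have [b hb] := seq_below s.
have [c cb] := below b.
have h u : u < b -> phi u = phi c.
  move=> ub; case: (ltgtP u c) => [uc|cu|->//]; [|apply/esym]; apply: hs => // z /hb; ord.
exists b => u ub; rewrite h //; apply/esym/minfE; exists b => w wb; exact: h.
Qed.

Lemma stepf_jump phi s : step phi s -> forall e, e \notin s -> jump phi e = 0%R.
Proof.
move=> hs e es; rewrite /jump (@rlimE phi e (phi e)) ?subrr //.
have [b eb hb] := gap_r e s; exists b => // u hu; apply/esym; apply: hs; first by ord.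
move=> z zs hz; case: (ltgtP e z) => h; last by rewrite h zs in es.
  by apply: (hb z zs); ord.
by ord.
Qed.

Lemma euler_sub phi psi : stepf phi -> stepf psi ->
  euler (fun x => phi x - psi x)%R = (euler phi - euler psi)%R.
Proof.
move=> sp sq; have [s hs] := sp; have [t ht] := sq.
have rs e : rlim (fun x => phi x - psi x)%R e = (rlim phi e - rlim psi e)%R.
  apply: rlimE; apply: nbr_sub (nbrI (stepf_rlim e sp) (stepf_rlim e sq)).
  by move=> u [-> ->].
have ms : minf (fun x => phi x - psi x)%R = (minf phi - minf psi)%R.
  apply: minfE; have [b hb] := stepf_minf sp; have [c hc] := stepf_minf sq.
  exists (Order.min b c) => u; rewrite lt_min => /andP[ub uc].
  by rewrite hb // hc.
have js e : jump (fun x => phi x - psi x)%R e = (jump phi e - jump psi e)%R.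
  by rewrite /jump rs; ring.
pose w := undup (s ++ t).
have h1 e : e \notin w -> jump phi e = 0%R.
  by rewrite mem_undup mem_cat negb_or => /andP[h _]; exact: stepf_jump hs _ h.
have h2 e : e \notin w -> jump psi e = 0%R.
  by rewrite mem_undup mem_cat negb_or => /andP[_ h]; exact: stepf_jump ht _ h.
rewrite (eulerE (undup_uniq _) h1) (eulerE (undup_uniq _) h2) (@eulerE _ w) ?undup_uniq //.
  by rewrite (eq_bigr _ (fun e _ => js e)) sumrB ms; ring.
by move=> e he; rewrite js h1 // h2.
Qed.

Lemma euler_scale (c : int) phi : stepf phi -> euler (fun x => c * phi x)%R = (c * euler phi)%R.
Proof.
move=> sp; have [s hs] := sp.
have rs e : rlim (fun x => c * phi x)%R e = (c * rlim phi e)%R.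
  by apply: rlimE; apply: nbr_sub (stepf_rlim e sp) => u ->.
have ms : minf (fun x => c * phi x)%R = (c * minf phi)%R.
  by apply: minfE; have [b hb] := stepf_minf sp; exists b => u /hb ->.
have js e : jump (fun x => c * phi x)%R e = (c * jump phi e)%R.
  by rewrite /jump rs; ring.
have h1 e : e \notin undup s -> jump phi e = 0%R.
  by rewrite mem_undup; exact: stepf_jump.
rewrite (eulerE (undup_uniq _) h1) (@eulerE _ (undup s)) ?undup_uniq //.
  by rewrite (eq_bigr _ (fun e _ => js e)) -mulr_sumr ms; ring.
by move=> e he; rewrite js h1 // mulr0.
Qed.

Lemma stepf_cst (c : int) : stepf (fun=> c).
Proof. by exists [::]. Qed.
Lemma stepf_sub phi psi : stepf phi -> stepf psi -> stepf (fun x => phi x - psi x)%R.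
Proof.
move=> [s hs] [t ht]; exists (s ++ t) => x y xy h.
by rewrite (hs x y) ?(ht x y) // => z zs; apply: h; rewrite mem_cat zs ?orbT.
Qed.
Lemma stepf_ind A : dset A -> stepf (fun x => indic (A x)).
Proof.
move=> /dset_step[s hs]; exists s => x y xy h; congr indic; exact: hs.
Qed.

Lemma euler_cst (c : int) : euler (fun=> c) = (- c)%R.
Proof.
rewrite (@eulerE _ [::]) //; last first.
  move=> e _; apply: (@stepf_jump _ [::]) => //.
rewrite big_nil sub0r; congr (- _)%R; apply: minfE.
by have [b] : inhabited M := om_inh; exists b.
Qed.

Lemma euler_point a : euler (fun x => indic (x = a)) = 1%R.
Proof.
have j0 e : e <> a -> jump (fun x => indic (x = a)) e = 0%R.
  move=> ea; rewrite /jump (@rlimE _ e 0%R) ?subr0 ?indF //.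
  have [b eb hb] := gap_r e [:: a]; exists b => // u hu; rewrite indF // => ua.
  by apply: (hb a); [rewrite inE|rewrite -ua].
rewrite (@eulerE _ [:: a]) //; last first.
  by move=> e; rewrite inE => /eqP; exact: j0.
rewrite big_seq1 /jump indT // (@rlimE _ a 0%R); last first.
  have [b ab] := above a; exists b => // u hu; rewrite indF // => ua; rewrite ua in hu; ord.
rewrite (@minfE _ 0%R) //; exists a => u ua; rewrite indF // => e; rewrite e in ua; ord.
Qed.

(** An open interval contributes only at its lower end, where the value jumps from 0
    to 1, or at minus infinity. *)
Lemma euler_convex A : dset A -> convex A -> isopen A -> (exists x, A x) ->
  euler (fun x => indic (A x)) = (-1)%R.
Proof.
move=> hA cA oA [x0 Ax0].
have jA e : A e -> jump (fun x => indic (A x)) e = 0%R.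
  move=> Ae; rewrite /jump (@rlimE _ e 1%R) ?indT //.
  by apply: nbr_sub (nb_r (oA e Ae)) => u Au; rewrite indT.
have jnA e : nbr e (fun u => ~ A u) -> ~ A e -> jump (fun x => indic (A x)) e = 0%R.
  move=> h Ae; rewrite /jump (@rlimE _ e 0%R) ?indF //.
  by apply: nbr_sub h => u Au; rewrite indF.
pose U x := exists2 u, A u & u < x.
have hU : dset U by rewrite /U; def_tac.
have [hall|nall] := pselect (forall x, U x).
  rewrite (@eulerE _ [::]) //.
    rewrite big_nil sub0r; congr (- _)%R; apply: minfE; exists x0 => u ux.
    by have [w Aw wu] := hall u; rewrite indT //; apply: (cA w u x0) => //; ord.
  move=> e _; have [Ae|nAe] := pselect (A e); [exact: jA|apply: jnA => //].
  have [b eb] := above e; exists b => // u hu Au; apply: nAe.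
  by have [w Aw we] := hall e; apply: (cA w e u) => //; ord.
have [x y xy [u Au ux]|||e [lo up]] := cut_inf hU.
- by exists u => //; ord.
- by have [y xy] := above x0; exists y, x0.
- by apply: contrapT => h; apply: nall => x; apply: contrapT => h'; apply: h; exists x.
have Age u : A u -> e < u.
  move=> Au; have [a [b [uab h]]] := oA u Au.
  have [w hw] : exists w, a < w < u by apply: between; ord.
  have [w' hw'] : exists w', w < w' < u by apply: between; ord.
  case: (leP w' e) => h'; last by ord.
  have [w'' hw''] : exists w'', w < w'' < w' by apply: between; ord.
  case: (lo w''); first by ord.
  by exists w; [apply: h|]; ord.
have eA : nbr e A.
  exists x0; first exact: Age.
  move=> u hu; have [w Aw wu] := up u ltac:(ord).
  by apply: (cA w u x0) => //; ord.
have je : jump (fun x => indic (A x)) e = (-1)%R.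
  rewrite /jump (@rlimE _ e 1%R) ?indF //; first by move=> /Age; rewrite ltxx.
  by apply: nbr_sub eA => u Au; rewrite indT.
rewrite (@eulerE _ [:: e]) //.
  rewrite big_seq1 je (@minfE _ 0%R) //; exists e => u ue; rewrite indF // => /Age; ord.
move=> y; rewrite inE => /eqP ye.
have [Ay|nAy] := pselect (A y); [exact: jA|apply: jnA => //].
case: (ltgtP y e) => // lt.
  by exists e => // u hu /Age; ord.
have [b yb] := above y; exists b => // u hu Au; apply: nAy.
have [w Aw wu] := up y lt; apply: (cA w y u) => //; ord.
Qed.
End Integral.

(** * Constructible functions *)

Section Constructible.
Context {d : Order.disp_t} {M : orderType d} (Def : ((nat -> M) -> Prop) -> Prop).
Context {om : omin_family Def}.
Notation dset := (dset Def).
Notation denv := (denv Def). Notation dfun := (dfun Def). Notation drel := (drel Def).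
Notation env := (nat -> M).
Implicit Types (x y z a b u t : M) (r : env) (A E G : env -> M -> Prop) (P D : env -> Prop).
Implicit Types (F : env -> int).

Inductive constructible : (env -> int) -> Prop :=
| con_indic P : Def P -> constructible (fun r => indic (P r))
| con_sub F F' : constructible F -> constructible F' -> constructible (fun r => F r - F' r)%R.

Lemma con_ext F F' : (forall r, F r = F' r) -> constructible F -> constructible F'.
Proof. by move=> h; have -> : F = F' by apply/funext. Qed.
Lemma con_opp F : constructible F -> constructible (fun r => - F r)%R.
Proof.
have h0 : Def (fun=> False) by exact: def_False.
move=> h; have := con_sub (con_indic h0) h.
by apply: con_ext => r; rewrite indF // sub0r.
Qed.
Lemma con_add F F' : constructible F -> constructible F' -> constructible (fun r => F r + F' r)%R.
Proof.
by move=> h h'; apply: (con_ext _ (con_sub h (con_opp h'))) => r; ring.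
Qed.
Lemma con_comp F (g : env -> env) : denv g -> constructible F -> constructible (fun r => F (g r)).
Proof.
move=> hg; elim=> [P hP|F1 F2 _ h1 _ h2]; last exact: con_sub.
by apply: con_indic; exact: (def_comp hP hg).
Qed.
Lemma con_step F r : constructible F -> stepf (fun x => F (x .: r)).
Proof.
move=> hF; elim: hF r => [P hP r|F1 F2 _ h1 _ h2 r]; last exact: stepf_sub.
have hd : dset (fun x => P (x .: r)) by def_tac.
exact: stepf_ind hd.
Qed.

(** Induction on a bound for the number of discontinuities of the fibres of A, given
    by uniform finiteness. If e r is the least one, then A r is constant below e r;
    the set A' obtained by continuing to the left the values of A just after e r has
    one discontinuity fewer, and differs from A in the region below the graph of e and
    on the graph. *)
Lemma con_decompose (K : (env -> int) -> Prop) :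
  (forall F F', K F -> K F' -> K (fun r => F r - F' r)%R) ->
  (forall D, Def D -> K (fun r => indic (D (shift r)))) ->
  (forall D e, Def D -> dfun e -> K (fun r => indic (D (shift r) /\ r 0%N < e (shift r)))) ->
  (forall D e, Def D -> dfun e -> K (fun r => indic (D (shift r) /\ r 0%N = e (shift r)))) ->
  forall P, Def P -> K (fun r => indic (P r)).
Proof.
move=> Ksub K0 K1 K2.
have Kext F F' : (forall r, F r = F' r) -> K F -> K F'.
  by move=> h; have -> : F = F' by apply/funext.
have Kadd F F' : K F -> K F' -> K (fun r => F r + F' r)%R.
  have h0 : Def (fun=> False) by exact: def_False.
  move=> h h'; have := Ksub _ _ (K0 _ h0) h'.
  by move=> /(Ksub _ _ h); apply: Kext => r; rewrite indF //; ring.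
suff key A : drel A -> K (fun r => indic (A (shift r) (r 0%N))).
  move=> P hP; have h : drel (fun r x => P (x .: r)) by def_tac.
  by apply: (Kext _ _ _ (key _ h)) => r; congr (indic (P _)); apply/funext => -[].
move=> hA.
pose E A r z := ~ nb z (fun z' => A r z' <-> A r z).
have hE B : drel B -> drel (E B) by move=> hB; rewrite /E /nb; def_tac.
have fE B r : drel B -> fin (E B r).
  move=> hB; have hBr : dset (B r) by def_tac.
  have [s hs] := dset_step hBr; exists s => z Ez; apply: contrapT => /negP zs; apply: Ez.
  have [b zb hb] := gap_r z s; have [a az ha] := gap_l z s; exists a, b; split; first by ord.
  move=> u hu; suff -> : B r u = B r z by [].
  case: (ltgtP u z) => [uz|zu|->//]; [|apply/esym]; apply: hs => // w ws hw.
    case: (ltgtP w z) => wz; [apply: (ha w ws)|by ord|by rewrite wz (negbTE zs) in ws]; ord.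
  case: (ltgtP w z) => wz; [by ord|apply: (hb w ws)|by rewrite wz (negbTE zs) in ws]; ord.
have Ecst B r x y : drel B -> x < y -> (forall z, x <= z <= y -> ~ E B r z) -> B r x <-> B r y.
  move=> hB xy hz; apply: (loc_rel (r := fun u v => B r u <-> B r v) (Def := Def)) => //.
  - by def_tac.
  - by move=> u v w h h'; rewrite h h'.
  - move=> z /hz /contrapT[a [b [zab h]]]; exists a, b; split=> // u v ? ? ?.
    by rewrite (h u) ?(h v) //; ord.
have [N hN] := uniform_finiteness (hE _ hA) (fun r => fE _ r hA).
elim: N A hA hN => [|N IH] A hA hN.
  have hD : Def (fun r => exists y, A r y) by def_tac.
  apply: (Kext _ _ _ (K0 _ hD)) => r; apply: ind_iff; split=> [[y Ay]|]; last by exists (r 0%N).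
  case: (ltgtP y (r 0%N)) => [lt|lt|<-//].
    by rewrite -(Ecst A _ _ _ hA lt) // => z _; exact: hN.
  by rewrite (Ecst A _ _ _ hA lt) // => z _; exact: hN.
have [e [he eE]] := dfun_min (hE _ hA) (fun r => fE _ r hA).
pose D r := exists z, E A r z.
have hEA := hE _ hA.
have hD : Def D by rewrite /D; def_tac.
(* The truth values of A r before, just after and at its least discontinuity. *)
pose a r := D r /\ exists z, z < e r /\ A r z.
pose g r := D r /\ nbr (e r) (A r).
pose b r := D r /\ A r (e r).
pose A' r z := (~ D r /\ A r z) \/ (D r /\ ((z <= e r /\ g r) \/ (e r < z /\ A r z))).
have ha : Def a by rewrite /a; def_tac.
have hg : Def g by rewrite /g /nbr; def_tac.
have hb : Def b by rewrite /b; def_tac.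
have hA' : drel A' by rewrite /A'; def_tac.
have KA' : K (fun r => indic (A' (shift r) (r 0%N))).
  have [c] : inhabited M := om_inh.
  apply: IH => // r; have [Dr|nD] := pselect (D r); last first.
    have eA : A' r = A r by apply/funext => z; apply/propext; rewrite /A'; tauto.
    apply: (seq_atmost c (s := [::])) => // z; rewrite /E eA => Ez.
    by case: nD; exists z.
  have [Ee emin] := eE r Dr.
  apply: (atmost_drop c (hN r) Ee) => z Ez.
  have lo u : u <= e r -> A' r u <-> g r.
    move=> ue; rewrite /A'; split; last by tauto.
    by case=> [[]//|[_ [[]//|[]]]]; ord.
  have hi u : e r < u -> A' r u <-> A r u.
    move=> ue; rewrite /A'; split; last by tauto.
    by case=> [[]//|[_ [[]|[]//]]]; ord.
  have ne : z <> e r.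
    move=> ze; apply: Ez; rewrite ze; apply: nb_lr.
    - have [w ew] := below (e r); exists w => // u hu; rewrite !lo //; ord.
    - have hAr : dset (A r) by def_tac.
      have [h|h] := germ_r (e r) hAr.
        have [w ew] := above (e r).
        have h2 : nbr (e r) (fun u => e r < u < w) by exists w.
        apply: nbr_sub (nbrI h h2) => u [Au hu]; rewrite hi; last by ord.
        by rewrite lo //; split.
      have ng : ~ g r by case=> _ h'; have [u [_ []]] := nbr_neq0 (nbrI h h').
      have [w ew] := above (e r).
      have h2 : nbr (e r) (fun u => e r < u < w) by exists w.
      apply: nbr_sub (nbrI h h2) => u [nAu hu]; rewrite hi; last by ord.
      by rewrite lo //; split.
    - by [].
  split=> // hz; apply: Ez; case: (ltgtP z (e r)) => // lt.
    have [w ew] := below z; exists w, (e r); split; first by ord.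
    by move=> u hu; rewrite !lo //; ord.
  have [w ew] := above z.
  apply: nb_sub (nbI hz (nb_itv (_ : e r < z < w))); last by ord.
  by move=> u [h1 h2]; rewrite !hi //; ord.
have := Kadd _ _ (Ksub _ _ (Kadd _ _ KA' (Ksub _ _ (K1 _ _ ha he) (K1 _ _ hg he))) (K2 _ _ hg he)) (K2 _ _ hb he).
(* A and A' differ by a - g below the graph of e and by b - g on it. *)
apply: Kext => r0; move: (shift r0) (r0 0%N) => {r0} r z.
have [Dr|nD] := pselect (D r); last first.
  rewrite !(@indF (_ /\ _)); try by (try rewrite /a; try rewrite /g; try rewrite /b; tauto).
  rewrite (ind_iff (Q := A r z)); last by rewrite /A'; tauto.
  by ring.
have [Ee emin] := eE r Dr.
case: (ltgtP z (e r)) => lt.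
- have -> : indic (A' r z) = indic (g r).
    apply: ind_iff; rewrite /A'; split; last by move=> h; right; split=> //; left; split=> //; ord.
    by case=> [[]//|[_ [[]//|[]]]]; ord.
  have -> : indic (a r /\ true) = indic (A r z).
    apply: ind_iff; rewrite /a; split; last by move=> Az; do !split=> //; exists z.
    move=> [[_ [w [we Aw]]] _].
    have nE u : u < e r -> ~ E A r u by move=> ue /emin; ord.
    case: (ltgtP w z) => [wz|zw|<-//].
      by rewrite -(Ecst A _ _ _ hA wz) // => u hu; apply: nE; ord.
    by rewrite (Ecst A _ _ _ hA zw) // => u hu; apply: nE; ord.
  have -> : indic (g r /\ true) = indic (g r) by apply: ind_iff; split=> [[]|].
  have ze : z <> e r by apply/eqP; rewrite lt_eqF.
  rewrite (@indF (g r /\ z = e r)); last by case.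
  rewrite (@indF (b r /\ z = e r)); last by case.
  by ring.
- have -> : indic (A' r z) = indic (A r z).
    apply: ind_iff; rewrite /A'; split; last by tauto.
    by case=> [[]//|[_ [[]|[]//]]]; ord.
  have ze : z <> e r by apply/eqP; rewrite gt_eqF.
  rewrite (@indF (g r /\ z = e r)); last by case.
  rewrite (@indF (b r /\ z = e r)); last by case.
  rewrite (@indF (a r /\ false)); last by case.
  rewrite (@indF (g r /\ false)); last by case.
  by ring.
- have -> : indic (A' r z) = indic (g r).
    apply: ind_iff; rewrite /A'; split; last by move=> h; right; split=> //; left; split=> //; rewrite lt.
    by case=> [[]//|[_ [[]//|[]]]]; rewrite lt ltxx.
  rewrite (@indF (a r /\ false)); last by case.
  rewrite (@indF (g r /\ false)); last by case.
  have -> : indic (g r /\ z = e r) = indic (g r) by apply: ind_iff; split=> [[]|].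
  have -> : indic (b r /\ z = e r) = indic (A r z).
    by apply: ind_iff; rewrite /b -lt; split=> [[[]]|].
  by ring.
Qed.
End Constructible.

(** * Fubini *)

Section Fubini.
Context {d : Order.disp_t} {M : orderType d} {Def : ((nat -> M) -> Prop) -> Prop}.
Context {om : omin_family Def}.
Notation dset := (dset Def). Notation dmap := (dmap Def). Notation dbin := (dbin Def).
Notation denv := (denv Def).
Notation constructible := (constructible Def).
Notation env := (nat -> M).
Implicit Types (x y z a b u t : M) (r : env) (A E G J : M -> Prop) (P D : env -> Prop).
Implicit Types (F : env -> int) (f : M -> M).

Definition euler_head F : env -> int := fun r => euler (fun x => F (x .: r)).

Lemma euler_ext (phi psi : M -> int) : (forall x, phi x = psi x) -> euler phi = euler psi.
Proof. by move=> h; congr euler; apply/funext. Qed.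

Lemma euler_lower (p : Prop) a : euler (fun x => indic (p /\ x < a)) = (- indic p)%R.
Proof.
have [hp|np] := pselect p; last first.
  rewrite (euler_ext (psi := fun=> 0%R)) ?euler_cst ?indF // => x.
  by rewrite indF // => -[].
have hA : dset (fun x => p /\ x < a) by def_tac.
rewrite (indT hp); apply: (euler_convex hA).
- by move=> x y z [_ hx] [_ hz] h; split=> //; ord.
- move=> x [_ hx]; have [w wx] := below x; exists w, a; split; first by ord.
  by move=> u hu; split=> //; ord.
- by have [w wa] := below a; exists w.
Qed.

Lemma euler_graph_fibre (p : Prop) a : euler (fun x => indic (p /\ x = a)) = indic p.
Proof.
have [hp|np] := pselect p; last first.
  rewrite (euler_ext (psi := fun=> 0%R)) ?euler_cst ?indF // => x.
  by rewrite indF // => -[].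
rewrite (indT hp) -[RHS](euler_point (om := om) a); apply: euler_ext => x.
by apply: ind_iff; split=> [[]|].
Qed.

Lemma euler_head_sub F F' r : constructible F -> constructible F' ->
  euler_head (fun r => F r - F' r)%R r = (euler_head F r - euler_head F' r)%R.
Proof. by move=> h h'; apply: euler_sub; apply: con_step. Qed.

Lemma con_euler_head F : constructible F -> constructible (euler_head F).
Proof.
suff key P : Def P -> constructible (fun r => indic (P r)) /\ constructible (euler_head (fun r => indic (P r))).
  elim=> [P /key[]//|F1 F2 h1 k1 h2 k2].
  by apply: con_ext (con_sub k1 k2) => r; rewrite euler_head_sub.
apply: (con_decompose (K := fun F => constructible F /\ constructible (euler_head F))).
- move=> F1 F2 [h1 k1] [h2 k2]; split; first exact: con_sub.
  by apply: con_ext (con_sub k1 k2) => r; rewrite euler_head_sub.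
- move=> D hD; split; first by apply: con_indic; def_tac.
  apply: con_ext (con_opp (con_indic hD)) => r.
  by rewrite /euler_head -euler_cst.
- move=> D e hD he; split; first by apply: con_indic; def_tac.
  by apply: con_ext (con_opp (con_indic hD)) => r; rewrite /euler_head -(euler_lower _ (e r)).
- move=> D e hD he; split; first by apply: con_indic; def_tac.
  by apply: con_ext (con_indic hD) => r; rewrite /euler_head -(euler_graph_fibre _ (e r)).
Qed.

Definition fubini_for (phi : M -> M -> int) :=
  euler (fun y => euler (fun z => phi y z)) = euler (fun z => euler (fun y => phi y z)).

Definition swap01 (r : env) : env := r 1%N .: (r 0%N .: shift (shift r)).
Lemma denv_swap01 : denv swap01. Proof. by rewrite /swap01; def_tac. Qed.

Lemma con_fubini_sub F F' r : constructible F -> constructible F' -> fubini_for (fun y z => F (z .: (y .: r))) ->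
  fubini_for (fun y z => F' (z .: (y .: r))) ->
  fubini_for (fun y z => F (z .: (y .: r)) - F' (z .: (y .: r)))%R.
Proof.
rewrite /fubini_for => h h' e e'.
have hs : constructible (fun r => F (swap01 r)) by exact: (con_comp denv_swap01 h).
have hs' : constructible (fun r => F' (swap01 r)) by exact: (con_comp denv_swap01 h').
transitivity (euler (fun y => euler_head F (y .: r) - euler_head F' (y .: r)))%R.
  by apply: euler_ext => y; rewrite -euler_head_sub.
rewrite euler_sub; [|exact: (con_step _ (con_euler_head h))|exact: (con_step _ (con_euler_head h'))].
rewrite /euler_head e e'.
transitivity (euler (fun z => euler_head (fun r => F (swap01 r)) (z .: r) - euler_head (fun r => F' (swap01 r)) (z .: r)))%R.
  rewrite euler_sub; [reflexivity|exact: (con_step _ (con_euler_head hs))|exact: (con_step _ (con_euler_head hs'))].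
by apply: euler_ext => z; rewrite -euler_head_sub.
Qed.

Lemma fubini_prod (phi psi : M -> int) : stepf phi -> stepf psi ->
  fubini_for (fun y z => phi y * psi z)%R.
Proof.
move=> hp hq; rewrite /fubini_for.
transitivity (euler phi * euler psi)%R.
  rewrite mulrC -euler_scale //; apply: euler_ext => y; by rewrite euler_scale // mulrC.
rewrite -euler_scale //; apply: euler_ext => z.
rewrite mulrC -euler_scale //; by apply: euler_ext => y; rewrite mulrC.
Qed.

Lemma fubini_ext (phi psi : M -> M -> int) : (forall y z, phi y z = psi y z) -> fubini_for phi -> fubini_for psi.
Proof.
by move=> h; have -> : phi = psi by apply/funext => y; apply/funext.
Qed.

(** An additive property of definable subsets of the line may be checked on points and
    on open intervals avoiding a given finite set, as each definable set is a finite
    disjoint union of these. *)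
Lemma cell_ind (Phi : (M -> Prop) -> Prop) s :
  Phi (fun=> False) ->
  (forall A E, dset A -> dset E -> (forall x, A x -> ~ E x) -> Phi A -> Phi E ->
     Phi (fun x => A x \/ E x)) ->
  (forall a, Phi (fun x => x = a)) ->
  (forall J, dset J -> convex J -> isopen J -> (forall z, z \in s -> ~ J z) -> Phi J) ->
  forall A, dset A -> step A s -> Phi A.
Proof.
move=> P0 PU P1 PJ A hA sA.
have Pext E G : (forall x, E x <-> G x) -> Phi E -> Phi G.
  by move=> h; have -> : E = G by apply/funext => x; apply/propext.
suff key (s' : seq M) J : dset J -> convex J -> isopen J ->
    (forall z, z \in s -> J z -> z \in s') -> Phi (fun x => J x /\ A x).
  have hT : dset (fun=> True) by def_tac.
  apply: (Pext (fun x => True /\ A x)); first by move=> x; tauto.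
  apply: (key s) => // x _; have [a ax] := below x; have [b xb] := above x.
  by exists a, b; split=> //; ord.
elim: s' J => [|e s' IH] J hJ cJ oJ hs.
  have sJ z : z \in s -> ~ J z by move=> zs /(hs z zs).
  have same x y : J x -> J y -> x < y -> A x = A y.
    move=> Jx Jy xy; apply: sA => // z zs hz; apply: (sJ z zs).
    exact: convex_seg hz.
  have [[x0 [Jx0 Ax0]]|n] := pselect (exists x, J x /\ A x).
    apply: (Pext J); last exact: PJ.
    move=> x; split=> [Jx|[]//]; split=> //.
    by case: (ltgtP x x0) => [lt|lt|->//]; [rewrite (same x x0)|rewrite -(same x0 x)].
  by apply: (Pext (fun=> False)) => // x; split=> // h; apply: n; exists x.
have [Je|nJe] := pselect (J e); last first.
  apply: IH => // z zs Jz; have := hs z zs Jz; rewrite inE => /orP[/eqP ze|//].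
  by case: nJe; rewrite -ze.
pose J1 x := J x /\ x < e. pose J2 x := J x /\ e < x.
have hJ1 : dset J1 by rewrite /J1; def_tac.
have hJ2 : dset J2 by rewrite /J2; def_tac.
have K1 : Phi (fun x => J1 x /\ A x).
  apply: IH => //.
  - by move=> x y z [Jx hx] [Jz hz] h; split; [exact: cJ Jx Jz h|ord].
  - move=> x [Jx hx]; have [a ax] := below x.
    apply: nb_sub (nbI (oJ x Jx) (nb_itv (_ : a < x < e))); last by ord.
    by move=> u [Ju hu]; split=> //; ord.
  - move=> z zs [Jz ze]; have := hs z zs Jz; rewrite inE => /orP[/eqP|//]; by ord.
have K2 : Phi (fun x => J2 x /\ A x).
  apply: IH => //.
  - by move=> x y z [Jx hx] [Jz hz] h; split; [exact: cJ Jx Jz h|ord].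
  - move=> x [Jx hx]; have [a ax] := above x.
    apply: nb_sub (nbI (oJ x Jx) (nb_itv (_ : e < x < a))); last by ord.
    by move=> u [Ju hu]; split=> //; ord.
  - move=> z zs [Jz ze]; have := hs z zs Jz; rewrite inE => /orP[/eqP|//]; by ord.
have hJA1 : dset (fun x => J1 x /\ A x) by def_tac.
have hJA2 : dset (fun x => J2 x /\ A x) by def_tac.
have hU : dset (fun x => (J1 x /\ A x) \/ (J2 x /\ A x)) by def_tac.
have hE : dset (fun x => x = e) by def_tac.
have K12 : Phi (fun x => (J1 x /\ A x) \/ (J2 x /\ A x)).
  by apply: PU => // x [[_ h] _] [[_ h'] _]; ord.
have [Ae|nAe] := pselect (A e).
  apply: (Pext (fun x => ((J1 x /\ A x) \/ (J2 x /\ A x)) \/ x = e)); last first.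
    by apply: PU => // x [[[_ h] _]|[[_ h] _]] xe; ord.
  move=> x; rewrite /J1 /J2; split=> [[[[[]]|[[]]]|->]//|[Jx Ax]].
  case: (ltgtP x e) => h; [left; left|left; right|right] => //.
apply: (Pext _ _ _ K12) => x; rewrite /J1 /J2; split=> [[[[]]|[[]]]//|[Jx Ax]].
by case: (ltgtP x e) => h; [left|right|case: nAe; rewrite -h].
Qed.

Lemma ivt f x y z : dmap f -> x < y -> (forall u, x <= u <= y -> cont f u) ->
  (f x < z < f y \/ f y < z < f x) -> exists2 u, x < u < y & f u = z.
Proof.
move=> hf xy cf hz; apply: contrapT => h.
have nz u : x <= u <= y -> f u <> z.
  move=> hu fu; apply: h; exists u => //.
  have ux : u <> x by move=> e; rewrite e in fu; rewrite fu in hz; case: hz; ord.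
  have uy : u <> y by move=> e; rewrite e in fu; rewrite fu in hz; case: hz; ord.
  by ord.
have hr : dbin (fun u v => f u < z <-> f v < z) by def_tac.
have : f x < z <-> f y < z.
  apply: (loc_rel hr) => // [u v w -> //|u hu].
  have [p hp] := below (f u); have [q hq] := above (f u).
  case: (ltgtP (f u) z) (nz u hu) => // fu _.
    have [|a [b [uab hab]]] := cf u hu p z; first by ord.
    exists a, b; split=> // v w av vw wb.
    have hv : p < f v < z by apply: hab; ord.
    have hw : p < f w < z by apply: hab; ord.
    by split=> ?; ord.
  have [|a [b [uab hab]]] := cf u hu z q; first by ord.
  exists a, b; split=> // v w av vw wb.
  have hv : z < f v < q by apply: hab; ord.
  have hw : z < f w < q by apply: hab; ord.
  by split=> ?; ord.
case: hz => /andP[h1 h2].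
  by move=> /iffLR/(_ h1); ord.
by move=> /iffRL/(_ h1); ord.
Qed.

Lemma fubini_cst (c : int) : fubini_for (fun _ _ => c).
Proof. by []. Qed.

Lemma con_fubini_add F F' r : constructible F -> constructible F' -> fubini_for (fun y z => F (z .: (y .: r))) ->
  fubini_for (fun y z => F' (z .: (y .: r))) ->
  fubini_for (fun y z => F (z .: (y .: r)) + F' (z .: (y .: r)))%R.
Proof.
move=> h h' e e'.
have h0 : constructible (fun=> indic False) by apply: con_indic; def_tac.
have h1 := con_sub h0 h'.
have e1 := con_fubini_sub (r := r) h0 h' (fubini_cst _) e'.
apply: fubini_ext (con_fubini_sub (r := r) h h1 e e1) => y z.
by rewrite indF //; ring.
Qed.

Lemma fubini_cells (C : M -> M -> Prop) (s : seq M) : dbin C ->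
  (forall a, fubini_for (fun y z => indic (y = a /\ C y z))) ->
  (forall J, dset J -> convex J -> isopen J -> (forall z, z \in s -> ~ J z) ->
     (exists x, J x) -> fubini_for (fun y z => indic (J y /\ C y z))) ->
  forall A, dset A -> fubini_for (fun y z => indic (A y /\ C y z)).
Proof.
move=> hC h1 hJ A hA; have [s' hs'] := dset_step hA; have [c] : inhabited M := om_inh.
pose r : env := fun=> c.
apply: (cell_ind (Phi := fun A => fubini_for (fun y z => indic (A y /\ C y z))) (s := s ++ s')) => //.
- apply: (fubini_ext _ (fubini_cst 0%R)) => y z; by rewrite indF // => -[].
- move=> E G hE hG EG fE fG.
  have cE : constructible (fun r => indic (E (r 1%N) /\ C (r 1%N) (r 0%N))) by apply: con_indic; def_tac.
  have cG : constructible (fun r => indic (G (r 1%N) /\ C (r 1%N) (r 0%N))) by apply: con_indic; def_tac.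
  apply: (fubini_ext _ (con_fubini_add (r := r) cE cG fE fG)) => y z /=.
  have [Ey|nE] := pselect (E y).
    rewrite (@indF (G y /\ _)); last by case=> Gy; case: (EG y).
    by rewrite addr0; apply: ind_iff; have := EG y; tauto.
  rewrite (@indF (E y /\ _)); last by case.
  by rewrite add0r; apply: ind_iff; tauto.
- move=> J hJd cJ oJ Js.
  have [ne|e] := pselect (exists x, J x).
    by apply: hJ => // z zs; apply: Js; rewrite mem_cat zs.
  apply: (fubini_ext _ (fubini_cst 0%R)) => y z; rewrite indF // => -[Jy _]; apply: e.
  by exists y.
- by move=> x y xy hz; apply: hs' => // z zs; apply: hz; rewrite mem_cat zs orbT.
Qed.

Lemma fubini_point (C : M -> M -> Prop) a : dbin C -> fubini_for (fun y z => indic (y = a /\ C y z)).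
Proof.
move=> hC.
have h1 : dset (fun y => y = a) by def_tac.
have h2 : dset (C a) by def_tac.
apply: (fubini_ext _ (fubini_prod (stepf_ind h1) (stepf_ind h2))) => y z.
have [->|ya] := pselect (y = a).
  by rewrite (@indT (a = a)) // mul1r; apply: ind_iff; split=> [|[]].
by rewrite (@indF (y = a)) // mul0r indF // => -[].
Qed.

Lemma mono_cont J f : isopen J -> [\/ cst_on J f, inc_on J f | dec_on J f] ->
  forall x, J x -> cont f x.
Proof.
move=> oJ [h|[_ h]|[_ h]] x Jx; try exact: h.
move=> p q hpq; apply: nb_sub (oJ x Jx) => u Ju.
by rewrite (h u x).
Qed.

(** Over an interval J on which f is monotone the region below f has open intervals as
    fibres in both directions; its projection to the z-axis is an open downward closed
    interval, and both integrals are 1. *)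
Lemma fubini_lower f : dmap f -> forall A, dset A -> fubini_for (fun y z => indic (A y /\ z < f y)).
Proof.
move=> hf; have [s hs] := mono_global hf.
have hC : dbin (fun y z => z < f y) by def_tac.
apply: (fubini_cells (s := s) hC); first by move=> a; exact: fubini_point hC.
move=> J hJ cJ oJ Js [x0 Jx0]; have mJ := hs J cJ Js.
have ctJ := mono_cont oJ mJ.
have btw y1 y y2 z : J y1 -> J y2 -> y1 < y < y2 -> z < f y1 -> z < f y2 -> z < f y.
  move=> J1 J2 hy z1 z2; have Jy : J y by exact: cJ J1 J2 hy.
  case: mJ => [h|[h _]|[h _]]; first by rewrite (h y y1).
    have h' : f y1 < f y by apply: h => //; ord.
    by ord.
  have h' : f y2 < f y by apply: h => //; ord.
  by ord.
pose Z z := exists y, J y /\ z < f y.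
have hZ : dset Z by rewrite /Z; def_tac.
rewrite /fubini_for; transitivity (1 : int)%R.
  rewrite (euler_ext (psi := fun y => - 1 * indic (J y))%R); last first.
    by move=> y; rewrite euler_lower; ring.
  rewrite euler_scale ?(euler_convex hJ) //; last exact: stepf_ind hJ.
  by exists x0.
rewrite (euler_ext (psi := fun z => - 1 * indic (Z z))%R); last first.
  move=> z; have [[y0 [Jy0 zy0]]|nZ] := pselect (Z z); last first.
    rewrite (indF nZ) mulr0 (euler_ext (psi := fun=> 0%R)) ?euler_cst // => y.
    by rewrite indF // => h; apply: nZ; exists y.
  rewrite (indT (P := Z z)); last by exists y0.
  have hA : dset (fun y => J y /\ z < f y) by def_tac.
  rewrite (euler_convex hA) ?mulr1 //.
  - move=> y1 y y2 [J1 z1] [J2 z2] hy; split; first exact: cJ J1 J2 hy.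
    exact: btw hy z1 z2.
  - move=> y [Jy zy]; have [q hq] := above (f y).
    have n1 : nb y (fun u => z < f u < q) by apply: ctJ => //; ord.
    by apply: nb_sub (nbI (oJ y Jy) n1) => u [Ju hu]; split=> //; ord.
  - by exists y0.
rewrite euler_scale ?(euler_convex hZ) //; last exact: stepf_ind hZ.
- move=> z1 z z2 [y1 h1] [y2 [J2 h2]] hz; exists y2; split=> //; ord.
- move=> z [y [Jy zy]]; have [p pz] := below z; exists p, (f y); split; first by ord.
  by move=> u hu; exists y; split=> //; ord.
- by have [z hz] := below (f x0); exists z, x0.
Qed.

(** Where f is constant the graph is a product. Where it is strictly monotone and
    continuous, the graph projects bijectively onto open intervals in both directions,
    by the intermediate value property. *)
Lemma fubini_graph f : dmap f -> forall A, dset A -> fubini_for (fun y z => indic (A y /\ z = f y)).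
Proof.
move=> hf; have [s hs] := mono_global hf.
have hC : dbin (fun y z => z = f y) by def_tac.
apply: (fubini_cells (s := s) hC); first by move=> a; exact: fubini_point hC.
move=> J hJ cJ oJ Js [x0 Jx0]; have mJ := hs J cJ Js.
have ctJ := mono_cont oJ mJ.
have [cst|ncst] := pselect (cst_on J f).
  have h2 : dset (fun z => z = f x0) by def_tac.
  apply: (fubini_ext _ (fubini_prod (stepf_ind hJ) (stepf_ind h2))) => y z.
  have [Jy|nJ] := pselect (J y).
    rewrite (indT Jy) mul1r (cst x0 y) //; apply: ind_iff; split=> [|[]] //.
  by rewrite (indF nJ) mul0r indF // => -[].
have mono x y : J x -> J y -> x < y -> f x <> f y.
  by move=> Jx Jy xy e; case: mJ => [//|[h _]|[h _]]; have := h x y Jx Jy xy; rewrite e ltxx.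
have inj x y : J x -> J y -> f x = f y -> x = y.
  move=> Jx Jy e; case: (ltgtP x y) => // lt; first by case: (mono x y).
  by case: (mono y x).
pose I z := exists y, J y /\ z = f y.
have hI : dset I by rewrite /I; def_tac.
have cI : convex I.
  move=> z1 z z2 [y1 [J1 e1]] [y2 [J2 e2]] hz.
  have seg a b u := @convex_seg _ _ J a b u cJ.
  case: (ltgtP y1 y2) => [lt|lt|e]; last by rewrite e1 e2 e in hz; ord.
    have [||u hu <-] := @ivt f y1 y2 z hf lt.
    - by move=> u hu; apply: ctJ; exact: seg hu.
    - by left; rewrite -e1 -e2.
    by exists u; split=> //; apply: (seg y1 y2) => //; ord.
  have [||u hu <-] := @ivt f y2 y1 z hf lt.
  - by move=> u hu; apply: ctJ; exact: seg hu.
  - by right; rewrite -e1 -e2.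
  by exists u; split=> //; apply: (seg y2 y1) => //; ord.
have oI : isopen I.
  move=> z [y [Jy ->]]; have [a [b [yab hab]]] := oJ y Jy.
  have [u1 hu1] : exists u1, a < u1 < y by apply: between; ord.
  have [u2 hu2] : exists u2, y < u2 < b by apply: between; ord.
  have J1 : J u1 by apply: hab; ord.
  have J2 : J u2 by apply: hab; ord.
  have I1 : I (f u1) by exists u1.
  have I2 : I (f u2) by exists u2.
  case: mJ => [//|[h _]|[h _]].
    exists (f u1), (f u2); split; first by apply/andP; split; apply: h => //; ord.
    by move=> w hw; apply: (cI (f u1) w (f u2)).
  exists (f u2), (f u1); split; first by apply/andP; split; apply: h => //; ord.
  by move=> w hw; apply: (cI (f u2) w (f u1)).
rewrite /fubini_for; transitivity (-1 : int)%R.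
  rewrite (euler_ext (psi := fun y => indic (J y))); last by move=> y; rewrite euler_graph_fibre.
  by apply: (euler_convex hJ) => //; exists x0.
rewrite (euler_ext (psi := fun z => indic (I z))); last first.
  move=> z; have [[y0 [Jy0 ->]]|nI] := pselect (I z); last first.
    rewrite (indF nI) (euler_ext (psi := fun=> 0%R)) ?euler_cst // => y.
    by rewrite indF // => h; apply: nI; exists y.
  rewrite (indT (P := I (f y0))); last by exists y0.
  rewrite -[RHS](euler_point (om := om) y0); apply: euler_ext => y; apply: ind_iff.
  by split=> [[Jy /inj ->]|->].
by rewrite (euler_convex hI) //; exists (f x0), x0.
Qed.

Theorem fubini F r : constructible F ->
  euler (fun y => euler (fun z => F (z .: (y .: r)))) =
  euler (fun z => euler (fun y => F (z .: (y .: r)))).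
Proof.
rewrite -/(fubini_for (fun y z => F (z .: (y .: r)))).
elim=> [P hP|F1 F2 h1 k1 h2 k2]; last exact: con_fubini_sub.
suff [] : constructible (fun r => indic (P r)) /\ fubini_for (fun y z => indic (P (z .: (y .: r)))) by [].
apply: (con_decompose (K := fun F => constructible F /\ fubini_for (fun y z => F (z .: (y .: r))))) => //.
- move=> F1 F2 [h1 k1] [h2 k2]; split; first exact: con_sub.
  exact: con_fubini_sub.
- move=> D hD; split; first by apply: con_indic; def_tac.
  have h1 : dset (fun y => D (y .: r)) by def_tac.
  apply: (fubini_ext _ (fubini_prod (stepf_ind h1) (stepf_cst 1%R))) => y z.
  by rewrite mulr1.
- move=> D e hD he; split; first by apply: con_indic; def_tac.
  have h1 : dset (fun y => D (y .: r)) by def_tac.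
  have h2 : dmap (fun y => e (y .: r)) by def_tac.
  exact: (fubini_lower h2 h1).
- move=> D e hD he; split; first by apply: con_indic; def_tac.
  have h1 : dset (fun y => D (y .: r)) by def_tac.
  have h2 : dmap (fun y => e (y .: r)) by def_tac.
  exact: (fubini_graph h2 h1).
Qed.
End Fubini.

(** * Iterated integrals and the pigeonhole principle *)

Section Iterated.
Context {d : Order.disp_t} {M : orderType d} {Def : ((nat -> M) -> Prop) -> Prop}.
Context {om : omin_family Def}.
Notation denv := (denv Def).
Notation constructible := (constructible Def).
Notation env := (nat -> M).
Implicit Types (r : env) (F : env -> int) (i j : nat) (l : seq nat).

Definition upd r i (x : M) : env := fun n => if n == i then x else r n.
(** Integration over the variable with index i; naming the variables makes the order
    of integration a matter of commuting operators. *)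
Definition euler_var i F : env -> int := fun r => euler (fun x => F (upd r i x)).
Definition euler_vars l F := foldr euler_var F l.

Lemma denv_upd i : denv (fun q => upd (shift q) i (q 0%N)).
Proof. by move=> n; rewrite /upd; case: (n == i); exact: dfun_var. Qed.

Lemma con_euler_var i F : constructible F -> constructible (euler_var i F).
Proof.
move=> hF; have h : constructible (fun q => F (upd (shift q) i (q 0%N))).
  exact: (con_comp (denv_upd i) hF).
exact: con_euler_head h.
Qed.

Lemma euler_var_sub i F F' : constructible F -> constructible F' ->
  euler_var i (fun r => F r - F' r)%R = (fun r => euler_var i F r - euler_var i F' r)%R.
Proof.
move=> h h'; apply/funext => r.
have k : constructible (fun q => F (upd (shift q) i (q 0%N))) by exact: (con_comp (denv_upd i) h).
have k' : constructible (fun q => F' (upd (shift q) i (q 0%N))) by exact: (con_comp (denv_upd i) h').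
exact: (euler_head_sub r k k').
Qed.

Lemma upd_comm r i j x y : i != j -> upd (upd r i x) j y = upd (upd r j y) i x.
Proof.
move=> ij; apply/funext => n; rewrite /upd.
by case: eqP => // ->; rewrite eq_sym (negbTE ij).
Qed.

Lemma euler_var_comm i j F : constructible F -> euler_var i (euler_var j F) = euler_var j (euler_var i F).
Proof.
move=> hF; have [->//|ij] := eqVneq i j; apply/funext => r; rewrite /euler_var.
have hg : denv (fun q => upd (upd (shift (shift q)) i (q 1%N)) j (q 0%N)).
  by move=> n; rewrite /upd; case: (n == j); [|case: (n == i)]; exact: dfun_var.
have k : constructible (fun q => F (upd (upd (shift (shift q)) i (q 1%N)) j (q 0%N))).
  exact: (con_comp hg hF).
rewrite (fubini r k); apply: euler_ext => z; apply: euler_ext => y.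
by congr F; exact: upd_comm.
Qed.

Lemma con_euler_vars l F : constructible F -> constructible (euler_vars l F).
Proof. by move=> hF; elim: l => //= i l IH; exact: con_euler_var. Qed.

Lemma euler_vars_sub l F F' : constructible F -> constructible F' ->
  euler_vars l (fun r => F r - F' r)%R = (fun r => euler_vars l F r - euler_vars l F' r)%R.
Proof.
move=> h h'; elim: l => //= i l ->; by rewrite euler_var_sub //; apply: con_euler_vars.
Qed.

Lemma euler_vars_add l F F' : constructible F -> constructible F' ->
  euler_vars l (fun r => F r + F' r)%R = (fun r => euler_vars l F r + euler_vars l F' r)%R.
Proof.
move=> h h'.
have e : euler_vars l F = (fun r => euler_vars l (fun q => F q + F' q) r - euler_vars l F' r)%R.
  rewrite -euler_vars_sub //; last exact: con_add.
  by congr (euler_vars l _); apply/funext => r; ring.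
by rewrite e; apply/funext => r; ring.
Qed.

Lemma euler_var_vars_comm i l F : constructible F -> euler_var i (euler_vars l F) = euler_vars l (euler_var i F).
Proof.
move=> h; elim: l => //= j l <-; rewrite euler_var_comm //; exact: con_euler_vars.
Qed.

Lemma euler_vars_comm l l' F : constructible F -> euler_vars l (euler_vars l' F) = euler_vars l' (euler_vars l F).
Proof.
move=> h; elim: l => //= i l ->; apply: euler_var_vars_comm; exact: con_euler_vars.
Qed.

(** The iterated integral of a function of n variables, independent of the names of
    the variables. *)
Fixpoint euler_seq n (H : seq M -> int) : int :=
  if n is m.+1 then euler (fun x => euler_seq m (fun s => H (x :: s))) else H [::].

Lemma euler_seq_ext n H H' : (forall s, size s = n -> H s = H' s) -> euler_seq n H = euler_seq n H'.
Proof.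
elim: n H H' => [|n IH] H H' h /=; first exact: h.
by apply: euler_ext => x; apply: IH => s sn; apply: h; rewrite /= sn.
Qed.

Lemma euler_vars_seq l F r H : uniq l ->
  (forall r', (forall i, i \notin l -> r' i = r i) -> F r' = H (map r' l)) ->
  euler_vars l F r = euler_seq (size l) H.
Proof.
elim: l F r H => [|i l IH] F r H /=; first by move=> _ h; exact: h.
move=> /andP[il ul] h; apply: euler_ext => x; apply: IH => // r' hr'.
rewrite h; last first.
  by move=> j; rewrite inE negb_or => /andP[ji jl]; rewrite hr' // /upd (negbTE ji).
by rewrite hr' // /upd eqxx.
Qed.

Lemma euler_seq_0 n : euler_seq n (fun=> 0%R) = 0%R.
Proof.
elim: n => //= n IH; rewrite (euler_ext (psi := fun=> 0%R)) ?euler_cst //.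
Qed.

Lemma euler_seq_point n w : size w = n -> euler_seq n (fun s => indic (s = w)) = 1%R.
Proof.
elim: n w => [|n IH] [|y w] //= => [_|[wn]]; first by rewrite indT.
rewrite -[RHS](euler_point (om := om) y); apply: euler_ext => x.
have [->|xy] := pselect (x = y).
  rewrite [RHS]indT // -(IH w wn); apply: euler_seq_ext => s _.
  by apply: ind_iff; split=> [[]|->].
rewrite [RHS]indF // -(euler_seq_0 n); apply: euler_seq_ext => s _.
by rewrite indF // => -[].
Qed.
End Iterated.

Definition cat_env (T : Type) k (s r : nat -> T) : nat -> T :=
  fun i => if (i < k)%N then s i else r (i - k)%N.

Lemma cat_envS (T : Type) k (s r : nat -> T) :
  cat_env k.+1 s r = cat_env k s (s k .: r).
Proof.
apply/funext => i; rewrite /cat_env ltnS leq_eqVlt.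
have [->|ik] := eqVneq i k; first by rewrite ltnn subnn.
rewrite orFb; case: ltnP => // ki.
have lt : (k < i)%N by rewrite ltn_neqAle eq_sym ik.
by rewrite subnS; case: (i - k)%N (subn_gt0 k i) => [|j]; rewrite lt.
Qed.

Lemma cat_env_upd (T : Type) k (x : T) (s r : nat -> T) :
  cat_env k (fun i => if i == k then x else s i) r = cat_env k s r.
Proof. by apply/funext => i; rewrite /cat_env; case: ltnP => // ik; rewrite ltn_eqF. Qed.

Lemma def_ex_cat d (M : orderType d) Def (om : omin_family (M := M) Def) k P :
  Def P -> Def (fun r => exists s, P (cat_env k s r)).
Proof.
elim: k P => [|k IH] P hP.
  apply: def_ext hP => r; have [c] : inhabited M := om_inh.
  have e s : cat_env 0 s r = r by apply/funext => i; rewrite /cat_env subn0.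
  by split=> [h|[s]]; [exists r|]; rewrite e.
have h1 := IH P hP.
have h2 : Def (fun r => exists x, exists s, P (cat_env k s (x .: r))).
  apply: def_ex; apply: def_ext h1 => r.
  by have -> : r 0%N .: shift r = r by apply/funext => -[].
apply: def_ext h2 => r; split=> [[x [s Ps]]|[s]].
  exists (fun i => if i == k then x else s i); rewrite cat_envS eqxx.
  by rewrite cat_env_upd.
by rewrite cat_envS; exists (s k), s.
Qed.

Section Pigeonhole.
Context {d : Order.disp_t} {M : orderType d} {Def : ((nat -> M) -> Prop) -> Prop}.
Context {om : omin_family Def}.
Notation constructible := (constructible Def).
Notation env := (nat -> M).
Variable (n : nat).
Implicit Types (r : env) (x y t : 'I_n -> M).

Definition tup (c : M) (s : seq M) : 'I_n -> M := fun i => nth c s i.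
Definition blk k r : 'I_n -> M := fun i => r (k + i)%N.

Lemma blk_cat_r (s r : env) : blk n (cat_env n s r) = blk 0 r.
Proof.
by apply/funext => i; rewrite /blk /cat_env ltnNge leq_addr /= addKn.
Qed.

Lemma tup_blk c k r : tup c (map r (iota k n)) = blk k r.
Proof.
by apply/funext => i; rewrite /tup (nth_map 0%N) ?size_iota // nth_iota.
Qed.

Lemma euler_seq_unique c (P : ('I_n -> M) -> Prop) t : (forall x, P x <-> x = t) ->
  euler_seq n (fun s => indic (P (tup c s))) = 1%R.
Proof.
move=> hP; pose w := [seq t i | i <- enum 'I_n].
have wn : size w = n by rewrite size_map size_enum_ord.
rewrite -(euler_seq_point wn); apply: euler_seq_ext => s sn; apply: ind_iff; rewrite hP; split.
  move=> e; apply: (@eq_from_nth _ c); first by rewrite sn wn.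
  move=> i; rewrite sn => hi; have := congr1 (fun f => f (Ordinal hi)) e.
  rewrite /tup /= => ->; rewrite (nth_map (Ordinal hi)) ?size_enum_ord //.
  by congr t; apply: val_inj; rewrite /= nth_enum_ord.
move=> ->; apply/funext => i; rewrite /tup (nth_map i) ?size_enum_ord //.
by rewrite nth_ord_enum.
Qed.

Lemma euler_seq_none c (P : ('I_n -> M) -> Prop) : (forall x, ~ P x) ->
  euler_seq n (fun s => indic (P (tup c s))) = 0%R.
Proof. by move=> hP; rewrite -(euler_seq_0 n); apply: euler_seq_ext => s _; rewrite indF. Qed.

Lemma blk_disj k l r r' : (forall i, i \notin iota k n -> r' i = r i) ->
  (l + n <= k)%N || (k + n <= l)%N -> blk l r' = blk l r.
Proof.
move=> h kl; apply/funext => i; apply: h; rewrite mem_iota negb_and -ltnNge -leqNgt.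
case/orP: kl => kl.
  by rewrite (leq_trans _ kl) // ltn_add2l.
by rewrite (leq_trans kl) ?leq_addr ?orbT.
Qed.

Lemma euler_vars_block c k (P : ('I_n -> M) -> Prop) r :
  euler_vars (iota k n) (fun r => indic (P (blk k r))) r = euler_seq n (fun s => indic (P (tup c s))).
Proof.
have := @euler_vars_seq _ M (iota k n) (fun r => indic (P (blk k r))) r
  (fun s => indic (P (tup c s))) (iota_uniq _ _).
rewrite size_iota; apply => r' _.
by rewrite tup_blk.
Qed.

Lemma def_blk_eq k t : Def (fun r => blk k r = t).
Proof.
suff h m : (m <= n)%N -> Def (fun r => forall i : 'I_n, (i < m)%N -> blk k r i = t i).
  apply: def_ext (h n (leqnn _)) => r; split=> [H|-> //].
  by apply/funext => i; apply: H.
elim: m => [_|m IH mn]; first by apply: (def_ext (P := fun=> True)) => [r|]; [split|def_tac].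
have hm : Def (fun r => r (k + m)%N = t (Ordinal mn)) by def_tac.
apply: def_ext (def_and hm (IH (ltnW mn))) => r; split.
  move=> [h1 h2] i; rewrite ltnS leq_eqVlt => /orP[/eqP im|]; last exact: h2.
  by have -> : i = Ordinal mn by exact: val_inj.
by move=> h; split=> [|i im]; [exact: (h (Ordinal mn))|apply: h; exact: ltnW].
Qed.

(** The Euler characteristic of a finite set is its number of points; only
    nonnegativity, and positivity for nonempty sets, is recorded. *)
Lemma euler_vars_finite (S : nat -> 'I_n -> M) k (T : ('I_n -> M) -> Prop) r :
  Def (fun r => T (blk 0 r)) -> (forall x, T x -> exists j, (j < k)%N /\ x = S j) ->
  exists m : nat, euler_vars (iota 0 n) (fun r => indic (T (blk 0 r))) r = m%:R%R /\
     ((exists x, T x) -> (0 < m)%N).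
Proof.
have [c] : inhabited M := om_inh.
elim: k T => [|k IH] T hT hS.
  exists 0%N; rewrite (euler_vars_block c) euler_seq_none; last by move=> x /hS[j []].
  by split=> // -[x /hS[j []]].
have hE := def_blk_eq 0 (S k).
pose T' x := T x /\ x <> S k.
have hT' : Def (fun r => T' (blk 0 r)) by apply: def_and => //; exact: def_not.
have [x [Tx xS]|m [hm pm]] := IH T' hT'.
  by have [j [+ e]] := hS x Tx; rewrite ltnS leq_eqVlt => /orP[/eqP jk|jk];
    [case: xS; rewrite e jk|exists j].
have [Tk|nTk] := pselect (T (S k)); last first.
  exists m; rewrite -hm; split.
    congr (euler_vars _ _ r); apply/funext => q; apply: ind_iff; rewrite /T'; split=> [h|[]//].
    by split=> // e; rewrite e in h.
  by move=> [x Tx]; apply: pm; exists x; split=> // e; rewrite e in Tx.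
exists m.+1; split=> //.
rewrite -addn1 natrD -hm.
have e : (euler_vars (iota 0 n) (fun q => indic (T' (blk 0 q)) + indic (blk 0 q = S k)) r =
    euler_vars (iota 0 n) (fun q => indic (T' (blk 0 q))) r +
    euler_vars (iota 0 n) (fun q => indic (blk 0 q = S k)) r)%R.
  by rewrite (euler_vars_add _ (con_indic hT') (con_indic hE)).
rewrite -[X in (_ = _ + X)%R](_ : euler_vars (iota 0 n) (fun q => indic (blk 0 q = S k)) r = 1%R).
  rewrite -e; congr (euler_vars _ _ r); apply/funext => q; rewrite /T'.
  have [->|ne] := pselect (blk 0 q = S k).
    by rewrite (indT Tk) (indT (P := S k = S k)) // indF ?add0r // => -[].
  by rewrite (indF ne) addr0; apply: ind_iff; tauto.
by rewrite (euler_vars_block c 0 (fun x => x = S k)) (euler_seq_unique c (P := fun x => x = S k) (t := S k)).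
Qed.

Lemma def_ex_blk (G : ('I_n -> M) -> ('I_n -> M) -> Prop) :
  Def (fun r => G (blk 0 r) (blk n r)) -> Def (fun r => exists x, G x (blk 0 r)).
Proof.
have [c] : inhabited M := om_inh.
move=> hG; apply: def_ext (def_ex_cat om n hG) => q; split=> [[s Gs]|[x Gx]].
  by exists (blk 0 (cat_env n s q)); rewrite -(blk_cat_r s q).
exists (fun i => if insub i is Some j then x j else c).
rewrite blk_cat_r (_ : blk 0 _ = x) //; apply/funext => i.
by rewrite /blk /cat_env add0n ltn_ord insubT //= => h; congr x; apply: val_inj.
Qed.

(** The points of Y outside the image are counted by chi(Y) - chi(image), which Fubini
    for the indicator of the graph shows to be zero. *)
Theorem injection_onto (Y : ('I_n -> M) -> Prop) (G : ('I_n -> M) -> ('I_n -> M) -> Prop)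
    (S : nat -> 'I_n -> M) k :
  Def (fun r => Y (blk 0 r)) -> Def (fun r => G (blk 0 r) (blk n r)) ->
  (forall x y, G x y -> Y x /\ Y y) -> (forall x, Y x -> exists y, G x y) ->
  (forall x y y', G x y -> G x y' -> y = y') -> (forall x x' y, G x y -> G x' y -> x = x') ->
  (forall y, Y y -> ~ (exists x, G x y) -> exists j, (j < k)%N /\ y = S j) ->
  forall y, Y y -> exists x, G x y.
Proof.
move=> hY hG GY tot fun_ inj hS y Yy; apply: contrapT => ny.
have [c] : inhabited M := om_inh; pose r : env := fun=> c.
pose I x := exists x', G x' x.
pose F r := indic (G (blk 0 r) (blk n r)).
have cF : constructible F := con_indic hG.
have e1 : euler_vars (iota n n) F = fun r => indic (Y (blk 0 r)).
  apply/funext => q.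
  rewrite (@euler_vars_seq _ M (iota n n) F q (fun s => indic (G (blk 0 q) (tup c s)))) ?iota_uniq //; last first.
    move=> r' hr'; rewrite tup_blk /F (blk_disj (l := 0) hr') //.
    by rewrite leqnn.
  rewrite size_iota; have [Yq|nY] := pselect (Y (blk 0 q)).
    have [t Gt] := tot _ Yq; rewrite (indT Yq); apply: (euler_seq_unique c (t := t)) => x.
    by split=> [Gx|->//]; exact: fun_ Gx Gt.
  by rewrite (indF nY); apply: (euler_seq_none c) => x /GY[].
have e2 : euler_vars (iota 0 n) F = fun r => indic (I (blk n r)).
  apply/funext => q.
  rewrite (@euler_vars_seq _ M (iota 0 n) F q (fun s => indic (G (tup c s) (blk n q)))) ?iota_uniq //; last first.
    move=> r' hr'; rewrite tup_blk /F (blk_disj (l := n) hr') //.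
    by rewrite leqnn orbT.
  rewrite size_iota; have [Iq|nI] := pselect (I (blk n q)).
    have [t Gt] := Iq; rewrite (indT Iq); apply: (euler_seq_unique c (P := fun x => G x (blk n q)) (t := t)) => x.
    by split=> [Gx|->//]; exact: inj Gx Gt.
  by rewrite (indF nI); apply: (euler_seq_none c (P := fun x => G x (blk n q))) => x Gx; apply: nI; exists x.
have eYI : euler_vars (iota 0 n) (fun r => indic (Y (blk 0 r))) r =
           euler_vars (iota 0 n) (fun r => indic (I (blk 0 r))) r.
  have e3 : euler_vars (iota 0 n) (euler_vars (iota n n) F) = euler_vars (iota n n) (euler_vars (iota 0 n) F).
    exact: euler_vars_comm.
  have := congr1 (fun H => H r) e3.
  by rewrite e1 e2 !(euler_vars_block c).
pose T x := Y x /\ ~ I x.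
have hI : Def (fun r => I (blk 0 r)) by exact: def_ex_blk.
have hT : Def (fun r => T (blk 0 r)) by apply: def_and => //; exact: def_not.
have [x [Yx nx]|m [hm pm]] := @euler_vars_finite S k T r hT.
  exact: hS.
suff m0 : (m%:R = 0 :> int)%R.
  have := pm (ex_intro _ y (conj Yy ny)); move/eqP: m0.
  by rewrite Num.Theory.pnatr_eq0 => /eqP ->.
rewrite -hm.
have eT : (fun r => indic (T (blk 0 r))) = (fun r => indic (Y (blk 0 r)) - indic (I (blk 0 r)))%R.
  apply/funext => q; rewrite /T.
  have [Iq|nI] := pselect (I (blk 0 q)).
    have Yq : Y (blk 0 q) by case: Iq => x' /GY[].
    by rewrite (indT Yq) (indT Iq) indF // => -[].
  by rewrite (indF nI) subr0; apply: ind_iff; tauto.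
by rewrite eT (euler_vars_sub _ (con_indic hY) (con_indic hI)) eYI subrr.
Qed.
End Pigeonhole.

(** * Discrete definable sets are finite *)

(** The points of T are enumerated without repetition by a finite set U of indices; a
    surjection of U onto itself is injective. *)
Lemma finite_surj_inj (X : Type) (T : X -> Prop) (S : nat -> X) k (g : X -> X) :
  (forall x, T x -> exists j, (j < k)%N /\ x = S j) -> (forall x, T x -> T (g x)) ->
  (forall y, T y -> exists x, T x /\ g x = y) ->
  forall x x', T x -> T x' -> g x = g x' -> x = x'.
Proof.
case: k => [|k] hS gT surj x x' Tx Tx' e; first by have [j []] := hS x Tx.
have [idx hidx] : exists idx : X -> 'I_k.+1, forall x, T x -> S (idx x) = x.
  have : forall x, exists j : 'I_k.+1, T x -> S j = x.
    move=> z; have [/hS[j [jk ->]]|nT] := pselect (T z); last by exists ord0.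
    by exists (Ordinal jk).
  by move=> /choice[idx h]; exists idx.
pose U : {set 'I_k.+1} := [set j | `[< exists x, T x /\ j = idx x >]].
have UE z : T z -> idx z \in U by move=> Tz; rewrite inE; apply/asboolP; exists z.
pose phi (j : 'I_k.+1) := idx (g (S j)).
have sub : U \subset phi @: U.
  apply/fintype.subsetP => j; rewrite inE => /asboolP[y [/surj[z [Tz <-]] ->]].
  by apply/imsetP; exists (idx z); [exact: UE|rewrite /phi hidx].
have /imset_injP inj : #|phi @: U| == #|U|.
  by rewrite eqn_leq leq_imset_card subset_leq_card.
rewrite -(hidx x Tx) -(hidx x' Tx'); congr S; congr nat_of_ord.
by apply: inj; rewrite ?UE // /phi !hidx // e.
Qed.

Section Discrete.
Context {d : Order.disp_t} {M : orderType d} {Def : ((nat -> M) -> Prop) -> Prop}.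
Context {om : omin_family Def}.
Notation dset := (dset Def). Notation denv := (denv Def).
Notation dbin := (dbin Def). Notation drel := (drel Def). Notation dmap := (dmap Def).
Notation env := (nat -> M).
Implicit Types (r s : env) (D : env -> Prop) (a b x y : M).

Definition in_box n (p q s : env) := forall i, (i < n)%N -> p i < s i < q i.
(** The set of s in N^n with D (cat_env n s r) is discrete, in terms of boxes. Points
    of N^n are sequences of which the first n entries matter, so that the dimension
    may vary in inductions. *)
Definition env_discrete n D r := forall s, D (cat_env n s r) -> exists p q, in_box n p q s /\
  forall s', in_box n p q s' -> D (cat_env n s' r) -> forall i, (i < n)%N -> s' i = s i.
(** A subset of N^n is finite when all coordinates of its points lie in one finite
    set. *)
Definition env_finite n D r := exists c : seq M, forall s, D (cat_env n s r) ->
  forall i, (i < n)%N -> s i \in c.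

Definition set_coord n s x : env := fun i => if i == n then x else s i.
Lemma set_coord_n n s x : set_coord n s x n = x. Proof. by rewrite /set_coord eqxx. Qed.
Lemma set_coord_lt n s x i : (i < n)%N -> set_coord n s x i = s i.
Proof. by move=> h; rewrite /set_coord ltn_eqF. Qed.
Lemma cat_env_set_coord n s x r : cat_env n.+1 (set_coord n s x) r = cat_env n s (x .: r).
Proof. by rewrite cat_envS set_coord_n cat_env_upd. Qed.
Lemma in_box_set_coord n p q s x : in_box n p q s -> p n < x < q n -> in_box n.+1 p q (set_coord n s x).
Proof.
move=> h hx i; rewrite ltnS leq_eqVlt => /orP[/eqP ->|hi]; first by rewrite set_coord_n.
by rewrite set_coord_lt //; exact: h.
Qed.

(** The last coordinate is made the least one in its fibre, a definable function f of
    x, continuous on a subinterval. Substituting it for the last coordinate lowers the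
    dimension, and continuity of f carries the accumulation back. *)
Lemma accumulation_point n D r a b : Def D -> a < b ->
  (forall x, a < x < b -> (exists s, D (cat_env n s (x .: r))) /\ env_finite n D (x .: r)) ->
  exists x0 s0, [/\ a < x0 < b, D (cat_env n s0 (x0 .: r)) &
    forall p q P Q, p < x0 < q -> in_box n P Q s0 -> exists x s,
      [/\ p < x < q, x <> x0, D (cat_env n s (x .: r)) & in_box n P Q s]].
Proof.
elim: n D a b => [|n IH] D a b hD ab h.
  have [x0 hx0] := between ab; have [[s Ds] _] := h x0 hx0.
  exists x0, s; split=> // p q P Q hpq _.
  have [x hx] : exists x, (p < x) && (a < x) && (x < x0) by apply: between_max; ord.
  have [|[s' Ds'] _] := h x; first by ord.
  exists x, s'; split=> //; first by ord.
  by move=> e; ord.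
pose W x y := exists s, D (cat_env n s (y .: (x .: r))).
have hW : dbin W.
  have := def_ex_cat om n hD; rewrite /W => h1.
  have hg : denv (fun q => q 0%N .: (q 1%N .: r)) by def_tac.
  exact: (def_comp h1 hg).
have Wfin x : a < x < b -> fin (W x).
  move=> hx; have [_ [c hc]] := h x hx; exists c => y [s Ds].
  have := hc (set_coord n s y); rewrite cat_env_set_coord => /(_ Ds n (ltnSn n)).
  by rewrite set_coord_n.
(* Outside (a, b) the fibre is made empty, since dfun_min asks for finite fibres
   everywhere. *)
have hA : drel (fun q y => a < q 0%N < b /\ W (q 0%N) y) by def_tac.
have [|e [he eE]] := dfun_min hA.
  move=> q; have [hq|nq] := pselect (a < q 0%N < b); last by exists [::] => y [].
  by apply: fin_sub (Wfin _ hq) => y [].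
pose f x := e (x .: r).
have hf : dmap f by rewrite /f; def_tac.
have fW x : a < x < b -> W x (f x).
  move=> hx; have [[s Ds] _] := h x hx.
  have [|[_ //]] := eE (x .: r).
  by exists (s n); split=> //; exists s; rewrite -cat_envS.
have [a' [b' [aa ab' bb cf]]] := cont_sub hf ab.
pose D' q := D (cat_env n q (f (q n) .: (fun i => q (n + i)%N))).
have D'E s x : D' (cat_env n s (x .: r)) = D (cat_env n s (f x .: (x .: r))).
  have e1 i : cat_env n s (x .: r) (n + i)%N = (x .: r) i.
    by rewrite /cat_env ltnNge leq_addr /= addKn.
  rewrite /D'; congr D; apply/funext => i; rewrite {1}/cat_env /=.
  have := e1 0%N; rewrite addn0 => -> /=.
  rewrite [RHS]/cat_env; case: ltnP => hi; first by rewrite /cat_env hi.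
  by case: (i - n)%N => //= j; rewrite e1.
have hD' : Def D'.
  have hg : denv (fun q => cat_env n q (f (q n) .: (fun i => q (n + i)%N))).
    move=> i; rewrite /cat_env; case: (i < n)%N; first by def_tac.
    case: (i - n)%N => [|j] /=; last exact: dfun_var.
    by def_tac.
  exact: (def_comp hD hg).
have [|x0 [s0 [hx0 Ds0 acc]]] := IH D' a' b' hD' ab'.
  move=> x hx; have hx' : a < x < b by ord.
  split; first by have [s Ds] := fW x hx'; exists s; rewrite D'E.
  have [_ [c hc]] := h x hx'; exists c => s; rewrite D'E -cat_env_set_coord => /hc hs i hi.
  by rewrite -(set_coord_lt s (f x) hi); apply: hs; exact: ltnW.
exists x0, (set_coord n s0 (f x0)); split; [by ord|by rewrite cat_env_set_coord -D'E|].
move=> p q P Q hpq hPQ.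
have n1 : nb x0 (fun u => P n < f u < Q n).
  by apply: cf => //; have := hPQ n (ltnSn n); rewrite set_coord_n.
have [p' [q' [hpq' h']]] := nbI (nb_itv hpq) n1.
have [|x [s [hx xx0 Ds hs]]] := acc p' q' P Q hpq'.
  by move=> i hi; have := hPQ i (ltnW hi); rewrite set_coord_lt.
have [hx1 hx2] := h' x hx.
by exists x, (set_coord n s (f x)); split=> //; [rewrite cat_env_set_coord -D'E|exact: in_box_set_coord].
Qed.

(** The fibres over the last coordinate are finite by induction. If infinitely many
    were nonempty, those over some interval would all be so, and accumulation_point
    would contradict isolation. *)
Theorem env_discrete_finite n D r : Def D -> env_discrete n D r -> env_finite n D r.
Proof.
elim: n D r => [|n IH] D r hD hd; first by exists [::].
have hdx x : env_finite n D (x .: r).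
  apply: IH => // s Ds.
  have [|P [Q [hPQ iso]]] := hd (set_coord n s x); first by rewrite cat_env_set_coord.
  have Pn : P n < x < Q n by have := hPQ n (ltnSn n); rewrite set_coord_n.
  exists P, Q; split=> [i hi|s' hs' Ds' i hi].
    by have := hPQ i (ltnW hi); rewrite set_coord_lt.
  have := iso (set_coord n s' x) (in_box_set_coord hs' Pn); rewrite cat_env_set_coord => /(_ Ds' i (ltnW hi)).
  by rewrite !set_coord_lt.
pose X x := exists s, D (cat_env n s (x .: r)).
have hX : dset X.
  have h1 : Def (fun q => exists s, D (cat_env n s q)) by exact: (def_ex_cat om n hD).
  have hg : denv (fun q => q 0%N .: r) by def_tac.
  exact: (def_comp h1 hg).
have [[c hc]|[a [b [ab hab]]]] := fin_or_itv hX.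
  have /choice[cx hcx] := hdx.
  exists (c ++ flatten (map cx c)) => s; rewrite cat_envS => Ds i.
  have sc : s n \in c by apply: hc; exists s.
  rewrite mem_cat ltnS leq_eqVlt => /orP[/eqP ->|hi]; first by rewrite sc.
  apply/orP; right; apply/flattenP; exists (cx (s n)); first exact: map_f.
  exact: hcx Ds i hi.
have [|x0 [s0 [hx0 Ds0 acc]]] := @accumulation_point n D r a b hD ab; first by move=> x /hab.
have [|P [Q [hPQ iso]]] := hd (set_coord n s0 x0); first by rewrite cat_env_set_coord.
have hx : P n < x0 < Q n by have := hPQ n (ltnSn n); rewrite set_coord_n.
have [|x [s [hx1 xx0 Ds hs]]] := acc _ _ P Q hx.
  by move=> i hi; have := hPQ i (ltnW hi); rewrite set_coord_lt.
case: xx0; have := iso (set_coord n s x) (in_box_set_coord hs hx1); rewrite cat_env_set_coord => /(_ Ds n (ltnSn n)).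
by rewrite !set_coord_n.
Qed.

Definition box_discrete n (T : ('I_n -> M) -> Prop) :=
  forall x : 'I_n -> M, T x -> exists p q : 'I_n -> M, (forall i, p i < x i < q i) /\
    forall y : 'I_n -> M, T y -> (forall i, p i < y i < q i) -> y = x.

Lemma discrete_finite n (T : ('I_n -> M) -> Prop) : Def (fun r => T (blk 0 r)) ->
  box_discrete T -> exists (S : nat -> 'I_n -> M) k, forall x : 'I_n -> M, T x -> exists j, (j < k)%N /\ x = S j.
Proof.
move=> hT dT; have [c0] : inhabited M := om_inh.
pose D r := T (blk 0 r); pose r0 : env := fun=> c0.
pose lift (x : 'I_n -> M) : env := fun i => if insub i is Some j then x j else c0.
have liftE (x : 'I_n -> M) (i : 'I_n) : lift x i = x i by rewrite /lift valK.
have blkE s : blk 0 (cat_env n s r0) = (fun i : 'I_n => s i).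
  by apply/funext => i; rewrite /blk /cat_env add0n ltn_ord.
have [|c hc] := @env_discrete_finite n D r0 hT.
  move=> s; rewrite /D blkE => Ts; have [p [q [hpq iso]]] := dT _ Ts.
  exists (lift p), (lift q); split=> [i hi|s' hs' Ts' i hi].
    by have := hpq (Ordinal hi); rewrite -!liftE.
  rewrite blkE in Ts'.
  have e : (fun i : 'I_n => s' i) = (fun i : 'I_n => s i).
    by apply: iso => // j; rewrite -!liftE; exact: hs'.
  exact: (congr1 (fun f => f (Ordinal hi)) e).
pose FT := {ffun 'I_n -> 'I_(size c)}.
exists (fun j i => if insub j is Some k then nth c0 c ((enum_val (k : 'I_#|FT|) : FT) i) else c0), #|FT|.
move=> x Tx.
have xc i : x i \in c.
  have := hc (lift x); rewrite /D blkE.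
  have -> : (fun i : 'I_n => lift x i) = x by apply/funext => j; rewrite liftE.
  by move=> /(_ Tx i (ltn_ord i)); rewrite liftE.
have hx i : (index (x i) c < size c)%N by rewrite index_mem.
pose phi : FT := [ffun i => Ordinal (hx i)].
exists (enum_rank phi); split; first exact: ltn_ord.
apply/funext => i; rewrite valK enum_rankK ffunE /=.
by rewrite nth_index.
Qed.

End Discrete.

(** * Formulas and uniform definability *)

Section Renaming.
Variable L : language.

Fixpoint tren n m (f : 'I_n -> 'I_m) (t : term L n) : term L m :=
  match t with
  | Var i => @Var L m (f i)
  | App k F a => App F (fun i => tren f (a i))
  end.

Definition ren_up n m (f : 'I_n -> 'I_m) : 'I_n.+1 -> 'I_m.+1 :=
  fun i => if unlift ord0 i is Some j then lift ord0 (f j) else ord0.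

Fixpoint fren n (phi : formula L n) : forall m, ('I_n -> 'I_m) -> formula L m :=
  match phi in formula _ n return forall m, ('I_n -> 'I_m) -> formula L m with
  | Bot _ => fun m _ => @Bot L m
  | Eq _ s t => fun m f => Eq (tren f s) (tren f t)
  | Rel _ _ R a => fun m f => Rel R (fun i => tren f (a i))
  | Imp _ p q => fun m f => Imp (fren p f) (fren q f)
  | All _ p => fun m f => All (fren p (ren_up f))
  end.

Lemma eval_ren (M : structure L) n m (f : 'I_n -> 'I_m) (e : 'I_m -> M) t :
  Defs.eval e (tren f t) = Defs.eval (fun i => e (f i)) t.
Proof. by elim: t => //= k F a IH; congr fun_interp; apply/funext => i. Qed.

Lemma scons_lift (M : structure L) n (x : M) (e : 'I_n -> M) i : scons x e (lift ord0 i) = e i.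
Proof. by rewrite /scons liftK. Qed.
Lemma scons_0 (M : structure L) n (x : M) (e : 'I_n -> M) : scons x e ord0 = x.
Proof. by rewrite /scons unlift_none. Qed.

Lemma sat_ren (M : structure L) n (phi : formula L n) m (f : 'I_n -> 'I_m) (e : 'I_m -> M) :
  sat (fren phi f) e <-> sat phi (fun i => e (f i)).
Proof.
elim: phi m f e => {n} [n|n s t|n k R a|n p IHp q IHq|n p IH] m f e //=.
- by rewrite !eval_ren.
- have -> // : (fun i => Defs.eval e (tren f (a i))) = (fun i => Defs.eval (fun i => e (f i)) (a i)).
  by apply/funext => i; rewrite eval_ren.
- by split=> h /IHp/h/IHq.
- have E x : (fun i => scons x e (ren_up f i)) = scons x (fun i => e (f i)).
    apply/funext => i; rewrite /ren_up {2}/scons.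
    by case: unliftP => [j|] _; rewrite ?scons_lift ?scons_0.
  by split=> h x; have := h x; rewrite IH E.
Qed.
End Renaming.

Section Uniform.
Context {L : language} {I : Type} {N : I -> structure L} {C : Type} {ci : C -> forall i, N i}.
Notation ienv i := (nat -> N i).
Implicit Types (P Q : forall i, ienv i -> Prop).

Definition value i (r : ienv i) (v : nat + C) : N i :=
  match v with inl k => r k | inr c => ci c i end.

(** Definability by one formula in all structures N i at once, with constants taken
    from C. One structure with all of its elements as constants gives definability
    with parameters; all structures with no constants give the sentences that can be
    transferred. *)
Definition udef P := exists n (phi : formula L n) (v : 'I_n -> nat + C),
  forall i (r : ienv i), P i r <-> sat phi (fun j => value r (v j)).

Lemma udef_ext P Q : (forall i r, P i r <-> Q i r) -> udef P -> udef Q.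
Proof. by move=> h [n [phi [v hv]]]; exists n, phi, v => i r; rewrite -h. Qed.

Lemma udef_bot : udef (fun _ _ => False).
Proof. by exists 0, (@Bot L 0), (fun _ => inl 0%N) => i r. Qed.

Lemma udef_imp P Q : udef P -> udef Q -> udef (fun i r => P i r -> Q i r).
Proof.
move=> [n [phi [v hv]]] [m [psi [w hw]]].
exists (n + m)%N, (Imp (fren phi (@lshift n m)) (fren psi (@rshift n m))),
  (fun j => match fintype.split j with inl a => v a | inr b => w b end) => i r /=.
rewrite hv hw !sat_ren.
have -> : (fun j => value r match fintype.split (lshift m j) with inl a => v a | inr b => w b end) =
          (fun j => value r (v j)).
  by apply/funext => j; have -> : fintype.split (lshift m j) = inl j by exact: (unsplitK (inl j)).
have -> // : (fun j => value r match fintype.split (rshift n j) with inl a => v a | inr b => w b end) =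
          (fun j => value r (w j)).
by apply/funext => j; have -> : fintype.split (rshift n j) = inr j by exact: (unsplitK (inr j)).
Qed.

Lemma udef_all P : udef P -> udef (fun i r => forall x, P i (x .: r)).
Proof.
move=> [n [phi [v hv]]].
(* Occurrences of the variable 0 become the bound variable; every other variable keeps
   a slot of its own under the quantifier. *)
pose g (j : 'I_n) : 'I_n.+1 := if v j is inl 0 then ord0 else lift ord0 j.
pose w (j : 'I_n) : nat + C := match v j with inl k => inl k.-1 | inr c => inr c end.
exists n, (All (fren phi g)), w => i r /=.
have E x : (fun j => scons x (fun j => value r (w j)) (g j)) = (fun j => value (x .: r) (v j)).
  apply/funext => j; rewrite /g /w; case e: (v j) => [[|k]|c].
  - by rewrite scons_0.
  - by rewrite scons_lift e.
  - by rewrite scons_lift e.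
by split=> h x; have := h x; rewrite sat_ren E hv.
Qed.

Lemma udef_lt0 : udef (fun i r => r 0%N < r 1%N).
Proof.
exists 2, (Rel (lt_symbol L) (fun j => @Var L 2 j)), (fun j => inl (val j)) => i r /=.
by rewrite (lt_interp (fun j : 'I_2 => r (val j))).
Qed.

(** A single variable or a constant, chosen uniformly in the structures. *)
Definition coord (f : forall i, ienv i -> N i) := exists v, forall i r, f i r = value r v.

Lemma udef_subst P (g : forall i, ienv i -> ienv i) : udef P ->
  (forall n, coord (fun i r => g i r n)) -> udef (fun i r => P i (g i r)).
Proof.
move=> [n [phi [v hv]]] /choice[w hw].
exists n, phi, (fun j => match v j with inl k => w k | inr c => inr c end) => i r.
rewrite hv; have -> // : (fun j => value (g i r) (v j)) = (fun j => value r
    match v j with inl k => w k | inr c => inr c end).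
by apply/funext => j; case: (v j) => //= k; rewrite hw.
Qed.

Lemma udef_sat n (phi : formula L n) (E : forall i, ienv i -> 'I_n -> N i) :
  (forall j, coord (fun i r => E i r j)) -> udef (fun i r => sat phi (E i r)).
Proof.
move=> /choice[w hw]; exists n, phi, w => i r.
by have -> : E i r = (fun j => value r (w j)) by apply/funext.
Qed.

Lemma udef_not P : udef P -> udef (fun i r => ~ P i r).
Proof. by move=> h; apply: udef_imp => //; exact: udef_bot. Qed.

Lemma udef_and P Q : udef P -> udef Q -> udef (fun i r => P i r /\ Q i r).
Proof.
move=> hP hQ; apply: udef_ext (udef_not (udef_imp hP (udef_not hQ))) => i r.
split=> [h|]; last by tauto.
by split; apply: contrapT => h'; tauto.
Qed.

Lemma udef_lt f g : coord f -> coord g -> udef (fun i r => f i r < g i r).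
Proof.
move=> hf hg; pose h i (r : ienv i) n := match n with 0 => f i r | _ => g i r end.
by apply: (udef_subst (g := h) udef_lt0) => -[|n].
Qed.

Lemma udef_eq f g : coord f -> coord g -> udef (fun i r => f i r = g i r).
Proof.
move=> hf hg; apply: udef_ext (udef_and (udef_not (udef_lt hf hg)) (udef_not (udef_lt hg hf))) => i r.
by split=> [[/negP h1 /negP h2]|->]; [case: ltgtP h1 h2|rewrite ltxx; split].
Qed.

Lemma udef_all_ord n (F : 'I_n -> forall i, ienv i -> Prop) : (forall j, udef (F j)) ->
  udef (fun i r => forall j, F j i r).
Proof.
move=> hF; suff h m : (m <= n)%N -> udef (fun i r => forall j : 'I_n, (j < m)%N -> F j i r).
  by apply: udef_ext (h n (leqnn n)) => i r; split=> // H j; exact: H.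
elim: m => [_|m IH mn]; first by apply: udef_ext (udef_not udef_bot) => i r; split=> [_ j|_ []].
apply: udef_ext (udef_and (hF (Ordinal mn)) (IH (ltnW mn))) => i r; split.
  move=> [h1 h2] j; rewrite ltnS leq_eqVlt => /orP[/eqP jm|]; last exact: h2.
  by have -> : j = Ordinal mn by exact: val_inj.
by move=> h; split=> [|j jm]; apply: h => //; exact: ltnW.
Qed.

Lemma udef_all_cat k P : udef P -> udef (fun i r => forall s : ienv i, P i (cat_env k s r)).
Proof.
elim: k P => [|k IH] P hP.
  apply: udef_ext hP => i r.
  have e s : cat_env 0 s r = r by apply/funext => j; rewrite /cat_env subn0.
  by split=> [h s|/(_ r)]; rewrite e.
apply: udef_ext (udef_all (IH P hP)) => i r; split=> [h s|h x s].
  by rewrite cat_envS.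
by have := h (fun j => if j == k then x else s j); rewrite cat_envS eqxx cat_env_upd.
Qed.

Lemma udef_all_tuple n (Q : forall i, ('I_n -> N i) -> ienv i -> Prop) :
  udef (fun i r => Q i (blk 0 r) (fun k => r (n + k)%N)) ->
  udef (fun i r => forall x, Q i x r).
Proof.
move=> h; apply: udef_ext (udef_all_cat n h) => i r.
have e s : (fun k => cat_env n s r (n + k)%N) = r.
  by apply/funext => k; rewrite /cat_env ltnNge leq_addr /= addKn.
split=> [H x|H s]; last by rewrite e.
have := H (fun j => if insub j is Some k then x k else r 0%N); rewrite e.
rewrite (_ : blk 0 _ = x) //; apply/funext => j.
by rewrite /blk /cat_env add0n ltn_ord valK.
Qed.

Lemma udef_ex_tuple n (Q : forall i, ('I_n -> N i) -> ienv i -> Prop) :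
  udef (fun i r => Q i (blk 0 r) (fun k => r (n + k)%N)) ->
  udef (fun i r => exists x, Q i x r).
Proof.
move=> h; have := udef_not (udef_all_tuple (Q := fun i x r => ~ Q i x r) (udef_not h)).
apply: udef_ext => i r; split=> [H|[x Qx] H]; last exact: (H x).
by apply: contrapT => H'; apply: H => x Qx; apply: H'; exists x.
Qed.

Lemma udef_support P : udef P -> exists n, forall i (r r' : ienv i),
  (forall k, (k < n)%N -> r k = r' k) -> P i r -> P i r'.
Proof.
move=> [n [phi [v hv]]].
exists (\max_(j < n) (if v j is inl k then k.+1 else 0))%N => i r r' h.
rewrite !hv; have -> // : (fun j => value r (v j)) = (fun j => value r' (v j)).
apply/funext => j; case e: (v j) => [k|//] /=; apply: h.
by have := @leq_bigmax _ (fun j => if v j is inl k then k.+1 else 0%N) j; rewrite e.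
Qed.
End Uniform.
Arguments udef {L I} N {C} ci P.
Arguments coord {L I} N {C} ci f.

(** * Boxes in the product of the order topologies *)

Local Open Scope classical_set_scope.

Section ProductBoxes.
Context {d : Order.disp_t} {T : orderType d} (n : nat).
Hypotheses (lo : forall x : T, exists y, y < x) (hi : forall x : T, exists y, x < y).

Lemma order_nbhs_itv (x : order_topology T) (V : set (order_topology T)) :
  nbhs x V -> exists a b : T, (a < (x : T) < b) /\ forall y : T, a < y < b -> V y.
Proof.
have [a0 a0x] := lo x; have [b0 xb0] := hi x.
rewrite itv_nbhsE => -[[l r] /= [oi xi] sub].
have [a [ax ha]] : exists a : T, a < (x : T) /\ forall y : T, a < y -> y <= (x : T) ->
    (Order.le l (BLeft y)).
  case: l oi xi {sub} => [[] t|[]] oi.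
  - by move: (itv_open_ends_lside oi).
  - rewrite in_itv => /andP[tx _]; by exists t.
  - by exists a0; split.
  - by move: (itv_open_ends_linfty oi).
have [b [xb hb]] : exists b : T, (x : T) < b /\ forall y : T, y < b -> (x : T) <= y ->
    (Order.le (BRight y) r).
  case: r oi xi {sub ha} => [[] t|[]] oi.
  - rewrite in_itv => /andP[_ tx]; by exists t.
  - by move: (itv_open_ends_rside oi).
  - by move: (itv_open_ends_rinfty oi).
  - by exists b0; split.
exists a, b; split=> [|y /andP[ay yb]]; first by rewrite ax.
apply: sub => /=; rewrite itv_boundlr; move: xi; rewrite itv_boundlr => /andP[lx xr].
apply/andP; split; case: (leP y x) => yx.
- exact: ha.
- by apply: le_trans lx _; rewrite bnd_simp; exact: ltW.
- by apply: le_trans xr; rewrite bnd_simp.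
- by apply: hb => //; exact: ltW.
Qed.

(** Boxes around x form a filter base; it converges to x because it does so in each
    coordinate, and hence it is finer than the neighbourhood filter. *)
Lemma product_nbhs_box (x : {ptws 'I_n -> order_topology T}) (V : set {ptws 'I_n -> order_topology T}) :
  nbhs x V -> exists p q : 'I_n -> T, (forall i, p i < (x i : T) < q i) /\
    forall y : 'I_n -> T, (forall i, p i < y i < q i) -> V y.
Proof.
pose D (pq : ('I_n -> T) * ('I_n -> T)) := forall i, pq.1 i < (x i : T) < pq.2 i.
pose B (pq : ('I_n -> T) * ('I_n -> T)) : set ('I_n -> T) :=
  [set y | forall i, pq.1 i < y i < pq.2 i].
have [p0 hp0] := choice lo; have [q0 hq0] := choice hi.
have FF : Filter (filter_from D B).
  apply: filter_from_filter.
    by exists (fun i => p0 (x i), fun i => q0 (x i)) => i /=; rewrite hp0 hq0.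
  move=> [p q] [p' q'] /= h h'.
  exists (fun i => Order.max (p i) (p' i), fun i => Order.min (q i) (q' i)).
    by move=> i /=; have := h i; have := h' i; rewrite /= gt_max lt_min; ord.
  move=> y /= hy; split=> i; have := hy i; rewrite /= gt_max lt_min; ord.
suff cv : filter_from D B --> (x : {ptws 'I_n -> order_topology T}).
  by move=> /cv [[p q] /= hpq sub]; exists p, q; split.
apply/cvg_sup => i A; rewrite nbhsE => -[W [[C oC <-] Cx] WA].
have [|a [b [xab hab]]] := @order_nbhs_itv (x i) C; first exact: open_nbhs_nbhs.
exists (fun j => if j == i then a else p0 (x j), fun j => if j == i then b else q0 (x j)).
  by move=> j /=; case: eqP => [->//|_]; rewrite hp0 hq0.
move=> y /= hy; apply: WA => /=; apply: hab.
by have := hy i; rewrite /= eqxx.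
Qed.
End ProductBoxes.

Lemma discrete_box (L : language) (M : structure L) n (A : set ('I_n -> M)) :
  discrete A -> box_discrete A.
Proof.
move=> dA x Ax; have xA : x \in A by exact: mem_set.
pose x' : set_type (A : set {ptws 'I_n -> order_topology M}) := SigSub xA.
have [V oV /seteqP[VU UV]] := dA [set x'].
have [p [q [hpq sub]]] := product_nbhs_box (@no_least _ M) (@no_greatest _ M)
  (open_nbhs_nbhs (conj oV (UV x' erefl))).
exists p, q; split=> // y Ay hy; have yA : y \in A by exact: mem_set.
have := VU (SigSub yA) (sub y hy) => /(congr1 val).
by [].
Qed.

(** * O-minimal structures and transfer *)

Lemma step_of_interval (L : language) (M : structure L) (A : set M) :
  point_or_open_interval A -> exists s : seq M, step A s.
Proof.
case=> [[a ->]|[i _ ->]].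
  exists [:: a] => x y xy h; apply/propext; split=> /= e; exfalso; apply: (h a); rewrite ?inE //.
    by ord.
  by ord.
case: i => l r.
have [sl hl] : exists s : seq M, forall x y : M, x < y -> (forall z, z \in s -> ~ (x <= z <= y)) ->
    (Order.le l (BLeft x)) = (Order.le l (BLeft y)).
  case: l => [b t|b]; last by exists [::] => x y _ _; case: b.
  exists [:: t] => x y xy h; have := h t; rewrite inE eqxx => /(_ isT) nt.
  case: b; rewrite !bnd_simp; apply/idP/idP => h1; apply: contrapT => /negP;
    rewrite -?ltNge -?leNgt => h2; try (by exfalso; ord); case: nt; ord.
have [sr hr] : exists s : seq M, forall x y : M, x < y -> (forall z, z \in s -> ~ (x <= z <= y)) ->
    (Order.le (BRight x) r) = (Order.le (BRight y) r).
  case: r => [b t|b]; last by exists [::] => x y _ _; case: b.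
  exists [:: t] => x y xy h; have := h t; rewrite inE eqxx => /(_ isT) nt.
  case: b; rewrite !bnd_simp; apply/idP/idP => h1; apply: contrapT => /negP;
    rewrite -?ltNge -?leNgt => h2; try (by exfalso; ord); case: nt; ord.
exists (sl ++ sr) => x y xy h; apply/propext; rewrite /= !itv_boundlr (hl x y) ?(hr x y) //.
  by move=> z zs; apply: h; rewrite mem_cat zs orbT.
by move=> z zs; apply: h; rewrite mem_cat zs.
Qed.

Section OMinimal.
Context {L : language} (N : structure L).

Definition pdef (P : (nat -> N) -> Prop) : Prop :=
  udef (fun _ : unit => N) (fun c _ => c) (fun _ => P).

Lemma pdef_sat n (phi : formula L n) (E : (nat -> N) -> 'I_n -> N) :
  (forall j, (exists k, forall r, E r j = r k) \/ (exists c, forall r, E r j = c)) ->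
  pdef (fun r => sat phi (E r)).
Proof.
move=> h; apply: (@udef_sat L unit (fun=> N) N (fun c _ => c) n phi (fun _ => E)) => j.
by case: (h j) => [[k hk]|[c hc]]; [exists (inl k)|exists (inr c)].
Qed.

Lemma o_minimal_family : o_minimal N -> omin_family pdef.
Proof.
move=> omN; have [c] := carrier_inhabited N; split.
- move=> x y /lt_dense[z [h1 h2]]; exists z; by rewrite h1.
- exact: no_least.
- exact: no_greatest.
- exact: carrier_inhabited.
- exact: udef_bot.
- move=> P Q; exact: udef_imp.
- move=> P; exact: udef_all.
- exact: udef_lt0.
- move=> P g hP hg; apply: (@udef_subst L unit (fun=> N) N (fun c _ => c) (fun _ => P) (fun _ => g) hP) => n.
  by case: (hg n) => [[k hk]|[e he]]; [exists (inl k)|exists (inr e)].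
- move=> P /udef_support[n hn]; exists n => r r' h; exact: (hn tt r r' h).
- move=> P [n [phi [v hv]]] r.
  pose b (j : 'I_n) : N := match v j with inl 0 => c | inl k.+1 => r k | inr e => e end.
  pose g (j : 'I_n) : 'I_(1 + n) :=
    if v j is inl 0 then lshift n (ord0 : 'I_1) else rshift 1 j.
  have E (x : 'I_1 -> N) : (fun j => value (N := fun _ : unit => N) (ci := fun c _ => c)
      (i := tt) (x ord0 .: r) (v j)) = (fun j => tuple_cat x b (g j)).
    apply/funext => j; rewrite /tuple_cat /g; case e: (v j) => [[|i]|i] /=.
    - by have -> : fintype.split (lshift n (ord0 : 'I_1)) = inl ord0 by exact: (unsplitK (inl _)).
    - by have -> : fintype.split (rshift 1 j) = inr j by [exact: (unsplitK (inr _))]; rewrite /b e.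
    - by have -> : fintype.split (rshift 1 j) = inr j by [exact: (unsplitK (inr _))]; rewrite /b e.
  have [|k [F [hF AE]]] := omN (fun x => P (x .: r)).
    exists n, (fren phi g), b; apply/seteqP.
    by split=> x /=; rewrite (hv tt) sat_ren E.
  have /choice[s hs] : forall i, exists s : seq N, step (F i) s.
    by move=> i; exact: step_of_interval (hF i).
  exists (flatten [seq s i | i <- enum 'I_k]) => x y xy h.
  have AEz z : P (z .: r) = (\bigcup_i F i) z by rewrite -AE.
  rewrite !AEz; apply/propext.
  have Fxy i : F i x = F i y.
    apply: hs => // z zs; apply: h; apply/flattenP; exists (s i) => //.
    by apply: map_f; rewrite mem_enum.
  by split=> -[i _ Fi]; exists i => //; [rewrite -Fxy|rewrite Fxy].
Qed.
End OMinimal.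

Section Transfer.
Context {L : language}.
Notation ci0 := (fun (c : void) (N : structure L) => match c with end : N).
Notation udef0 := (udef (fun N : structure L => N) ci0).

Fixpoint close n : formula L n -> formula L 0 :=
  if n is m.+1 then fun phi => close (All phi) else fun phi => phi.

Lemma models_close (N : structure L) n (phi : formula L n) :
  models N (close phi) <-> forall e : 'I_n -> N, sat phi e.
Proof.
elim: n phi => [|n IH] phi //=.
rewrite IH /=; split=> [h e|h e x]; last exact: h.
have -> : e = scons (e ord0) (fun i => e (lift ord0 i)); last exact: h.
apply/funext => i; rewrite /scons.
by case: unliftP => [j ->|->].
Qed.

(** The universal closure of the formula is a sentence true in all o-minimal
    structures. Its free variables are renamed by their own indices first, so that
    every assignment of them comes from a sequence. *)
Lemma transfer (P : forall N : structure L, (nat -> N) -> Prop) (M : structure L) :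
  udef0 P -> o_minimalistic M ->
  (forall N : structure L, o_minimal N -> forall r, P N r) -> forall r, P M r.
Proof.
move=> [n [phi [v hv]]] hM hP r.
pose w (j : 'I_n) : nat := match v j with inl k => k | inr c => match c with end end.
pose m := (\max_(j < n) (w j).+1)%N.
have wm j : (w j < m)%N by exact: (@leq_bigmax _ (fun j => (w j).+1) j).
pose psi := fren phi (fun j => Ordinal (wm j)).
have key (N : structure L) (e : nat -> N) : P N e <-> sat psi (fun i : 'I_m => e i).
  rewrite hv sat_ren; have -> // : (fun j => value (ci := ci0) e (v j)) = (fun j => e (w j)).
  by apply/funext => j; rewrite /w; case: (v j) => [k|[]].
have := hM (close psi) => /(_ _)/models_close h; apply/key/h => N oN.
apply/models_close => e; have [c] := carrier_inhabited N.
pose e' k := if insub k is Some i then e i else c.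
have -> : e = (fun i : 'I_m => e' i) by apply/funext => i; rewrite /e' valK.
by apply/key; exact: hP.
Qed.
End Transfer.

(** * The two first-order statements *)

Section Statements.
Context {d : Order.disp_t} {N : orderType d} (n : nat).
Notation tpl := ('I_n -> N).

(** Maps are treated as relations, which is how formulas present them. *)
Definition function_graph (Y : tpl -> Prop) (G : tpl -> tpl -> Prop) :=
  (forall x y : tpl, G x y -> Y x /\ Y y) /\
  ((forall x : tpl, Y x -> exists y : tpl, G x y) /\
   (forall x y y' : tpl, G x y -> G x y' -> y = y')).
Definition injective_graph (G : tpl -> tpl -> Prop) :=
  forall x x' y : tpl, G x y -> G x' y -> x = x'.
Definition surjective_graph (Y : tpl -> Prop) (G : tpl -> tpl -> Prop) :=
  forall y : tpl, Y y -> exists x : tpl, G x y.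
Definition injective_is_onto (Y : tpl -> Prop) (G : tpl -> tpl -> Prop) :=
  function_graph Y G -> injective_graph G ->
  box_discrete (fun y => Y y /\ ~ (exists x : tpl, G x y)) -> surjective_graph Y G.
Definition surjective_is_injective (Y : tpl -> Prop) (G : tpl -> tpl -> Prop) :=
  function_graph Y G -> box_discrete Y -> surjective_graph Y G -> injective_graph G.
End Statements.

Section OMinimalCase.
Context {L : language} {N : structure L} (oN : o_minimal N) (n : nat).
Let om : omin_family (@pdef L N) := o_minimal_family oN.
Existing Instance om.
Variables (Y : ('I_n -> N) -> Prop) (G : ('I_n -> N) -> ('I_n -> N) -> Prop).
Hypotheses (hY : pdef (fun r : nat -> N => Y (blk 0 r)))
  (hG : pdef (fun r : nat -> N => G (blk 0 r) (blk n r))).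

Lemma o_minimal_onto : injective_is_onto Y G.
Proof.
move=> [GY [tot fun_]] inj dT.
have hI : pdef (fun r : nat -> N => exists x, G x (blk 0 r)) by exact: def_ex_blk.
have hT : pdef (fun r : nat -> N => Y (blk 0 r) /\ ~ exists x, G x (blk 0 r)).
  exact: (def_and hY (def_not hI)).
have [S [k hS]] := discrete_finite (T := fun y => Y y /\ ~ exists x, G x y) hT dT.
by apply: (injection_onto (S := S) (k := k) hY hG) => // y Yy ny; apply: hS.
Qed.

(** The set is finite, so counting suffices. *)
Lemma o_minimal_injective : surjective_is_injective Y G.
Proof.
move=> [GY [tot fun_]] dY sur.
have [S [k hS]] := discrete_finite hY dY.
have : forall x, exists y, Y x -> G x y.
  by move=> x; have [/tot[y Gy]|nY] := pselect (Y x); [exists y|exists x].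
move=> /choice[g hg].
have gE x y : G x y -> g x = y by move=> Gxy; apply: fun_ (hg x (GY _ _ Gxy).1) Gxy.
move=> x x' y Gx Gx'.
apply: (finite_surj_inj hS (g := g)).
- by move=> z Yz; exact: (GY _ _ (hg z Yz)).2.
- by move=> z /sur[w Gw]; exists w; split; [exact: (GY _ _ Gw).1|exact: gE].
- exact: (GY _ _ Gx).1.
- exact: (GY _ _ Gx').1.
- by rewrite (gE _ _ Gx) (gE _ _ Gx').
Qed.
End OMinimalCase.

Section Formulas.
Context {L : language} (n m m' : nat) (phi : formula L (n + m)) (psi : formula L ((n + n) + m')).
Notation ci0 := (fun (c : void) (N : structure L) => match c with end : N).
Notation udef0 := (udef (fun N : structure L => N) ci0).

Definition phi_set (N : structure L) (r : nat -> N) (x : 'I_n -> N) : Prop :=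
  sat phi (tuple_cat x (fun j : 'I_m => r j)).
Definition psi_rel (N : structure L) (r : nat -> N) (x y : 'I_n -> N) : Prop :=
  sat psi (tuple_cat (tuple_cat x y) (fun j : 'I_m' => r (m + j)%N)).

Lemma udef_andb (f g : forall N : structure L, (nat -> N) -> bool) :
  udef0 (fun N r => f N r) -> udef0 (fun N r => g N r) -> udef0 (fun N r => f N r && g N r).
Proof. by move=> h h'; apply: udef_ext (udef_and h h') => N r; split=> [[-> ->]|/andP[]]. Qed.

Lemma udef_eq_tuple (f g : forall N : structure L, (nat -> N) -> 'I_n -> N) :
  (forall j, udef0 (fun N r => f N r j = g N r j)) -> udef0 (fun N r => f N r = g N r).
Proof.
move=> h; apply: udef_ext (udef_all_ord h) => N r.
by split=> [e|-> //]; apply/funext.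
Qed.

Ltac coords := let j := fresh "j" in intro j; unfold tuple_cat;
  repeat (case: (fintype.split _) => ?); eexists (inl _); intros; reflexivity.
Ltac coord1 := eexists (inl _); intros; reflexivity.
Ltac udefs := cbv beta; repeat (first
  [ apply: udef_sat; solve [coords]
  | apply: udef_and | apply: udef_andb | apply: udef_not
  | apply: udef_eq_tuple => ?; apply: udef_eq; solve [coord1]
  | apply: udef_lt; solve [coord1]
  | apply: udef_imp | apply: udef_ex_tuple | apply: udef_all_tuple
  | apply: udef_all_ord => ? ]; cbv beta).

Lemma udef_onto : udef0 (fun N r => injective_is_onto (phi_set r) (psi_rel r)).
Proof.
rewrite /injective_is_onto /function_graph /injective_graph /surjective_graph /box_discrete.
rewrite /phi_set /psi_rel.
udefs.
Qed.

Lemma udef_injective : udef0 (fun N r => surjective_is_injective (phi_set r) (psi_rel r)).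
Proof.
rewrite /surjective_is_injective /function_graph /injective_graph /surjective_graph /box_discrete.
rewrite /phi_set /psi_rel.
udefs.
Qed.
End Formulas.

(** * The proposition *)

Section Final.
Context {L : language} {M : structure L} (hM : o_minimalistic M) (n : nat).
Implicit Types (Y : set ('I_n -> M)) (f : ('I_n -> M) -> ('I_n -> M)).

Lemma tuple_cat_inj k l (x x' : 'I_k -> M) (y y' : 'I_l -> M) :
  tuple_cat x y = tuple_cat x' y' -> x = x' /\ y = y'.
Proof.
move=> e; split; apply/funext => j.
  have := congr1 (fun h => h (lshift l j)) e; rewrite /tuple_cat.
  by have -> : fintype.split (lshift l j) = inl j by exact: (unsplitK (inl j)).
have := congr1 (fun h => h (rshift k j)) e; rewrite /tuple_cat.
by have -> : fintype.split (rshift k j) = inr j by exact: (unsplitK (inr j)).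
Qed.

Definition graph_of Y f (x y : 'I_n -> M) := Y x /\ y = f x.

Lemma graph_ofE Y f x y : graph_on Y f (tuple_cat x y) <-> graph_of Y f x y.
Proof.
split=> [[x' Yx' /tuple_cat_inj[-> ->]]//|[Yx ->]]; by exists x.
Qed.

(** The parameters of the two formulas are placed one after the other in a single
    sequence. *)
Lemma definable_pair Y f : definable Y -> definable_map Y Y f ->
  exists m m' (phi : formula L (n + m)) (psi : formula L ((n + n) + m')) (r : nat -> M),
    (Y : ('I_n -> M) -> Prop) = phi_set phi r /\ graph_of Y f = psi_rel m psi r.
Proof.
move=> [m [phi [b eY]]] [_ [m' [psi [b' eG]]]].
have [c] := carrier_inhabited M.
exists m, m', phi, psi, (fun k => if insub k is Some i then b i else
  if insub (k - m)%N is Some i then b' i else c).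
split.
  rewrite {1}eY; apply/funext => x; rewrite /phi_set /=; congr (sat phi (tuple_cat x _)).
  by apply/funext => j; rewrite valK.
apply/funext => x; apply/funext => y; apply/propext; rewrite -graph_ofE eG /psi_rel /=.
have -> // : (fun j : 'I_m' => if insub (m + j)%N is Some i then b (i : 'I_m) else
   if insub (m + j - m)%N is Some i then b' i else c) = b'.
apply/funext => j; rewrite insubF; last by rewrite ltnNge leq_addr.
by rewrite addKn valK.
Qed.

Lemma graph_of_function Y f : set_fun Y Y f -> function_graph Y (graph_of Y f).
Proof.
move=> fY; split; first by move=> x y [Yx ->]; split=> //; exact: fY.
by split=> [x Yx|x y y' [_ ->] [_ ->]//]; exists (f x).
Qed.

Lemma graph_of_inj Y f : injective_graph (graph_of Y f) <-> set_inj Y f.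
Proof.
split=> [h x x' /set_mem Yx /set_mem Yx' e|h x x' y [Yx ->] [Yx' e]].
  by apply: (h x x' (f x)); split.
by apply: h => //; exact: mem_set.
Qed.

Lemma graph_of_surj Y f : surjective_graph Y (graph_of Y f) <-> set_surj Y Y f.
Proof.
split=> [h y Yy|h y Yy]; first by have [x [Yx ->]] := h y Yy; exists x.
by have [x Yx e] := h y Yy; exists x.
Qed.

Lemma box_discrete_onto Y f : definable Y -> definable_map Y Y f -> set_inj Y f ->
  box_discrete (Y `\` f @` Y : set _) -> set_surj Y Y f.
Proof.
move=> dY df inj dc; have [m [m' [phi [psi [r [eY eG]]]]]] := definable_pair dY df.
apply/graph_of_surj.
have H : injective_is_onto Y (graph_of Y f).
  rewrite {1}eY eG; apply: (transfer (udef_onto phi psi) hM) => N oN q.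
  apply: o_minimal_onto => //; rewrite /phi_set /psi_rel; apply: pdef_sat => j;
    rewrite /tuple_cat; repeat (case: (fintype.split _) => ?);
    (left; eexists; intros; reflexivity) || (right; eexists; intros; reflexivity).
apply: H; [exact: graph_of_function df.1|exact/graph_of_inj|].
move=> y [Yy ny]; have [|p [q [h1 h2]]] := dc y.
  by split=> // -[x Yx e]; apply: ny; exists x.
exists p, q; split=> // z [Yz nz] hz; apply: h2 => //; split=> // -[x Yx e].
by apply: nz; exists x.
Qed.

Lemma box_discrete_inj Y f : definable Y -> definable_map Y Y f ->
  box_discrete (Y : set _) -> set_surj Y Y f -> set_inj Y f.
Proof.
move=> dY df dc sj; have [m [m' [phi [psi [r [eY eG]]]]]] := definable_pair dY df.
apply/graph_of_inj.
have H : surjective_is_injective Y (graph_of Y f).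
  rewrite {1}eY eG; apply: (transfer (udef_injective phi psi) hM) => N oN q.
  apply: o_minimal_injective => //; rewrite /phi_set /psi_rel; apply: pdef_sat => j;
    rewrite /tuple_cat; repeat (case: (fintype.split _) => ?);
    (left; eexists; intros; reflexivity) || (right; eexists; intros; reflexivity).
by apply: H => //; [exact: graph_of_function df.1|exact/graph_of_surj].
Qed.
End Final.

Theorem proposition12p6 (L : language) (M : structure L)
    (hM : o_minimalistic M) :
  (forall (n : nat) (Y : set ('I_n -> M)) (f : ('I_n -> M) -> ('I_n -> M)),
      definable Y -> definable_map Y Y f -> set_inj Y f ->
      discrete (Y `\` f @` Y) -> set_bij Y Y f) /\
  (forall (n : nat) (D : set ('I_n -> M)) (g : ('I_n -> M) -> ('I_n -> M)),
      definable D -> discrete D -> definable_map D D g ->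
      (set_inj D g <-> set_surj D D g)).
Proof.
split=> [n Y f dY df inj dc|n D g dD dc dg].
  split=> //; first exact: df.1.
  by apply: box_discrete_onto => //; exact: discrete_box.
have bD := discrete_box dc.
split=> [inj|]; last exact: box_discrete_inj.
apply: box_discrete_onto => // y [Dy _]; have [p [q [h1 h2]]] := bD y Dy.
by exists p, q; split=> // z [Dz _]; exact: h2.
Qed.
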